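(* Let $X$ and $Y$ be nonzero real Banach lattices. The following are equivalent: (i) Every $R$-bounded family $\mathscr{T}\subseteq\mathcal{L}(X,Y)$ is $\ell^2$-bounded. (ii) Every $\gamma$-bounded family $\mathscr{T}\subseteq\mathcal{L}(X,Y)$ is $\ell^2$-bounded. (iii) $X$ has finite cotype. In this case there is a constant $C_X$ depending only on $X$ such that $\mathcal{R}^2(\mathscr{T})\le C_X\mathcal{R}(\mathscr{T})$ and $C_X^{-1}\mathcal{R}(\mathscr{T})\le\mathcal{R}^\gamma(\mathscr{T})\le C_X\mathcal{R}(\mathscr{T})$ for all $\mathscr{T}\subseteq\mathcal{L}(X,Y)$.
   Context: $(r_n)$ Rademacher sequence, $(\gamma_n)$ independent standard Gaussians. $R$-bound $\mathcal{R}(\mathscr{T})$: least $C$ with $(\mathbb{E}\|\sum_{n=1}^N r_nT_nx_n\|^2)^{1/2}\le C(\mathbb{E}\|\sum_{n=1}^N r_nx_n\|^2)^{1/2}$ for all $N$, $x_n\in X$, $T_n\in\mathscr{T}$ (not necessarily distinct); $\gamma$-bound $\mathcal{R}^\gamma(\mathscr{T})$ likewise with $(\gamma_n)$; $\ell^2$-bound $\mathcal{R}^2(\mathscr{T})$: least $C$ with $\|(\sum_{n=1}^N|T_nx_n|^2)^{1/2}\|\le C\|(\sum_{n=1}^N|x_n|^2)^{1/2}\|$ (square functions via Krivine's calculus). A family is $R$-, $\gamma$-, $\ell^2$-bounded if the respective bound is finite. $X$ has finite cotype if for some $q<\infty$, $(\sum\|x_n\|^q)^{1/q}\le C\|\sum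 r_nx_n\|_{L^q(\Omega;X)}$ for all finite sequences. *)

(* Defs.v *)
From HB Require Import structures.
From mathcomp Require Import all_boot all_order all_algebra.
From mathcomp Require Import all_classical all_reals all_analysis.
Set Implicit Arguments. Unset Strict Implicit. Unset Printing Implicit Defensive.
Import Order.TTheory GRing.Theory Num.Theory.
Import numFieldNormedType.Exports.
Local Open Scope classical_set_scope.
Local Open Scope ring_scope.

Section Defs.
Variable R : realType.

Record banach_lattice (X : completeNormedModType R) := BanachLattice {
  bl_le : X -> X -> Prop;
  bl_join : X -> X -> X;
  bl_refl : forall x, bl_le x x;
  bl_antisym : forall x y, bl_le x y -> bl_le y x -> x = y;
  bl_trans : forall x y z, bl_le x y -> bl_le y z -> bl_le x z;
  bl_add : forall x y z, bl_le x y -> bl_le (x + z) (y + z);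
  bl_scale : forall (a : R) x y, 0 <= a -> bl_le x y -> bl_le (a *: x) (a *: y);
  bl_join_l : forall x y, bl_le x (bl_join x y);
  bl_join_r : forall x y, bl_le y (bl_join x y);
  bl_join_lub : forall x y z, bl_le x z -> bl_le y z -> bl_le (bl_join x y) z;
  bl_norm_mono : forall x y, bl_le (bl_join x (- x)) (bl_join y (- y)) ->
                             `|x| <= `|y|
}.

Definition nonzero_space (X : completeNormedModType R) := exists x : X, x != 0.

Definition bounded_linear (X Y : completeNormedModType R) (T : X -> Y) : Prop :=
  (forall (a : R) (x y : X), T (a *: x + y) = a *: T x + T y) /\
  exists C : R, forall x, `|T x| <= C * `|x|.

Definition sgn (b : bool) : R := if b then 1 else -1.

Definition rad_mean (N : nat) (F : (nat -> R) -> R) : R :=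
  (2 ^+ N)^-1 * \sum_(e : {ffun 'I_N -> bool})
     F (fun n => if @insub nat (fun k => k < N)%N 'I_N n is Some i then sgn (e i) else 0).

(* Gaussian expectation E F(g_0,...,g_{N-1}) for independent standard Gaussians,
   as the iterated integral against the standard normal density
   (used for nonnegative integrands only). *)
Fixpoint gauss_mean (N : nat) (F : (nat -> R) -> \bar R) : \bar R :=
  match N with
  | 0 => F (fun _ => 0)
  | N'.+1 => (\int[@lebesgue_measure R]_(t in setT)
       ((normal_pdf 0 1 t)%:E *
        gauss_mean N' (fun g => F (fun n => if n == N' then t else g n))))%E
  end.

Definition rad_sum (X : completeNormedModType R) N (x : 'I_N -> X) (g : nat -> R) : X :=
  \sum_(i < N) g (nat_of_ord i) *: x i.

Definition rad_norm (X : completeNormedModType R) N (x : 'I_N -> X) : R :=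
  Num.sqrt (rad_mean N (fun g => `|rad_sum x g| ^+ 2)).

Definition gauss_norm2 (X : completeNormedModType R) N (x : 'I_N -> X) : \bar R :=
  gauss_mean N (fun g => (`|rad_sum x g| ^+ 2)%:E).

(* s = (sum_n |x_n|^2)^{1/2} in the sense of Krivine's calculus, i.e.
   s = sup { sum_n a_n x_n : sum_n a_n^2 <= 1 } in the lattice order. *)
Definition is_sqfun (X : completeNormedModType R) (L : banach_lattice X)
    N (x : 'I_N -> X) (s : X) : Prop :=
  (forall a : 'I_N -> R, \sum_(i < N) a i ^+ 2 <= 1 ->
      bl_le L (\sum_(i < N) a i *: x i) s) /\
  (forall u : X, (forall a : 'I_N -> R, \sum_(i < N) a i ^+ 2 <= 1 ->
      bl_le L (\sum_(i < N) a i *: x i) u) -> bl_le L s u).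

Section Bounds.
Variables (X Y : completeNormedModType R).

Definition R_bounded_by (TT : set (X -> Y)) (C : R) : Prop :=
  forall N (x : 'I_N -> X) (T : 'I_N -> X -> Y), (forall i, TT (T i)) ->
    rad_norm (fun i => T i (x i)) <= C * rad_norm x.

Definition gamma_bounded_by (TT : set (X -> Y)) (C : R) : Prop :=
  forall N (x : 'I_N -> X) (T : 'I_N -> X -> Y), (forall i, TT (T i)) ->
    (gauss_norm2 (fun i => T i (x i)) <= (C ^+ 2)%:E * gauss_norm2 x)%E.

Definition l2_bounded_by (LX : banach_lattice X) (LY : banach_lattice Y)
    (TT : set (X -> Y)) (C : R) : Prop :=
  forall N (x : 'I_N -> X) (T : 'I_N -> X -> Y), (forall i, TT (T i)) ->
    forall s t, is_sqfun LY (fun i => T i (x i)) s -> is_sqfun LX x t ->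
      `|s| <= C * `|t|.

Definition Rbound (TT : set (X -> Y)) : \bar R :=
  ereal_inf [set C%:E | C in [set C : R | 0 <= C /\ R_bounded_by TT C]].
Definition Gbound (TT : set (X -> Y)) : \bar R :=
  ereal_inf [set C%:E | C in [set C : R | 0 <= C /\ gamma_bounded_by TT C]].
Definition L2bound (LX : banach_lattice X) (LY : banach_lattice Y)
    (TT : set (X -> Y)) : \bar R :=
  ereal_inf [set C%:E | C in [set C : R | 0 <= C /\ l2_bounded_by LX LY TT C]].

Definition R_bounded TT := exists C, R_bounded_by TT C.
Definition gamma_bounded TT := exists C, gamma_bounded_by TT C.
Definition l2_bounded LX LY TT := exists C, l2_bounded_by LX LY TT C.
End Bounds.

Definition finite_cotype (X : completeNormedModType R) : Prop :=
  exists q : R, 2 <= q /\ exists C : R, forall N (x : 'I_N -> X),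
    powR (\sum_(i < N) powR `|x i| q) q^-1 <=
    C * powR (rad_mean N (fun g => powR `|rad_sum x g| q)) q^-1.

End Defs.

(* Main.v *)
From mathcomp.real_closed Require complex.
Require Import Defs.
From HB Require Import structures.
From mathcomp Require Import all_boot all_order all_algebra.
From mathcomp Require Import all_classical all_reals all_analysis.
From mathcomp Require Import ring lra measurable_realfun.
Set Implicit Arguments. Unset Strict Implicit. Unset Printing Implicit Defensive.
Import Order.TTheory GRing.Theory Num.Theory.
Import numFieldNormedType.Exports.
Local Open Scope classical_set_scope.
Local Open Scope ring_scope.

(** The square function of [x] is dominated by the Rademacher mean of [x] in every
    Banach lattice, by Riesz products with imaginary coefficients.  If [X] has finite
    cotype, it also dominates the Gaussian mean (Khintchine-Maurey): finite cotype
    gives [\sum_i |f_i|^q <= C |t|^q] whenever [f_i >= 0] and [\sum_i f_i <= t], and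
    cutting [|\sum_n g_n x_n|] at the levels [k t], [t] the square function, gives
    slabs whose means decay exponentially.  As R-bounded families are gamma-bounded
    (condition on the moduli of the Gaussians), (iii) implies (ii), (ii) implies (i),
    and the constants depend only on [X].

    If [X] has no finite cotype, concavity fails for every [q], so [X] contains
    positive copies of [l_infty^m] for all [m], with biorthogonal functionals [phi_i].
    Index these by the cyclic group of order [m] and, for [y <> 0] in [Y], put
    [T_g = m^-1 \sum_i h (g + i) phi_i (.) y], where [h i] is of the order of
    [sqrt (m / (i + 1))] for [i < sqrt m] and [0] beyond.  The vectors
    [z_g = c \sum_i h (g + i) x_i], normalised so that [\sum_i x_i] dominates their
    square function, show that the l2-bound of [(T_g)_g] is at least of the order of
    the square root of a harmonic sum.  The R-bound stays bounded by Riesz products once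
    more: each [h] lies in weak [L^2] uniformly in [m], so [i |-> a_n h (g_n + i)] can be
    realised as the correlation with [r_n] of nonnegative kernels indexed by [i] whose
    average over [i] is bounded in mean square.  A union of small multiples of such
    families is R-bounded but not l2-bounded. *)

(** The lattice is never represented by functions. A lattice inequality is proved by unfolding joins
    until only linear combinations of the [x n] remain, which are compared with an upper bound of
    the set that defines the square function. Unfolding handles finite sums only, so Gaussians are
    replaced by a finitely supported law whose means of even convex functions dominate theirs;
    averaging over signs makes the integrand even and convex in each coordinate.

    Slabs have means of size [d * t] with [d] small, so concavity is needed for weighted families,
    with a bound linear in [d]. Bare concavity gives a power of the multiplicity, which blows up
    when fractional weights are rounded to integers; the extremal argument restores linearity.

    The profile [h] meets three demands: its mean square [l] is unbounded (large l2-bound), its weak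
    L^2 norm is bounded (kernels of bounded average), and its squared mean is at most of order
    [e^-l], because kernels at two points may be correlated by a factor [e^l]. The cut at
    [M = sqrt m] yields the last: [e^l] is of order [M] and the mean is at most [2 / sqrt M]. *)

(** * Calculus in Banach lattices *)

Section VectorLattice.
Variables (R : realType) (X : completeNormedModType R) (L : banach_lattice X).
Implicit Types (x y z s t : X) (a b c : R).

Local Notation "x <=l y" := (bl_le L x y) (at level 70, no associativity).
Definition vmeet x y := - bl_join L (- x) (- y).
Definition vabs x := bl_join L x (- x).
Definition vpos x := bl_join L x 0.

Lemma vle_refl x : x <=l x. Proof. exact: bl_refl. Qed.
Lemma vle_trans y x z : x <=l y -> y <=l z -> x <=l z.
Proof. exact: bl_trans. Qed.

Lemma vleD2r z x y : (x + z <=l y + z) <-> (x <=l y).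
Proof.
split=> [H|]; last exact: bl_add.
by have := bl_add (- z) H; rewrite !addrK.
Qed.

Lemma vleD2l z x y : (z + x <=l z + y) <-> (x <=l y).
Proof. by rewrite ![z + _]addrC; exact: vleD2r. Qed.

Lemma vleD x y z t : x <=l y -> z <=l t -> x + z <=l y + t.
Proof. by move=> xy zt; apply: (@vle_trans (y + z)); [apply/vleD2r|apply/vleD2l]. Qed.

Lemma vsub_ge0 x y : (0 <=l y - x) <-> (x <=l y).
Proof. by rewrite -(vleD2r x) add0r subrK. Qed.

Lemma vleN x y : x <=l y -> - y <=l - x.
Proof. by move=> xy; apply/vsub_ge0; rewrite opprK addrC; apply/vsub_ge0. Qed.

Lemma vle_subl_addr x y z : (x - y <=l z) <-> (x <=l z + y).
Proof. by rewrite -(vleD2r y) subrK. Qed.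

Lemma vle_subr_addr x y z : (x <=l y - z) <-> (x + z <=l y).
Proof. by rewrite -(vleD2r z) subrK. Qed.

Lemma vscale_ge0 a x : 0 <= a -> 0 <=l x -> 0 <=l a *: x.
Proof. by move=> a0 /(bl_scale a0); rewrite scaler0. Qed.

Lemma vscaler_le a x y : 0 <= a -> x <=l y -> a *: x <=l a *: y.
Proof. exact: bl_scale. Qed.

Lemma vscalel_le a b x : a <= b -> 0 <=l x -> a *: x <=l b *: x.
Proof.
by move=> ab x0; apply/vsub_ge0; rewrite -scalerBl; apply: vscale_ge0; rewrite ?subr_ge0.
Qed.

Lemma vle_sum (I : Type) (r : seq I) (P : pred I) (F G : I -> X) :
  (forall i, P i -> F i <=l G i) ->
  \sum_(i <- r | P i) F i <=l \sum_(i <- r | P i) G i.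
Proof.
move=> FG; elim/big_ind2 : _ => //; first exact: vle_refl.
by move=> *; exact: vleD.
Qed.

Lemma vsum_ge0 (I : Type) (r : seq I) (P : pred I) (F : I -> X) :
  (forall i, P i -> 0 <=l F i) -> 0 <=l \sum_(i <- r | P i) F i.
Proof.
by move=> F0; have := @vle_sum I r P (fun=> 0) F F0; rewrite big1.
Qed.

Lemma vjoinP x y z : (bl_join L x y <=l z) <-> (x <=l z) /\ (y <=l z).
Proof.
split=> [H|[]]; last exact: bl_join_lub.
by split; apply: vle_trans H; [exact: bl_join_l|exact: bl_join_r].
Qed.

Lemma vmeetP x y z : (z <=l vmeet x y) <-> (z <=l x) /\ (z <=l y).
Proof.
rewrite /vmeet; split=> [H|[zx zy]].
  have /vleN := H; rewrite opprK => /vjoinP[/vleN + /vleN].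
  by rewrite !opprK.
by rewrite -[z]opprK; apply/vleN/vjoinP; split; exact: vleN.
Qed.

Lemma vmeet_l x y : vmeet x y <=l x.
Proof. by have /vmeetP[] := vle_refl (vmeet x y). Qed.
Lemma vmeet_r x y : vmeet x y <=l y.
Proof. by have /vmeetP[] := vle_refl (vmeet x y). Qed.

Lemma vmeet_eql x y : x <=l y -> vmeet x y = x.
Proof.
move=> xy; apply: (bl_antisym (b:=L)); first exact: vmeet_l.
by apply/vmeetP; split=> //; exact: vle_refl.
Qed.

Lemma vmeetC x y : vmeet x y = vmeet y x.
Proof.
by apply: (bl_antisym (b:=L)); apply/vmeetP; split; exact: vmeet_l || exact: vmeet_r.
Qed.

Lemma vmeet_eqr x y : y <=l x -> vmeet x y = y.
Proof. by rewrite vmeetC; exact: vmeet_eql. Qed.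

Lemma vmeetDr x y z : vmeet (x + z) (y + z) = vmeet x y + z.
Proof.
apply: (bl_antisym (b:=L)).
  by rewrite -[X in X <=l _](subrK z); apply/vleD2r/vmeetP; split;
     apply/vle_subl_addr; [exact: vmeet_l|exact: vmeet_r].
by apply/vmeetP; split; apply/vleD2r; [exact: vmeet_l|exact: vmeet_r].
Qed.

Lemma vabsP x y : (vabs x <=l y) <-> (x <=l y) /\ (- x <=l y).
Proof. exact: vjoinP. Qed.

Lemma vle_abs x : x <=l vabs x. Proof. exact: bl_join_l. Qed.
Lemma vleN_abs x : - x <=l vabs x. Proof. exact: bl_join_r. Qed.

Lemma vge0_double x : 0 <=l x + x -> 0 <=l x.
Proof.
move=> H; have /(@vscale_ge0 2^-1) := H.
have -> : 2^-1 *: (x + x) = x by rewrite scalerDr -scalerDl -[LHS]scale1r scalerA; rewrite (_ : 1 * _ = 1) ?scale1r//; lra.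
by apply; rewrite invr_ge0.
Qed.

Lemma vabs_ge0 x : 0 <=l vabs x.
Proof.
by apply: vge0_double; rewrite -(subrr x); apply: vleD; [exact: vle_abs|exact: vleN_abs].
Qed.

Lemma vge0N x : 0 <=l x -> - x <=l x.
Proof. by move=> x0; apply: (@vle_trans 0) => //; rewrite -oppr0; exact: vleN. Qed.

Lemma vabs_id x : 0 <=l x -> vabs x = x.
Proof.
move=> x0; apply: (bl_antisym (b:=L)); last exact: vle_abs.
by apply/vabsP; split; [exact: vle_refl|exact: vge0N].
Qed.

Lemma vnorm_abs x : `|vabs x| = `|x|.
Proof.
by apply/le_anti/andP; split; apply: (@bl_norm_mono _ _ L); rewrite -!/(vabs _);
  rewrite (vabs_id (vabs_ge0 x)); exact: vle_refl.
Qed.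

Lemma vnorm_le x y : x <=l y -> - x <=l y -> `|x| <= `|y|.
Proof.
move=> xy nxy; apply: (@bl_norm_mono _ _ L); rewrite -!/(vabs _).
by apply: (@vle_trans y); [apply/vabsP|exact: vle_abs].
Qed.

Lemma vnorm_le0 x y : 0 <=l x -> x <=l y -> `|x| <= `|y|.
Proof.
by move=> x0 xy; apply: vnorm_le => //; apply: vle_trans xy; exact: vge0N.
Qed.

Lemma vscale_le_abs a x : a *: x <=l `|a| *: vabs x.
Proof.
case: (ger0P a) => a0; first by apply: vscaler_le => //; exact: vle_abs.
rewrite -[a in a *: _]opprK scaleNr -scalerN; apply: vscaler_le; first by rewrite oppr_ge0 ltW.
exact: vleN_abs.
Qed.

Lemma vpos_ge0 x : 0 <=l vpos x. Proof. exact: bl_join_r. Qed.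
Lemma vle_pos x : x <=l vpos x. Proof. exact: bl_join_l. Qed.
Lemma vposP x y : 0 <=l y -> x <=l y -> vpos x <=l y.
Proof. by move=> y0 xy; apply/vjoinP. Qed.

(* The positive cone is norm closed: the negative part of [v] is dominated
   by [w - v] for every [w >= 0]. *)
Lemma vge0_closed v :
  (forall e, 0 < e -> exists2 w, 0 <=l w & `|w - v| <= e) -> 0 <=l v.
Proof.
move=> H.
have nv0 : `|vpos (- v)| <= 0.
  apply/ler_addgt0Pl => e e0; rewrite addr0; have [w w0 wv] := H e e0.
  apply: le_trans wv; rewrite -(vnorm_abs (w - v)).
  apply: vnorm_le0; first exact: vpos_ge0.
  apply: vposP; first exact: vabs_ge0.
  apply: (@vle_trans (w - v)); last exact: vle_abs.
  by rewrite -{1}[- v]add0r; apply/vleD2r.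
have /eqP nv : vpos (- v) == 0 by rewrite -normr_le0.
by have := vle_pos (- v); rewrite nv => /vleN; rewrite opprK oppr0.
Qed.

Lemma vle_closed x v :
  (forall e, 0 < e -> exists2 w, x <=l w & `|w - v| <= e) -> x <=l v.
Proof.
move=> H; apply/vsub_ge0/vge0_closed => e /H[w xw wv].
exists (w - x); first exact/vsub_ge0.
by rewrite opprB addrA subrK.
Qed.

Lemma vge_closed x v :
  (forall e, 0 < e -> exists2 w, w <=l x & `|w - v| <= e) -> v <=l x.
Proof.
move=> H; apply/vsub_ge0/vge0_closed => e /H[w xw wv].
exists (x - w); first exact/vsub_ge0.
by rewrite opprB addrC addrA subrK -normrN opprB.
Qed.

Lemma vmeet_addlP x y z w : (z <=l w + vmeet x y) <-> (z <=l w + x) /\ (z <=l w + y).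
Proof. by rewrite ![w + _]addrC -vmeetDr; exact: vmeetP. Qed.

Lemma vmeet_diff_le s u v : u <=l v -> vmeet s v - vmeet s u <=l v - u.
Proof.
move=> ab; apply/vle_subl_addr/vmeet_addlP; split; last by rewrite subrK; exact: vmeet_r.
apply: (@vle_trans s); first exact: vmeet_l.
by rewrite -{1}[s]add0r; apply/vleD2r/vsub_ge0.
Qed.

(** For numbers, the part of [s] between the levels [u] and [v] grows with [s]. Here both sides
    become sums of two meets, and the four pairs of terms on the right are checked one by one. *)
Lemma vmeet_diff_mono s s' u v : u <=l v -> s <=l s' ->
  vmeet s v - vmeet s u <=l vmeet s' v - vmeet s' u.
Proof.
move=> ab ss.
suff H : vmeet s v + vmeet s' u <=l vmeet s u + vmeet s' v.
  by apply/vle_subl_addr; rewrite addrAC; apply/vle_subr_addr; rewrite [X in _ <=l X]addrC.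
have Ps := vmeet_l s v; have Pv := vmeet_r s v.
have Qs := vmeet_l s' u; have Qu := vmeet_r s' u.
apply/vmeet_addlP; split; rewrite [X in _ <=l X]addrC; apply/vmeet_addlP; split.
- by rewrite [X in _ <=l X]addrC; exact: vleD.
- by apply: vleD => //; exact: vle_trans ss.
- by rewrite [X in _ <=l X]addrC; apply: vleD => //; exact: vle_trans ab.
- exact: vleD.
Qed.

Lemma vmeet_diff_ge0 s u v : u <=l v -> 0 <=l vmeet s v - vmeet s u.
Proof.
move=> uv; apply/vsub_ge0/vmeetP; split; first exact: vmeet_l.
by apply: vle_trans uv; exact: vmeet_r.
Qed.

Lemma vmeet_diff_pos s u v : vmeet s v - vmeet s u <=l vpos (s - u).
Proof.
apply/vle_subl_addr/vmeet_addlP; split.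
  apply: (@vle_trans s); first exact: vmeet_l.
  by rewrite -{1}[s]add0r; apply/vleD2r; exact: vpos_ge0.
by apply: (@vle_trans s); [exact: vmeet_l | apply/vle_subl_addr; exact: vle_pos].
Qed.

End VectorLattice.

(** * Concavity on positive families *)

(** The tangent of the convex power at [b]. It serves twice: for Jensen's inequality and for the
    extremal argument on decompositions. *)
Lemma expr_tangent (R : realFieldType) (q : nat) (a b : R) : 0 <= a -> 0 <= b ->
  b ^+ q.+1 + q.+1%:R * b ^+ q * (a - b) <= a ^+ q.+1.
Proof.
move=> a0 b0; elim: q => [|q IH]; first by rewrite !expr1 expr0; lra.
have := ler_wpM2l a0 IH; rewrite -exprS; apply: le_trans.
have h : 0 <= q.+1%:R * b ^+ q * (a - b) ^+ 2.
  by apply: mulr_ge0; [rewrite mulr_ge0 ?exprn_ge0|exact: sqr_ge0].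
rewrite -subr_ge0; apply: le_trans h _; rewrite le_eqVlt; apply/orP; left; apply/eqP.
rewrite [q.+2%:R]mulrSr !exprS; ring.
Qed.

Section Stack.
Variables (R : realType) (X : completeNormedModType R) (L : banach_lattice X).
Local Notation "x <=l y" := (bl_le L x y) (at level 70, no associativity).
Local Notation vmeet := (vmeet L).

Section Layers.
Variables (t : X) (H : nat -> X).
Hypothesis H_mono : forall l, H l <=l H l.+1.

(** The multiples of [t] cut the range of [s] into [M] periods, and each period is subdivided by the
    levels [H]. Layer [l] collects what [s] has in the [l]-th subdivision of all periods, that is,
    in the [l]-th piece modulo [t]. *)
Definition layer M l s := \sum_(m < M)
  (vmeet s (m%:R *: t + H l.+1) - vmeet s (m%:R *: t + H l)).

Let Hm (m l : nat) : m%:R *: t + H l <=l m%:R *: t + H l.+1.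
Proof. exact/vleD2l. Qed.

Lemma layer_mono M l s s' : s <=l s' -> layer M l s <=l layer M l s'.
Proof. by move=> ss; apply: vle_sum => m _; exact: vmeet_diff_mono. Qed.

Lemma layer_ge0 M l s : 0 <=l layer M l s.
Proof. by apply: vsum_ge0 => m _; exact: vmeet_diff_ge0. Qed.

Lemma layer_le M l s : layer M l s <=l M%:R *: (H l.+1 - H l).
Proof.
have -> : M%:R *: (H l.+1 - H l) = \sum_(m < M) (H l.+1 - H l).
  by rewrite sumr_const card_ord scaler_nat.
apply: vle_sum => m _; apply: vle_trans (vmeet_diff_le _ (Hm m l)) _.
by rewrite opprD addrACA subrr add0r; exact: vle_refl.
Qed.

(** Adding [t] moves every period onto the next one. Only the first period is new, and it
    contributes at most one piece; the last period of [s] is dropped because it is nonnegative. *)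
Lemma layer_shift M l s : layer M l (s + t) <=l (H l.+1 - H l) + layer M l s.
Proof.
case: M => [|M].
  by rewrite /layer !big_ord0 addr0; apply/vsub_ge0.
rewrite [layer _ _ (s + t)]/layer big_ord_recl; apply: vleD.
  apply: vle_trans (vmeet_diff_le _ (Hm 0 l)) _.
  by rewrite opprD addrACA subrr add0r; exact: vle_refl.
rewrite /layer big_ord_recr /= -[X in X <=l _]addr0; apply: vleD; last exact: vmeet_diff_ge0.
apply: vle_sum => m _; rewrite /bump /= add1n -natr1 scalerDl scale1r.
rewrite ![_ *: t + t + _]addrAC !vmeetDr opprD addrACA subrr addr0; exact: vle_refl.
Qed.

(** Two telescoping sums: over [l] the pieces fill one period, over [m] the periods fill everything
    up to [M] times [t]. *)
Lemma layer_sum M n s : H 0%N = 0 -> H n = t -> 0 <=l s -> s <=l M%:R *: t ->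
  \sum_(l < n) layer M l s = s.
Proof.
move=> H0 Hn s0 sM; rewrite exchange_big /=.
have E (m : 'I_M) : \sum_(l < n)
    (vmeet s (m%:R *: t + H l.+1) - vmeet s (m%:R *: t + H l)) =
    vmeet s (m.+1%:R *: t) - vmeet s (m%:R *: t).
  rewrite -(big_mkord xpredT (fun l => vmeet s (m%:R *: t + H l.+1) - vmeet s (m%:R *: t + H l))).
  rewrite (telescope_sumr (fun l => vmeet s (m%:R *: t + H l))) // H0 Hn addr0.
  by rewrite -[m.+1%:R]natr1 scalerDl scale1r.
under eq_bigr do rewrite E.
rewrite -(big_mkord xpredT (fun m => vmeet s (m.+1%:R *: t) - vmeet s (m%:R *: t))).
rewrite (telescope_sumr (fun m => vmeet s (m%:R *: t))) // scale0r.
by rewrite (vmeet_eqr s0) subr0 (vmeet_eql sM).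
Qed.

End Layers.

(** This is (q,1)-concavity of the identity of [X], with the constant already raised to the power
    [q]. An arbitrary bound [t] of the sum is allowed, so that no equality of sums has to be
    kept. *)
Definition pos_concave (q : nat) (C : R) := 0 <= C /\
  forall n (f : nat -> X) t, (forall i, (i < n)%N -> 0 <=l f i) ->
    \sum_(i < n) f i <=l t -> \sum_(i < n) `|f i| ^+ q <= C * `|t| ^+ q.

(* Take a decomposition [h] of [t] that nearly maximises [\sum_l |h l| ^ q.+1].  The
   layers cut each [f w] into parts [u l w <= h l], and replacing [h l] by
   [h l - u l w], [f w] cannot beat the maximum; the tangent inequality for the
   powers and summation over [w] then bound [\sum_w |f w| ^ q.+1]. *)
Lemma pos_concave_multiple q C : pos_concave q.+1 C ->
  forall n (f : nat -> X) t M, 0 <=l t ->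
    (forall i, (i < n)%N -> 0 <=l f i) -> (forall i, (i < n)%N -> f i <=l t) ->
    \sum_(i < n) f i <=l M%:R *: t ->
    \sum_(i < n) `|f i| ^+ q.+1 <= q.+1%:R * M%:R * (C * `|t| ^+ q.+1).
Proof.
move=> [C0 conc] n f t M t0 f0 ft fM.
pose E := [set v : R | exists k (h : nat -> X), [/\ forall i, (i < k)%N -> 0 <=l h i,
   \sum_(i < k) h i = t & v = \sum_(i < k) `|h i| ^+ q.+1]].
have Eub : ubound E (C * `|t| ^+ q.+1).
  by move=> v [k [h [h0 ht ->]]]; apply: conc h0 _; rewrite ht; exact: vle_refl.
have supE : has_sup E.
  split; last by eexists; exact: Eub.
  by exists (`|t| ^+ q.+1); exists 1%N, (fun=> t); split; rewrite ?big_ord1.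
have supC : sup E <= C * `|t| ^+ q.+1 by apply: ge_sup => //; case: supE.
have sup0 : 0 <= sup E.
  have : E (`|t| ^+ q.+1) by exists 1%N, (fun=> t); split; rewrite ?big_ord1.
  by move=> /(ub_le_sup (proj2 supE)); apply: le_trans; exact: exprn_ge0.
suff {supC} H : \sum_(i < n) `|f i| ^+ q.+1 <= q.+1%:R * M%:R * sup E.
  by apply: le_trans H _; rewrite ler_wpM2l// mulr_ge0.
apply/ler_addgt0Pr => e e0.
have n1 : 0 < (n%:R + 1) :> R by rewrite ltr_wpDl.
(* The deficit [e / (n + 1)] is chosen because it is multiplied by [n] when the [n] inequalities
   [step] are added. *)
have [_ [k [h [h0 ht ->]]] hE] := sup_adherent (divr_gt0 e0 n1) supE.
set K := sup E in sup0 hE *.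
pose h' i := if (i < k)%N then h i else 0.
pose H l := \sum_(i < l) h' i.
have h'0 i : 0 <=l h' i by rewrite /h'; case: ifP => [/h0//|_]; exact: vle_refl.
have HS l : H l.+1 - H l = h' l by rewrite /H big_ord_recr /= addrAC subrr add0r.
have H_mono l : H l <=l H l.+1 by apply/vsub_ge0; rewrite HS.
have hk (i : 'I_k) : h' i = h i by rewrite /h' ltn_ord.
have Hk : H k = t by rewrite -ht; apply: eq_bigr => i _.
have H0 : H 0%N = 0 by rewrite /H big_ord0.
pose S w := \sum_(i < w) f i.
pose u l w := layer t H M l (S w.+1) - layer t H M l (S w).
have SS w : S w.+1 = S w + f w by rewrite /S big_ord_recr.
have S0 w : (w <= n)%N -> 0 <=l S w.
  by move=> wn; apply: vsum_ge0 => i _; apply: f0; exact: leq_trans wn.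
have SM w : (w <= n)%N -> S w <=l M%:R *: t.
  move=> wn; apply: vle_trans fM; apply/vsub_ge0.
  rewrite /S -(big_mkord xpredT f) -(big_mkord xpredT f) (big_cat_nat _ wn)//= addrAC subrr add0r.
  by rewrite big_nat_cond; apply: vsum_ge0 => i /andP[/andP[_ ?] _]; exact: f0.
have u0 l w : (w < n)%N -> 0 <=l u l w.
  move=> wn; apply/vsub_ge0/layer_mono => //; rewrite SS -{1}[S w]addr0.
  exact/vleD2l/f0.
have uh l w : (w < n)%N -> u l w <=l h' l.
  move=> wn; apply/vle_subl_addr; rewrite -(HS l); apply: vle_trans (layer_shift t H_mono M l (S w)).
  by apply: layer_mono => //; rewrite SS; exact/vleD2l/ft.
have usum w : (w < n)%N -> \sum_(l < k) u l w = f w.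
  move=> wn; rewrite sumrB (layer_sum H0 Hk (S0 _ wn) (SM _ wn)).
  by rewrite (layer_sum H0 Hk (S0 _ (ltnW wn)) (SM _ (ltnW wn))) SS addrAC subrr add0r.
have uM l : \sum_(w < n) u l w <=l M%:R *: h' l.
  rewrite -(big_mkord xpredT (fun w => u l w)) (telescope_sumr (fun w => layer t H M l (S w)))//.
  rewrite -(HS l); apply: vle_trans (layer_le t H_mono M l (S n)).
  apply/vle_subl_addr; rewrite -{1}[layer _ _ _ _ _]addr0.
  by apply/vleD2l; exact: layer_ge0.
pose v l w := h' l - u l w.
have v0 l w : (w < n)%N -> 0 <=l v l w by move=> wn; apply/vsub_ge0; exact: uh.
have step w : (w < n)%N -> \sum_(l < k) `|v l w| ^+ q.+1 + `|f w| ^+ q.+1 <= K.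
  move=> wn; apply: ub_le_sup; first by case: supE.
  exists k.+1, (fun i => if (i < k)%N then v i w else f w); split.
  - by move=> i _; case: ifP => _; [exact: v0|exact: f0].
  - rewrite big_ord_recr /= ltnn; under eq_bigr do rewrite ltn_ord.
    by rewrite sumrB usum// subrK.
  - by rewrite big_ord_recr /= ltnn; under [in RHS]eq_bigr do rewrite ltn_ord.
have nl l : n%:R * `|h' l| <= \sum_(w < n) `|v l w| + M%:R * `|h' l|.
  have -> : n%:R * `|h' l| = `|n%:R *: h' l| by rewrite normrZ normr_nat.
  have -> : M%:R * `|h' l| = `|M%:R *: h' l| by rewrite normrZ normr_nat.
  have nh : n%:R *: h' l <=l (\sum_(w < n) v l w) + M%:R *: h' l.
    rewrite sumrB sumr_const card_ord scaler_nat -addrA.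
    rewrite -[X in X <=l _]addr0; apply/vleD2l; rewrite addrC.
    exact/vsub_ge0.
  have nh0 : 0 <=l n%:R *: h' l by apply: vscale_ge0.
  apply: le_trans (vnorm_le0 nh0 nh) _; apply: le_trans (ler_normD _ _) _.
  by rewrite lerD2r; exact: ler_norm_sum.
(* Over all [w] the norms [|v l w|] drop below [|h' l|] by at most [M * |h' l|] in total.
   Linearising the power at [|h' l|] therefore costs a multiple of [M], not a power of it. *)
have tang l : (n%:R - q.+1%:R * M%:R) * `|h' l| ^+ q.+1 <= \sum_(w < n) `|v l w| ^+ q.+1.
  have H1 : \sum_(w < n) (`|h' l| ^+ q.+1 + q.+1%:R * `|h' l| ^+ q * (`|v l w| - `|h' l|)) <=
      \sum_(w < n) `|v l w| ^+ q.+1 by apply: ler_sum => w _; exact: expr_tangent.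
  apply: le_trans H1; rewrite big_split /= -mulr_sumr sumrB !sumr_const card_ord.
  rewrite -[_ ^+ _ *+ n]mulr_natl -[`|h' l| *+ n]mulr_natl.
  have h2 : 0 <= q.+1%:R * `|h' l| ^+ q by rewrite mulr_ge0// exprn_ge0.
  have := ler_wpM2l h2 (nl l); rewrite exprS; lra.
have tot : \sum_(w < n) (\sum_(l < k) `|v l w| ^+ q.+1 + `|f w| ^+ q.+1) <= n%:R * K.
  by rewrite mulr_natl -[X in K *+ X](card_ord n) -sumr_const; apply: ler_sum => w _; exact: step.
rewrite big_split /= exchange_big /= in tot.
have tot2 : \sum_(l < k) (n%:R - q.+1%:R * M%:R) * `|h' l| ^+ q.+1 <=
    \sum_(l < k) \sum_(w < n) `|v l w| ^+ q.+1 by apply: ler_sum => l _; exact: tang.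
rewrite -mulr_sumr in tot2.
have hh : \sum_(l < k) `|h' l| ^+ q.+1 = \sum_(l < k) `|h l| ^+ q.+1.
  by apply: eq_bigr => i _; rewrite hk.
rewrite hh in tot2.
set A := \sum_(l < k) `|h l| ^+ q.+1 in hE tot2.
have AK : A <= K.
  by apply: ub_le_sup; [case: supE | exists k, h].
have n0 : 0 <= n%:R :> R by [].
have m0 : 0 <= q.+1%:R * M%:R :> R by rewrite mulr_ge0.
have e1 : n%:R * (K - A) <= e.
  have d1 : K - A <= e / (n%:R + 1) by lra.
  have := ler_wpM2l n0 d1; move=> /le_trans; apply.
  by rewrite mulrCA ger_pMr// ler_pdivrMr// mul1r; lra.
have := ler_wpM2l m0 AK; lra.
Qed.

End Stack.

Lemma geom_half_le (R : realFieldType) n : \sum_(k < n) 2^-1 ^+ k <= 2 :> R.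
Proof.
have -> : \sum_(k < n) 2^-1 ^+ k = 2 - 2 * 2^-1 ^+ n :> R.
  elim: n => [|j IH]; first by rewrite big_ord0 expr0 mulr1 subrr.
  by rewrite big_ord_recr /= IH exprS; set u := 2^-1 ^+ j; lra.
have : 0 <= 2^-1 ^+ n :> R by apply: exprn_ge0; rewrite invr_ge0.
by set u := 2^-1 ^+ n; lra.
Qed.

(** Divide by [k] and let it grow: rounding errors bounded independently of [k] disappear. *)
Lemma archi_le (R : realType) (a b d : R) :
  (forall k : nat, k%:R * a <= k%:R * b + d) -> a <= b.
Proof.
move=> H; rewrite leNgt; apply/negP => ba.
have ab : 0 < a - b by rewrite subr_gt0.
have := H (Num.truncn (d / (a - b))).+1.
have := truncnS_gt (d / (a - b)); rewrite ltr_pdivrMr//; lra.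
Qed.

Lemma exprD_convex (R : realFieldType) (q : nat) (a b : R) : 0 <= a -> 0 <= b ->
  (a + b) ^+ q.+1 <= 2 ^+ q * (a ^+ q.+1 + b ^+ q.+1).
Proof.
move=> a0 b0; elim: q => [|q IH]; first by rewrite !expr1 expr0 mul1r.
rewrite exprS [2 ^+ _]exprS.
apply: le_trans (ler_wpM2l (addr_ge0 a0 b0) IH) _.
have h : 0 <= (a ^+ q.+1 - b ^+ q.+1) * (a - b).
  case: (leP a b) => [ab|/ltW ba].
    by rewrite mulr_le0// subr_le0 // lerXn2r.
  by rewrite mulr_ge0// subr_ge0 // lerXn2r.
have h2 : 0 <= 2 ^+ q * ((a ^+ q.+1 - b ^+ q.+1) * (a - b)) by rewrite mulr_ge0// exprn_ge0.
rewrite -subr_ge0; apply: le_trans h2 _; rewrite le_eqVlt; apply/orP; left; apply/eqP.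
rewrite [a ^+ q.+2]exprS [b ^+ q.+2]exprS; ring.
Qed.

(** Two-term convexity, iterated by splitting off the first term. The weights grow geometrically,
    which is affordable for slabs whose means decay faster. *)
Lemma expr_sum_le (R : realFieldType) (q n : nat) (y : nat -> R) : (forall k, 0 <= y k) ->
  (\sum_(k < n) y k) ^+ q.+1 <= \sum_(k < n) 2 ^+ (k.+1 * q) * y k ^+ q.+1.
Proof.
elim: n y => [|n IH] y y0; first by rewrite !big_ord0 expr0n.
rewrite !big_ord_recl /=.
apply: le_trans (exprD_convex q _ _) _ => //; first by apply: sumr_ge0.
rewrite mul1n mulrDr lerD2l.
apply: le_trans (ler_wpM2l _ (IH (fun k => y k.+1) (fun k => y0 k.+1))) _; first exact: exprn_ge0.
rewrite mulr_sumr; apply: ler_sum => k _.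
by rewrite mulrA -exprD mulSn.
Qed.

(** * Weighted families and slabs of linear combinations *)

Section Weighted.
Variables (R : realType) (X : completeNormedModType R) (L : banach_lattice X).
Local Notation "x <=l y" := (bl_le L x y) (at level 70, no associativity).
Local Notation vmeet := (vmeet L).
Local Notation vabs := (vabs L).
Local Notation vpos := (vpos L).

Lemma nth_flatten_nseq (P : X -> Prop) (I : Type) (r : seq I) (m : I -> nat) (F : I -> X) k :
  P 0 -> (forall i, P (F i)) -> P (nth 0 (flatten [seq nseq (m i) (F i) | i <- r]) k).
Proof.
move=> P0 PF; elim: r k => [|i r IH] k /=; first by rewrite nth_nil.
by rewrite nth_cat size_nseq; case: ifP => // km; rewrite nth_nseq km.
Qed.

Lemma big_flatten_nseq (V : nmodType) (G : X -> V) (I : Type) (r : seq I) (m : I -> nat)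
    (F : I -> X) :
  \sum_(x <- flatten [seq nseq (m i) (F i) | i <- r]) G x = \sum_(i <- r) G (F i) *+ m i.
Proof.
rewrite big_flatten big_map; apply: eq_bigr => i _.
by rewrite big_nseq iter_addr_0.
Qed.

(** Each [F i] is repeated about [k * p i] times and [pos_concave_multiple] is applied with [M]
    about [k * d]. Since that bound is linear in [M], dividing by [k] leaves [d], and the rounding
    errors vanish by [archi_le]. *)
Lemma pos_concave_weighted q C : pos_concave L q.+1 C ->
  forall (I : Type) (r : seq I) (p : I -> R) (F : I -> X) t d, 0 <=l t -> 0 <= d ->
    (forall i, 0 <= p i) -> (forall i, 0 <=l F i) -> (forall i, F i <=l t) ->
    \sum_(i <- r) p i *: F i <=l d *: t ->
    \sum_(i <- r) p i * `|F i| ^+ q.+1 <= q.+1%:R * d * (C * `|t| ^+ q.+1).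
Proof.
move=> conc I r p F t d t0 d0 p0 F0 Ft Fd.
have C0 : 0 <= C by case: conc.
set B := C * `|t| ^+ q.+1.
have B0 : 0 <= B by rewrite mulr_ge0// exprn_ge0.
apply: (@archi_le _ _ _ (q.+1%:R * (size r)%:R * B + q.+1%:R * B)) => k.
pose m i := (Num.truncn (k%:R * p i)).+1.
have m1 i : k%:R * p i <= (m i)%:R by apply/ltW/truncnS_gt.
have kp0 i : 0 <= k%:R * p i by rewrite mulr_ge0.
have m2 i : (m i)%:R <= k%:R * p i + 1.
  by rewrite -natr1 lerD2r; have /andP[] := truncn_itv (kp0 i).
pose M := (Num.truncn (k%:R * d + (size r)%:R)).+1.
have M1 : k%:R * d + (size r)%:R <= M%:R by apply/ltW/truncnS_gt.
have M2 : M%:R <= k%:R * d + (size r)%:R + 1.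
  rewrite -natr1 lerD2r; have h : 0 <= k%:R * d + (size r)%:R by rewrite addr_ge0// mulr_ge0.
  by have /andP[] := truncn_itv h.
pose s := flatten [seq nseq (m i) (F i) | i <- r].
have sumE (V : nmodType) (G : X -> V) :
    \sum_(i < size s) G (nth 0 s i) = \sum_(i <- r) G (F i) *+ m i.
  rewrite -(big_mkord xpredT (fun i => G (nth 0 s i))).
  by rewrite -(big_nth 0 xpredT) big_flatten_nseq.
have H1 : \sum_(i < size s) nth 0 s i <=l M%:R *: t.
  rewrite (sumE _ id).
  apply: (@vle_trans _ _ _ (\sum_(i <- r) (k%:R * p i + 1) *: F i)).
    by apply: vle_sum => i _; rewrite -scaler_nat; exact: vscalel_le.
  have -> : \sum_(i <- r) (k%:R * p i + 1) *: F i =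
            k%:R *: (\sum_(i <- r) p i *: F i) + \sum_(i <- r) F i.
    rewrite scaler_sumr -big_split /=; apply: eq_bigr => i _.
    by rewrite scalerDl scale1r scalerA.
  apply: (@vle_trans _ _ _ ((k%:R * d + (size r)%:R) *: t)); last exact: vscalel_le.
  rewrite scalerDl; apply: vleD.
    by rewrite -scalerA; apply: vscaler_le.
  have -> : (size r)%:R *: t = \sum_(i <- r) t.
    by rewrite big_const_seq count_predT iter_addr_0 scaler_nat.
  exact: vle_sum.
have s0 i : (i < size s)%N -> 0 <=l nth 0 s i.
  by move=> _; apply: (nth_flatten_nseq (P := fun x => 0 <=l x)) => //; exact: vle_refl.
have st i : (i < size s)%N -> nth 0 s i <=l t.
  by move=> _; apply: (nth_flatten_nseq (P := fun x => x <=l t)).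
have := pos_concave_multiple conc t0 s0 st H1.
rewrite (sumE _ (fun x => `|x| ^+ q.+1)) -/B => H2.
have H3 : k%:R * \sum_(i <- r) p i * `|F i| ^+ q.+1 <= \sum_(i <- r) `|F i| ^+ q.+1 *+ m i.
  rewrite mulr_sumr; apply: ler_sum => i _; rewrite -[X in _ <= X]mulr_natl mulrA.
  by rewrite ler_wpM2r ?exprn_ge0.
apply: le_trans H3 _; apply: le_trans H2 _.
have h : 0 <= q.+1%:R * B by rewrite mulr_ge0.
have := ler_wpM2l h M2; lra.
Qed.

(** The first half of [is_sqfun]. Estimates are stated for every such [t], so that besides the
    square function also a lattice-valued Rademacher mean can play its part. *)
Definition vub N (x : 'I_N -> X) t :=
  forall a : 'I_N -> R, \sum_(i < N) a i ^+ 2 <= 1 -> \sum_(i < N) a i *: x i <=l t.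

Lemma vub_ge0 N (x : 'I_N -> X) t : vub x t -> 0 <=l t.
Proof.
move=> /(_ (fun=> 0)); rewrite big1 => [|i _]; last by rewrite expr0n.
by rewrite big1 => [|i _]; [apply; exact: ler01 | rewrite scale0r].
Qed.

(** By duality the hypothesis says that the Euclidean norm of [b] is at most [c]; test it and [vub]
    on the normalised [b]. *)
Lemma vub_sum N (x : 'I_N -> X) t c (b : 'I_N -> R) : vub x t ->
  (forall a : 'I_N -> R, \sum_(i < N) a i ^+ 2 <= 1 -> \sum_(i < N) a i * b i <= c) ->
  \sum_(i < N) b i *: x i <=l c *: t.
Proof.
move=> xt H; have t0 := vub_ge0 xt.
have c0 : 0 <= c.
  have := H (fun=> 0); rewrite big1 => [|i _]; last by rewrite expr0n.
  by rewrite big1 => [|i _]; [apply; exact: ler01 | rewrite mul0r].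
set s2 := \sum_(i < N) b i ^+ 2.
have s20 : 0 <= s2 by apply: sumr_ge0 => i _; exact: sqr_ge0.
have [s0|sp] := eqVneq s2 0.
  rewrite big1; first exact: vscale_ge0.
  move=> i _; have /eqP : s2 == 0 by rewrite s0.
  move/eqP; rewrite psumr_eq0; last by move=> j _; exact: sqr_ge0.
  by move=> /allP /(_ i (mem_index_enum _)) /=; rewrite sqrf_eq0 => /eqP ->; rewrite scale0r.
have sq0 : 0 < Num.sqrt s2 by rewrite sqrtr_gt0 lt_neqAle eq_sym sp.
pose a i := (Num.sqrt s2)^-1 * b i.
have a1 : \sum_(i < N) a i ^+ 2 <= 1.
  under eq_bigr do rewrite exprMn.
  by rewrite -mulr_sumr -/s2 exprVn sqr_sqrtr// mulVf.
have ab : \sum_(i < N) a i * b i = Num.sqrt s2.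
  under eq_bigr do rewrite /a -mulrA -expr2.
  by rewrite -mulr_sumr -/s2 -{2}(sqr_sqrtr s20) expr2 mulKf// gt_eqF.
have := H a a1; rewrite ab => sc.
apply: (@vle_trans _ _ _ (Num.sqrt s2 *: t)); last exact: vscalel_le.
have := vscaler_le (sqrtr_ge0 s2) (xt a a1).
rewrite scaler_sumr; under eq_bigr do rewrite scalerA mulVKf ?gt_eqF//.
exact.
Qed.

Lemma vscale_pos_abs_le p l s t u : 0 <= p -> 0 <=l u ->
  p *: s - (p * l) *: t <=l u -> - (p *: s) - (p * l) *: t <=l u ->
  p *: vpos (vabs s - l *: t) <=l u.
Proof.
move=> p0 u0 h1 h2; have [->|pn] := eqVneq p 0; first by rewrite scale0r.
have pp : 0 < p by rewrite lt_neqAle eq_sym pn.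
have key z : p *: z <=l u -> z <=l p^-1 *: u.
  move=> h; have := vscaler_le (ltW (_ : 0 < p^-1)) h; rewrite invr_gt0 => /(_ pp).
  by rewrite scalerA mulVf// scale1r.
have -> : u = p *: (p^-1 *: u) by rewrite scalerA divff// scale1r.
apply: vscaler_le => //; apply: vposP.
  by apply: vscale_ge0 => //; rewrite invr_ge0.
apply/vle_subl_addr/vabsP; split; apply/vle_subl_addr; apply: key;
  by rewrite scalerBr ?scalerN scalerA.
Qed.

(* Lattice inequality between positive parts of [sum_n g_i(n) x_n], reduced to the
   same inequality for the numbers [sum_n g_i(n) a_n] with [|a|_2 <= 1].
   The vector [b] and the number [m] accumulate the choices made in the joins. *)
Lemma vub_tail N (x : 'I_N -> X) t (I : Type) (r : seq I) (p : I -> R)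
    (g : I -> 'I_N -> R) l (b : 'I_N -> R) m d :
  vub x t -> (forall i, 0 <= p i) ->
  (forall a : 'I_N -> R, \sum_(n < N) a n ^+ 2 <= 1 ->
    \sum_(n < N) a n * b n - m +
      \sum_(i <- r) p i * Num.max (`|\sum_(n < N) a n * g i n| - l) 0 <= d) ->
  \sum_(n < N) b n *: x n - m *: t +
    \sum_(i <- r) p i *: vpos (vabs (\sum_(n < N) g i n *: x n) - l *: t) <=l d *: t.
Proof.
move=> xt p0; elim: r b m => [|i r IH] b m H.
  rewrite big_nil addr0; apply/vle_subl_addr; rewrite -scalerDl.
  by apply: vub_sum => // a /H; rewrite big_nil; lra.
rewrite big_cons addrCA; apply/vle_subr_addr.
have IH' := IH.
apply: vscale_pos_abs_le => //.
- apply/vsub_ge0; apply: IH => a a1; have := H a a1; rewrite big_cons.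
  have : 0 <= p i * Num.max (`|\sum_(n < N) a n * g i n| - l) 0.
    by rewrite mulr_ge0// le_max lexx orbT.
  lra.
- apply/vle_subr_addr.
  have -> : p i *: \sum_(n < N) g i n *: x n - (p i * l) *: t +
     (\sum_(n < N) b n *: x n - m *: t +
      \sum_(j <- r) p j *: vpos (vabs (\sum_(n < N) g j n *: x n) - l *: t)) =
     \sum_(n < N) (b n + p i * g i n) *: x n - (m + p i * l) *: t +
      \sum_(j <- r) p j *: vpos (vabs (\sum_(n < N) g j n *: x n) - l *: t).
    rewrite addrA addrACA -opprD -scalerDl [p i * l + m]addrC; congr (_ - _ + _).
    rewrite addrC scaler_sumr -big_split /=; apply: eq_bigr => n _.
    by rewrite scalerDl scalerA.
  apply: IH => a a1; have := H a a1; rewrite big_cons.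
  have -> : \sum_(n < N) a n * (b n + p i * g i n) =
     \sum_(n < N) a n * b n + p i * \sum_(n < N) a n * g i n.
    rewrite mulr_sumr -big_split /=; apply: eq_bigr => n _; ring.
  set z := \sum_(n < N) a n * g i n.
  have : p i * (z - l) <= p i * Num.max (`|z| - l) 0.
    by rewrite ler_wpM2l// le_max lerD2r ler_norm.
  lra.
- apply/vle_subr_addr.
  have -> : - (p i *: \sum_(n < N) g i n *: x n) - (p i * l) *: t +
     (\sum_(n < N) b n *: x n - m *: t +
      \sum_(j <- r) p j *: vpos (vabs (\sum_(n < N) g j n *: x n) - l *: t)) =
     \sum_(n < N) (b n - p i * g i n) *: x n - (m + p i * l) *: t +
      \sum_(j <- r) p j *: vpos (vabs (\sum_(n < N) g j n *: x n) - l *: t).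
    rewrite addrA addrACA -opprD -scalerDl [p i * l + m]addrC; congr (_ - _ + _).
    rewrite addrC scaler_sumr -sumrB; apply: eq_bigr => n _.
    by rewrite scalerBl scalerA.
  apply: IH => a a1; have := H a a1; rewrite big_cons.
  have -> : \sum_(n < N) a n * (b n - p i * g i n) =
     \sum_(n < N) a n * b n - p i * \sum_(n < N) a n * g i n.
    rewrite mulr_sumr -sumrB /=; apply: eq_bigr => n _; ring.
  set z := \sum_(n < N) a n * g i n.
  have : p i * (- z - l) <= p i * Num.max (`|z| - l) 0.
    by rewrite ler_wpM2l// le_max lerD2r -normrN ler_norm.
  lra.
Qed.

Lemma vub_tail_sum N (x : 'I_N -> X) t (I : Type) (r : seq I) (p : I -> R)
    (g : I -> 'I_N -> R) l d :
  vub x t -> (forall i, 0 <= p i) ->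
  (forall a : 'I_N -> R, \sum_(n < N) a n ^+ 2 <= 1 ->
    \sum_(i <- r) p i * Num.max (`|\sum_(n < N) a n * g i n| - l) 0 <= d) ->
  \sum_(i <- r) p i *: vpos (vabs (\sum_(n < N) g i n *: x n) - l *: t) <=l d *: t.
Proof.
move=> xt p0 H.
have := @vub_tail N x t I r p g l (fun=> 0) 0 d xt p0.
rewrite big1 => [|n _]; last by rewrite scale0r.
rewrite scale0r subr0 add0r; apply=> a a1.
by rewrite big1 => [|n _]; [rewrite subr0 add0r; exact: H|rewrite mulr0].
Qed.

Definition vslab t s l l' := vmeet (vabs s) (l' *: t) - vmeet (vabs s) (l *: t).

(** Divided by [l' - l], the slabs lie below [t], and before division their weighted sum lies below
    that of the tails, hence below [d *: t]. Undoing the normalisation turns [d / (l' - l)] into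
    [(l' - l) ^+ q * d]. *)
Lemma vslab_norm N (x : 'I_N -> X) t (I : Type) (r : seq I) (p : I -> R)
    (g : I -> 'I_N -> R) q C l l' d : pos_concave L q.+1 C ->
  vub x t -> (forall i, 0 <= p i) -> 0 <= d -> 0 <= l < l' ->
  (forall a : 'I_N -> R, \sum_(n < N) a n ^+ 2 <= 1 ->
    \sum_(i <- r) p i * Num.max (`|\sum_(n < N) a n * g i n| - l) 0 <= d) ->
  \sum_(i <- r) p i * `|vslab t (\sum_(n < N) g i n *: x n) l l'| ^+ q.+1 <=
    q.+1%:R * (C * `|t| ^+ q.+1) * ((l' - l) ^+ q * d).
Proof.
move=> conc xt p0 d0 /andP[l0 ll'] H; have t0 := vub_ge0 xt.
have D0 : 0 < l' - l by rewrite subr_gt0.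
have D0' : 0 <= (l' - l)^-1 by rewrite invr_ge0 ltW.
have llt : l *: t <=l l' *: t by apply: vscalel_le => //; exact: ltW.
have := @pos_concave_weighted q C conc I r p
  (fun i => (l' - l)^-1 *: vslab t (\sum_(n < N) g i n *: x n) l l') t ((l' - l)^-1 * d).
move=> /(_ t0 (mulr_ge0 D0' d0) p0) W.
have : \sum_(i <- r) p i * `|(l' - l)^-1 *: vslab t (\sum_(n < N) g i n *: x n) l l'| ^+ q.+1
   <= q.+1%:R * ((l' - l)^-1 * d) * (C * `|t| ^+ q.+1).
  apply: W => [i|i|].
  - by apply: vscale_ge0 => //; exact: vmeet_diff_ge0.
  - have tE : t = (l' - l)^-1 *: ((l' - l) *: t).
      by rewrite scalerA mulVf ?scale1r// gt_eqF.
    rewrite [X in _ <=l X]tE.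
    by apply: vscaler_le => //; rewrite scalerBl; exact: (vmeet_diff_le _ llt).
  - rewrite -scalerA.
    have -> : \sum_(i <- r) p i *: ((l' - l)^-1 *: vslab t (\sum_(n < N) g i n *: x n) l l') =
       (l' - l)^-1 *: \sum_(i <- r) p i *: vslab t (\sum_(n < N) g i n *: x n) l l'.
      by rewrite scaler_sumr; apply: eq_bigr => i _; rewrite !scalerA mulrC.
    apply: vscaler_le => //; apply: vle_trans (vub_tail_sum xt p0 H).
    apply: vle_sum => i _; apply: vscaler_le => //; exact: vmeet_diff_pos.
under eq_bigr do rewrite normrZ (ger0_norm D0') exprMn mulrCA.
rewrite -mulr_sumr; set S := \sum_(i <- r) _ => HS.
have Dq : 0 < (l' - l) ^+ q.+1 by rewrite exprn_gt0.
have SE : S = (l' - l) ^+ q.+1 * ((l' - l)^-1 ^+ q.+1 * S).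
  by rewrite mulrA -exprMn divff ?expr1n ?mul1r// gt_eqF.
rewrite SE; apply: le_trans (ler_wpM2l (ltW Dq) HS) _.
rewrite le_eqVlt; apply/orP; left; apply/eqP; rewrite exprS; field.
by rewrite gt_eqF.
Qed.

Lemma vslab_decomp t s l (e : nat -> R) n : 0 <=l t -> (forall k, e k <= e k.+1) -> e 0%N = 0 ->
  l = e n -> vabs s <=l l *: t -> `|s| <= \sum_(k < n) `|vslab t s (e k) (e k.+1)|.
Proof.
move=> t0 e_mono e0 -> sl; rewrite -(vnorm_abs L).
apply: le_trans (ler_norm_sum _ _ _).
rewrite -(big_mkord xpredT (fun k => vslab t s (e k) (e k.+1))).
rewrite (telescope_sumr (fun k => vmeet (vabs s) (e k *: t)))// e0 scale0r.
by rewrite (vmeet_eqr (vabs_ge0 L s)) subr0 (vmeet_eql sl).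
Qed.

End Weighted.

(** * Random signs and Khintchine's lower bound *)

(** Jensen's inequality: in the tangents at the mean [b] the linear terms cancel. *)
Lemma mean_expr (R : realFieldType) (I : finType) (q : nat) (y : I -> R) :
  (0 < #|I|)%N -> (forall i, 0 <= y i) ->
  (#|I|%:R^-1 * \sum_i y i) ^+ q.+1 <= #|I|%:R^-1 * \sum_i y i ^+ q.+1.
Proof.
move=> I0 y0; set n : R := #|I|%:R; have n0 : 0 < n by rewrite ltr0n.
set b := n^-1 * _; have b0 : 0 <= b by apply: mulr_ge0; [rewrite invr_ge0 ltW|apply: sumr_ge0].
have : \sum_i (b ^+ q.+1 + q.+1%:R * b ^+ q * (y i - b)) <= \sum_i y i ^+ q.+1.
  by apply: ler_sum => i _; exact: expr_tangent.
rewrite big_split /= -mulr_sumr sumrB !sumr_const.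
have -> : \sum_i y i = n * b by rewrite mulrA divff ?mul1r// gt_eqF.
rewrite -[b *+ _]mulr_natl subrr mulr0 addr0 -[_ *+ _]mulr_natl -/n.
by rewrite ler_pdivlMl.
Qed.

Section SignSums.
Variable R : realType.

Lemma sgn_sqr b : sgn R b ^+ 2 = 1.
Proof. by case: b; rewrite /sgn ?expr1n// sqrrN expr1n. Qed.

Lemma sgnM b c : sgn R b * sgn R c = sgn R (b == c).
Proof. by case: b; case: c; rewrite /sgn /=; ring. Qed.

Lemma card_signs N : #|{ffun 'I_N -> bool}|%:R = 2 ^+ N :> R.
Proof. by rewrite card_ffun card_bool card_ord natrX. Qed.

Lemma cards_signs_gt0 N : (0 < #|{ffun 'I_N -> bool}|)%N.
Proof. by rewrite card_ffun card_bool expn_gt0. Qed.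

Lemma rad_meanE N (F : (nat -> R) -> R) : rad_mean N F =
  #|{ffun 'I_N -> bool}|%:R^-1 * \sum_(e : {ffun 'I_N -> bool})
    F (fun n => if @insub nat (fun k => k < N)%N 'I_N n is Some i then sgn R (e i) else 0).
Proof. by rewrite card_signs. Qed.

Lemma prod_exp_sq N (a : 'I_N -> R) : \sum_(i < N) a i ^+ 2 <= 1 ->
  \prod_(i < N) (1 + a i ^+ 2) <= expR 1.
Proof.
move=> a1; apply: (@le_trans _ _ (\prod_(i < N) expR (a i ^+ 2))).
  apply: ler_prod => i _; rewrite expR_ge1Dx andbT addr_ge0//; exact: sqr_ge0.
by rewrite -expR_sum ler_expR.
Qed.

Import complex.
Local Notation C := (complex R).

Definition cplx_abs2 (z : C) : R := Re z ^+ 2 + Im z ^+ 2.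

Lemma cplx_abs2M (z w : C) : cplx_abs2 (z * w) = cplx_abs2 z * cplx_abs2 w.
Proof. by case: z => a b; case: w => c d; rewrite /cplx_abs2 /=; ring. Qed.

Lemma Im_sum (I : finType) (F : I -> C) : Im (\sum_i F i) = \sum_i Im (F i).
Proof. by apply: (big_morph (@Im R) _ _) => [[? ?] [? ?]|]. Qed.

(* The imaginary part of the Riesz product [prod_n (1 + i a_n r_n)]. *)
Lemma riesz_bounded N (a : 'I_N -> R) : \sum_(i < N) a i ^+ 2 <= 1 ->
  exists2 phi : {ffun 'I_N -> bool} -> R, forall e, `|phi e| <= expR 1 &
    forall n, \sum_e phi e * sgn R (e n) = 2 ^+ N * a n.
Proof.
move=> a1.
pose z (i : 'I_N) (b : bool) : C := Complex 1 (a i * sgn R b).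
exists (fun e : {ffun 'I_N -> bool} => Im (\prod_i z i (e i))) => [e|n].
  have H : cplx_abs2 (\prod_i z i (e i)) <= expR 1.
    rewrite (big_morph cplx_abs2 cplx_abs2M (_ : _ = 1)); last first.
      by rewrite /cplx_abs2 /=; ring.
    rewrite (eq_bigr (fun i => 1 + a i ^+ 2)); first exact: prod_exp_sq.
    by move=> i _; rewrite /cplx_abs2 /= expr1n exprMn sgn_sqr mulr1.
  have e1 : 1 <= expR 1 :> R by apply: le_trans (expR_ge1Dx 1); lra.
  rewrite -ler_sqr ?nnegrE ?expR_ge0// -normrX ger0_norm ?sqr_ge0//.
  apply: le_trans (_ : _ <= expR 1) _; last by rewrite expr2 ler_peMr ?expR_ge0.
  by apply: le_trans H; rewrite /cplx_abs2 lerDr sqr_ge0.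
(* The sign [r_n] is inserted as a factor of the product, so that the sum over all signs factorises.
   Every factor with [i != n] sums to [2], the factor [n] to [2 i a_n]. *)
pose F (i : 'I_N) (b : bool) : C := z i b * (if i == n then Complex (sgn R b) 0 else 1).
have -> : \sum_(e : {ffun 'I_N -> bool}) Im (\prod_i z i (e i)) * sgn R (e n) = Im (\sum_(e : {ffun 'I_N -> bool}) \prod_i F i (e i)).
  rewrite Im_sum; apply: eq_bigr => e _; rewrite /F big_split /=.
  under [X in _ = Im (_ * X)]eq_bigr => i _.
    rewrite (_ : (if _ then _ else _) = (if i == n then Complex (sgn R (e n)) 0 else 1 : C)); last by case: eqP => // ->.
    over.
  have -> : \prod_(i < N) (if i == n then Complex (sgn R (e n)) 0 else 1 : C) = Complex (sgn R (e n)) 0.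
    by rewrite (bigD1 n) //= eqxx big1 ?mulr1 // => i /negbTE ->.
  by case: (\prod_(i < N) z i (e i)) => u v /=; ring.
rewrite -bigA_distr_bigA (bigD1 n) //=.
rewrite big_bool /F eqxx (eq_bigr (fun=> Complex 2 0)); last first.
  by move=> i /negbTE ->; rewrite big_bool /z /sgn /= !mulr1; congr Complex; ring.
have -> : \prod_(i < N | i != n) Complex 2 0 = Complex (2 ^+ N.-1 : R) 0 :> C.
  rewrite prodr_const cardC1 card_ord; elim: (N.-1) => [|k IH]; first by rewrite !expr0.
  by rewrite !exprS IH /=; congr Complex; ring.
have N0 : (0 < N)%N by apply: leq_trans (ltn_ord n).
rewrite -{2}(prednK N0) exprS /z /sgn /=; ring.
Qed.

End SignSums.

Section RadNorm.
Variables (R : realType) (X : completeNormedModType R).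
Implicit Types N : nat.

Definition sign_sum N (x : 'I_N -> X) (e : {ffun 'I_N -> bool}) : X :=
  \sum_(i < N) sgn R (e i) *: x i.

Definition rad_pow N q (x : 'I_N -> X) : R :=
  (2 ^+ N)^-1 * \sum_(e : {ffun 'I_N -> bool}) `|sign_sum x e| ^+ q.

Lemma rad_sum_signs N (x : 'I_N -> X) (e : {ffun 'I_N -> bool}) :
  rad_sum x (fun n => if @insub nat (fun k => k < N)%N 'I_N n is Some i
                      then sgn R (e i) else 0) = sign_sum x e.
Proof. by apply: eq_bigr => i _; rewrite valK. Qed.

Lemma rad_normE N (x : 'I_N -> X) : rad_norm x = Num.sqrt (rad_pow 2 x).
Proof.
congr (Num.sqrt (_ * _)); apply: eq_bigr => e _; by rewrite rad_sum_signs.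
Qed.

Lemma pow2N_gt0 N : 0 < (2 ^+ N)^-1 :> R. Proof. by rewrite invr_gt0 exprn_gt0. Qed.

Lemma pow2N_ge0 N : 0 <= (2 ^+ N)^-1 :> R. Proof. exact/ltW/pow2N_gt0. Qed.
Hint Resolve pow2N_gt0 pow2N_ge0 : core.

Lemma rad_pow_ge0 N q (x : 'I_N -> X) : 0 <= rad_pow q x.
Proof. by apply: mulr_ge0 => //; apply: sumr_ge0 => e _; exact: exprn_ge0. Qed.

Lemma rad_norm_ge0 N (x : 'I_N -> X) : 0 <= rad_norm x.
Proof. exact: sqrtr_ge0. Qed.

Lemma rad_norm_sqr N (x : 'I_N -> X) : rad_norm x ^+ 2 = rad_pow 2 x.
Proof. by rewrite rad_normE sqr_sqrtr// rad_pow_ge0. Qed.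

Lemma eq_rad_pow N q (x y : 'I_N -> X) : x =1 y -> rad_pow q x = rad_pow q y.
Proof.
move=> xy; congr (_ * _); apply: eq_bigr => e _; congr (`|_| ^+ _).
by apply: eq_bigr => i _; rewrite xy.
Qed.

Lemma rad_pow_le_pow N q (x : 'I_N -> X) :
  rad_pow 1 x ^+ q.+1 <= rad_pow q.+1 x.
Proof.
rewrite /rad_pow -card_signs.
apply: le_trans (_ : _ <= #|{ffun 'I_N -> bool}|%:R^-1 * \sum_(e : {ffun 'I_N -> bool}) `|sign_sum x e| ^+ q.+1) => //.
apply: le_trans (mean_expr q (cards_signs_gt0 N) _) => //.
Qed.

Lemma rad_pow1_le N (x : 'I_N -> X) : rad_pow 1 x <= rad_norm x.
Proof.
rewrite -ler_sqr ?nnegrE ?rad_pow_ge0 ?rad_norm_ge0// rad_norm_sqr.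
exact: rad_pow_le_pow.
Qed.

(* Multiplying the vectors by fixed signs only permutes the sign patterns. *)
Lemma rad_pow_flip N q (x : 'I_N -> X) (c : 'I_N -> bool) :
  rad_pow q (fun i => sgn R (c i) *: x i) = rad_pow q x.
Proof.
congr (_ * _); pose h (e : {ffun 'I_N -> bool}) := [ffun i => e i == c i].
have hK : involutive h by move=> e; apply/ffunP => i; rewrite !ffunE; case: (e i); case: (c i).
rewrite [RHS](reindex_inj (inv_inj hK)); apply: eq_bigr => e _.
congr (`|_| ^+ _); apply: eq_bigr => i _; by rewrite scalerA sgnM ffunE.
Qed.

Lemma sign_sumD N (x y : 'I_N -> X) e :
  sign_sum (fun i => x i + y i) e = sign_sum x e + sign_sum y e.
Proof. by rewrite /sign_sum -big_split /=; apply: eq_bigr => i _; rewrite scalerDr. Qed.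

Lemma sign_sumZ N (x : 'I_N -> X) (a : R) e :
  sign_sum (fun i => a *: x i) e = a *: sign_sum x e.
Proof. by rewrite /sign_sum scaler_sumr; apply: eq_bigr => i _; rewrite !scalerA mulrC. Qed.

Lemma rad_powZ N q (x : 'I_N -> X) (a : R) :
  rad_pow q (fun i => a *: x i) = `|a| ^+ q * rad_pow q x.
Proof.
rewrite /rad_pow [RHS]mulrCA; congr (_ * _); rewrite mulr_sumr; apply: eq_bigr => e _.
by rewrite sign_sumZ normrZ exprMn.
Qed.

Lemma normD_convex2 (u v : X) (a b : R) : 0 <= a -> 0 <= b -> a + b = 1 ->
  `|a *: u + b *: v| ^+ 2 <= a * `|u| ^+ 2 + b * `|v| ^+ 2.
Proof.
move=> a0 b0 ab; have H : `|a *: u + b *: v| <= a * `|u| + b * `|v|.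
  by apply: le_trans (ler_normD _ _) _; rewrite !normrZ !ger0_norm.
have H2 : `|a *: u + b *: v| ^+ 2 <= (a * `|u| + b * `|v|) ^+ 2 by apply: lerXn2r; rewrite ?nnegrE ?addr_ge0 ?mulr_ge0.
apply: le_trans H2 _; rewrite -subr_ge0.
have -> : a * `|u| ^+ 2 + b * `|v| ^+ 2 - (a * `|u| + b * `|v|) ^+ 2 = a * b * (`|u| - `|v|) ^+ 2.
  have -> : b = 1 - a by lra.
  ring.
by apply: mulr_ge0; [exact: mulr_ge0|exact: sqr_ge0].
Qed.

Lemma rad_pow_convex N (x y : 'I_N -> X) (a b : R) : 0 <= a -> 0 <= b -> a + b = 1 ->
  rad_pow 2 (fun i => a *: x i + b *: y i) <= a * rad_pow 2 x + b * rad_pow 2 y.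
Proof.
move=> a0 b0 ab; rewrite /rad_pow mulrCA [b * _]mulrCA -mulrDr ler_wpM2l//.
rewrite !mulr_sumr -big_split /=; apply: ler_sum => e _.
by rewrite sign_sumD !sign_sumZ; exact: normD_convex2.
Qed.

(** The restricted family is the average of [x] and of [x] with its signs flipped off [A]; both have
    the same Rademacher mean, and the squared norm is convex. *)
Lemma rad_pow_restrict N (x : 'I_N -> X) (A : pred 'I_N) :
  rad_pow 2 (fun i => if A i then x i else 0) <= rad_pow 2 x.
Proof.
have h : 0 <= 2^-1 :> R by rewrite invr_ge0.
have h2 : 2^-1 + 2^-1 = 1 :> R by lra.
have := rad_pow_convex x (fun i => sgn R (A i) *: x i) h h h2.
rewrite rad_pow_flip -mulrDl h2 mul1r; apply: le_trans.
rewrite le_eqVlt; apply/orP; left; apply/eqP/eq_rad_pow => i.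
case: (A i); rewrite /sgn ?scale1r ?scaleN1r ?scalerN ?subrr//.
by rewrite -scalerDl h2 scale1r.
Qed.

End RadNorm.

Section KhintchineLower.
Variables (R : realType) (X : completeNormedModType R) (L : banach_lattice X).
Local Notation "x <=l y" := (bl_le L x y) (at level 70, no associativity).
Local Notation vabs := (vabs L).

(** The mean of [|sum_n r_n x_n|] taken in the lattice; the factor [e] is the uniform bound of the
    Riesz product in [riesz_bounded]. *)
Definition rad_bound N (x : 'I_N -> X) : X :=
  expR 1 *: ((2 ^+ N)^-1 *: \sum_(e : {ffun 'I_N -> bool}) vabs (sign_sum x e)).

Lemma rad_bound_norm N (x : 'I_N -> X) : `|rad_bound x| <= expR 1 * rad_pow 1 x.
Proof.
rewrite /rad_bound !normrZ !ger0_norm ?expR_ge0 ?invr_ge0 ?exprn_ge0//.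
rewrite ler_wpM2l ?expR_ge0// ler_wpM2l ?invr_ge0 ?exprn_ge0//.
apply: le_trans (ler_norm_sum _ _ _) _.
by apply: ler_sum => e _; rewrite (vnorm_abs L) expr1.
Qed.

(** For [|a|_2 <= 1], the combination [sum_n a_n x_n] is the mean of [phi] times [sum_n r_n x_n],
    where [phi] has Rademacher coefficients [a_n] and is bounded by [e]. *)
Lemma rad_bound_vub N (x : 'I_N -> X) : vub L x (rad_bound x).
Proof.
move=> a a1; have [phi phi1 phir] := riesz_bounded a1.
have -> : \sum_(i < N) a i *: x i = (2 ^+ N)^-1 *: \sum_e phi e *: sign_sum x e.
  under [in RHS]eq_bigr do rewrite /sign_sum scaler_sumr.
  rewrite exchange_big /= scaler_sumr; apply: eq_bigr => i _.
  under eq_bigr do rewrite scalerA.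
  by rewrite -scaler_suml phir scalerA mulrA mulVf ?mul1r//.
rewrite /rad_bound scalerA mulrC -scalerA; apply: vscaler_le.
  by rewrite invr_ge0 exprn_ge0.
rewrite scaler_sumr; apply: vle_sum => e _.
apply: vle_trans (vscale_le_abs L _ _) _.
by apply: vscalel_le => //; exact: vabs_ge0.
Qed.

Lemma is_sqfun_vub N (x : 'I_N -> X) s : is_sqfun L x s -> vub L x s.
Proof. by case. Qed.

Lemma sqfun_norm_le N (x : 'I_N -> X) s t : is_sqfun L x s -> vub L x t -> `|s| <= `|t|.
Proof.
move=> sx xt; apply: (vnorm_le0 (L := L)); first exact: vub_ge0 (is_sqfun_vub sx).
by case: sx => _; apply.
Qed.

Lemma khintchine_lower N (x : 'I_N -> X) s : is_sqfun L x s -> `|s| <= expR 1 * rad_norm x.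
Proof.
move=> sx; apply: le_trans (sqfun_norm_le sx (@rad_bound_vub _ x)) _.
apply: le_trans (rad_bound_norm x) _.
by rewrite ler_wpM2l ?expR_ge0// rad_pow1_le.
Qed.

End KhintchineLower.

(** * Gaussian means *)

Section GaussInt.
Variable R : realType.
Local Open Scope ereal_scope.
Local Notation leb := (@lebesgue_measure R).
Local Notation RM := (measurableTypeR R).
Import HBNNSimple.

(** A nonnegative integral is a supremum over simple functions below the integrand, so measurability
    is irrelevant for monotonicity. Gaussian means can thus be compared freely. *)
Lemma ge0_le_integral_nomeas d (T : measurableType d) (mu : {measure set T -> \bar R})
  (f g : T -> \bar R) : (forall x, 0 <= f x) -> (forall x, f x <= g x) ->
  \int[mu]_x f x <= \int[mu]_x g x.
Proof.
move=> f0 fg; have g0 x : 0 <= g x by exact: le_trans (fg x).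
rewrite !ge0_integralTE//; apply: ereal_sup_le => _ [h hf <-].
by exists h => // x; exact: le_trans (fg x).
Qed.

(** By uniqueness of Lebesgue measure only half-open intervals matter; reflection exchanges the open
    and the closed end, which does not change the length. *)
Lemma lebesgue_opp (A : set RM) : measurable A ->
  leb A = pushforward leb (-%R : RM -> RM) A.
Proof.
have mopp : measurable_fun setT (-%R : RM -> RM) by exact: oppr_measurable.
pose nu : {measure set RM -> \bar R} :=
  measure_function_pushforward__canonical__measure_function_Measure leb mopp.
apply: (@lebesgue_measure_unique R nu) => X /ocitvP[->|[[a b] /= ab ->]].
  by rewrite !measure0.
rewrite /nu /= /pushforward.
have -> : -%R @^-1` `]a, b]%classic = `[(- b)%R, (- a)%R[%classic :> set R.
  by apply/seteqP; split => x /=; rewrite !in_itv /= => /andP[? ?]; apply/andP; split; lra.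
rewrite !lebesgue_measure_itv /= !lte_fin ltrN2; case: ifP => // _.
by rewrite -!EFinB opprK addrC.
Qed.

Definition gint (f : R -> \bar R) : \bar R :=
  \int[leb]_t ((normal_pdf 0 1 t)%:E * f t).

Lemma normal_pdf_opp (t : R) : normal_pdf 0 1 (- t) = normal_pdf 0 1 t :> R.
Proof. by rewrite !normal_pdfE ?oner_neq0//= /normal_fun !subr0 sqrrN. Qed.

Lemma gpdf_ge0 (t : R) : 0 <= (normal_pdf 0 1 t)%:E.
Proof. by rewrite lee_fin normal_pdf_ge0. Qed.
Hint Resolve gpdf_ge0 : core.

Lemma measurable_gpdf (f : R -> \bar R) : measurable_fun setT (f : RM -> \bar R) ->
  measurable_fun setT (fun t : RM => (normal_pdf 0 1 t)%:E * f t).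
Proof.
move=> mf; apply: emeasurable_funM => //; apply/measurable_EFinP.
exact: measurable_normal_pdf.
Qed.

Lemma gint_ge0 f : (forall t, 0 <= f t) -> 0 <= gint f.
Proof. by move=> f0; apply: integral_ge0 => t _; rewrite mule_ge0. Qed.

Lemma gint_le f g : (forall t, 0 <= f t) -> (forall t, f t <= g t) -> gint f <= gint g.
Proof.
move=> f0 fg; apply: ge0_le_integral_nomeas => t; first by rewrite mule_ge0.
by rewrite lee_wpmul2l.
Qed.

Lemma gintD f g : measurable_fun setT (f : RM -> \bar R) -> measurable_fun setT (g : RM -> \bar R) ->
  (forall t, 0 <= f t) -> (forall t, 0 <= g t) ->
  gint (fun t => f t + g t) = gint f + gint g.
Proof.
move=> mf mg f0 g0; rewrite /gint.
under eq_integral do rewrite ge0_muleDr//.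
apply: ge0_integralD => //; try exact: measurable_gpdf; move=> t _; exact: mule_ge0.
Qed.

Lemma gintZ f (c : R) : measurable_fun setT (f : RM -> \bar R) ->
  (forall t, 0 <= f t) -> (0 <= c)%R ->
  gint (fun t => c%:E * f t) = c%:E * gint f.
Proof.
move=> mf f0 c0; rewrite /gint.
under eq_integral do rewrite muleCA.
apply: ge0_integralZl => //; first exact: measurable_gpdf.
move=> t _; exact: mule_ge0.
Qed.

Lemma gint_opp f : measurable_fun setT (f : RM -> \bar R) -> (forall t, 0 <= f t) ->
  gint (fun t => f (- t)%R) = gint f.
Proof.
move=> mf f0; rewrite /gint.
have mopp : measurable_fun setT (-%R : RM -> RM) by exact: oppr_measurable.
pose nu : {measure set RM -> \bar R} :=
  measure_function_pushforward__canonical__measure_function_Measure leb mopp.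
transitivity (\int[nu]_t ((normal_pdf 0 1 t)%:E * f t)).
  rewrite (ge0_integral_pushforward mopp leb measurableT); first last.
  - by move=> t _; exact: mule_ge0.
  - exact: measurable_gpdf.
  by apply: eq_integral => t _ /=; rewrite normal_pdf_opp.
by apply/esym/eq_measure_integral => A mA _; exact: lebesgue_opp.
Qed.

Lemma gint_lim (f : nat -> R -> \bar R) :
  (forall n, measurable_fun setT (f n : RM -> \bar R)) -> (forall n t, 0 <= f n t) ->
  (forall t, nondecreasing_seq (f ^~ t)) ->
  gint (fun t => limn (f ^~ t)) = limn (fun n => gint (f n)).
Proof.
move=> mf f0 nd; rewrite /gint.
rewrite -monotone_convergence//.
- apply: eq_integral => t _; rewrite limeMl//.
  by apply: ereal_nondecreasing_is_cvgn; exact: nd.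
- by move=> n; exact: measurable_gpdf.
- by move=> n t _; exact: mule_ge0.
- by move=> t _ m n mn; rewrite lee_wpmul2l//; exact: nd.
Qed.

Lemma gint1 : gint (fun=> 1) = 1.
Proof.
rewrite /gint; under eq_integral do rewrite mule1.
by rewrite integral_normal_pdf.
Qed.

End GaussInt.

Section GaussMean.
Variable R : realType.
Local Open Scope ereal_scope.
Local Notation RM := (measurableTypeR R).
Implicit Types (F G : (nat -> R) -> \bar R) (N : nat).

Definition upd (g : nat -> R) k (t : R) : nat -> R := fun n => if n == k then t else g n.

Lemma gauss_meanS N F : gauss_mean N.+1 F = gint (fun t => gauss_mean N (fun g => F (upd g N t))).
Proof. by []. Qed.

Lemma gauss_mean_ge0 N F : (forall g, 0 <= F g) -> 0 <= gauss_mean N F.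
Proof.
elim: N F => [|N IH] F F0; first exact: F0.
by rewrite gauss_meanS; apply: gint_ge0 => t; exact: IH.
Qed.

(* Measurability of a function on [R^N] tested on all measurable families of
   coordinates, so that no sigma-algebra on the sequence space is needed. *)
Definition jmeas d (T : measurableType d) (Phi : T -> (nat -> R) -> \bar R) :=
  forall d' (U : measurableType d') (a : U -> T) (f : nat -> U -> RM),
    measurable_fun setT a -> (forall n, measurable_fun setT (f n)) ->
    measurable_fun setT (fun u => Phi (a u) (fun n => f n u)).

Definition gmeas F := forall d' (U : measurableType d') (f : nat -> U -> RM),
    (forall n, measurable_fun setT (f n)) ->
    measurable_fun setT (fun u => F (fun n => f n u)).

(** Induction on [N]: the variable integrated last joins the parameter space, which becomes a
    product, and Tonelli's theorem integrates it out. This is why a general parameter space is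
    carried along. *)
Lemma gauss_mean_jmeas N d (T : measurableType d) (Phi : T -> (nat -> R) -> \bar R) :
  (forall t g, 0 <= Phi t g) -> jmeas Phi ->
  measurable_fun setT (fun t => gauss_mean N (Phi t)).
Proof.
elim: N d T Phi => [|N IH] d T Phi Phi0 mPhi.
  by apply: (mPhi _ _ id (fun _ _ => 0%R)) => //.
have := @measurable_fun_fubini_tonelli_F _ _ T RM R (@lebesgue_measure R)
  (fun ts : T * RM => (normal_pdf 0 1 ts.2)%:E * gauss_mean N (fun g => Phi ts.1 (upd g N ts.2))).
apply.
  apply: emeasurable_funM; first by apply/measurable_EFinP; apply: measurableT_comp => //; exact: measurable_normal_pdf.
  apply: (IH _ _ (fun ts g => Phi ts.1 (upd g N ts.2))) => // d' U a f ma mf.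
  have H := mPhi _ _ (fst \o a) (fun n => if n == N then snd \o a else f n).
  rewrite (_ : (fun u => _) = (fun u => Phi ((fst \o a) u) (fun n => (if n == N then snd \o a else f n) u))).
    apply: H; first exact: measurableT_comp.
    by move=> n; case: eqP => // _; exact: measurableT_comp.
  by apply/funext => u; congr Phi; apply/funext => n; rewrite /upd; case: eqP.
move=> [t s] /=; apply: mule_ge0; first by rewrite lee_fin normal_pdf_ge0.
by apply: gauss_mean_ge0.
Qed.

Lemma gmeas_upd N F : gmeas F ->
  jmeas (fun (t : RM) g => F (upd g N t)).
Proof.
move=> mF d' U a f ma mf.
rewrite (_ : (fun u => _) = (fun u => F (fun n => (if n == N then a else f n) u))).
  by apply: mF => n; case: eqP.
by apply/funext => u; congr F; apply/funext => n; rewrite /upd; case: eqP.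
Qed.

Lemma gmeas_upd_at N F t : gmeas F -> gmeas (fun g => F (upd g N t)).
Proof. by move=> mF d' U f mf; exact: (@gmeas_upd N F mF _ U (cst t) f (@measurable_cst _ _ _ _ _ _) mf). Qed.

Lemma gauss_mean_upd_meas N F : (forall g, 0 <= F g) -> gmeas F ->
  measurable_fun setT (fun t : RM => gauss_mean N (fun g => F (upd g N t))).
Proof.
by move=> F0 mF; apply: (gauss_mean_jmeas N (Phi := fun (t : RM) g => F (upd g N t))) => //;
  exact: gmeas_upd.
Qed.

Lemma gauss_mean_le N F G : (forall g, 0 <= F g) -> (forall g, F g <= G g) ->
  gauss_mean N F <= gauss_mean N G.
Proof.
elim: N F G => [|N IH] F G F0 FG; first exact: FG.
rewrite !gauss_meanS; apply: gint_le => t; first exact: gauss_mean_ge0.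
exact: IH.
Qed.

Lemma gauss_meanD N F G : (forall g, 0 <= F g) -> (forall g, 0 <= G g) ->
  gmeas F -> gmeas G ->
  gauss_mean N (fun g => F g + G g) = gauss_mean N F + gauss_mean N G.
Proof.
elim: N F G => [//|N IH] F G F0 G0 mF mG.
rewrite !gauss_meanS -gintD; last 4 first.
- exact: gauss_mean_upd_meas.
- exact: gauss_mean_upd_meas.
- by move=> t; exact: gauss_mean_ge0.
- by move=> t; exact: gauss_mean_ge0.
congr gint; apply/funext => t; apply: IH => //; exact: gmeas_upd_at.
Qed.

Lemma gauss_meanZ N F (c : R) : (forall g, 0 <= F g) -> gmeas F -> (0 <= c)%R ->
  gauss_mean N (fun g => c%:E * F g) = c%:E * gauss_mean N F.
Proof.
elim: N F => [//|N IH] F F0 mF c0.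
rewrite !gauss_meanS -gintZ//; last 2 first.
- exact: gauss_mean_upd_meas.
- by move=> t; exact: gauss_mean_ge0.
congr gint; apply/funext => t; apply: IH => //; exact: gmeas_upd_at.
Qed.

Lemma gauss_mean0 N : gauss_mean N (fun=> 0 : \bar R) = 0.
Proof.
elim: N => [//|N IH]; rewrite gauss_meanS /gint.
by under eq_integral do rewrite IH mule0; rewrite integral0.
Qed.

Lemma gmeas_sum (I : Type) (r : seq I) (F : I -> (nat -> R) -> \bar R) :
  (forall i, gmeas (F i)) -> gmeas (fun g => \sum_(i <- r) F i g).
Proof. by move=> mF d' U f mf; apply: emeasurable_sum => i; exact: mF. Qed.

Lemma gauss_mean_sum N (I : Type) (r : seq I) (F : I -> (nat -> R) -> \bar R) :
  (forall i g, 0 <= F i g) -> (forall i, gmeas (F i)) ->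
  gauss_mean N (fun g => \sum_(i <- r) F i g) = \sum_(i <- r) gauss_mean N (F i).
Proof.
move=> F0 mF; elim: r => [|i r IH].
  rewrite big_nil -[RHS](gauss_mean0 N); congr gauss_mean.
  by apply/funext => g; rewrite big_nil.
rewrite big_cons -IH -gauss_meanD//; last 2 first.
- by move=> g; apply: sume_ge0.
- exact: gmeas_sum.
by congr gauss_mean; apply/funext => g; rewrite big_cons.
Qed.

(** Each coordinate is reflected in its own integral. The induction starts at the zero sequence,
    which sign changes fix. *)
Lemma gauss_mean_flip N F (s : nat -> R) : (forall n, s n = 1%R \/ s n = (-1)%R) ->
  (forall g, 0 <= F g) -> gmeas F ->
  gauss_mean N (fun g => F (fun n => s n * g n)%R) = gauss_mean N F.
Proof.
move=> s1; elim: N F => [|N IH] F F0 mF.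
  by rewrite /=; congr F; apply/funext => n; rewrite mulr0.
rewrite !gauss_meanS.
have E t : gauss_mean N (fun g => F (fun n => s n * upd g N t n)%R) =
    gauss_mean N (fun g => F (upd g N (s N * t))).
  rewrite -(IH (fun g => F (upd g N (s N * t)%R))) //; last exact: gmeas_upd_at.
  congr gauss_mean; apply/funext => g; congr F; apply/funext => n.
  by rewrite /upd; case: eqP => // ->.
under [X in gint X = _]funext => t do rewrite E.
have [->|->] := s1 N.
  by congr gint; apply/funext => t; rewrite mul1r.
rewrite -[RHS]gint_opp//; last 2 first.
- exact: gauss_mean_upd_meas.
- by move=> t; exact: gauss_mean_ge0.
by congr gint; apply/funext => t; rewrite mulN1r.
Qed.

Lemma gauss_mean_lim N (F : nat -> (nat -> R) -> \bar R) :
  (forall n g, 0 <= F n g) -> (forall n, gmeas (F n)) ->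
  (forall g, nondecreasing_seq (F ^~ g)) ->
  gauss_mean N (fun g => limn (F ^~ g)) = limn (fun n => gauss_mean N (F n)).
Proof.
elim: N F => [//|N IH] F F0 mF nd.
rewrite gauss_meanS.
have -> : (fun t => gauss_mean N (fun g => limn (F ^~ (upd g N t)))) =
    (fun t => limn (fun n => gauss_mean N (fun g => F n (upd g N t)))).
  apply/funext => t; apply: (IH (fun n g => F n (upd g N t))) => //.
  by move=> n; exact: gmeas_upd_at.
apply: (gint_lim (f := fun n t => gauss_mean N (fun g => F n (upd g N t)))).
- by move=> n; exact: gauss_mean_upd_meas.
- by move=> n t; exact: gauss_mean_ge0.
- by move=> t m n mn; apply: gauss_mean_le => // g; exact: nd.
Qed.

Lemma gauss_mean_le_lim N F (Fn : nat -> (nat -> R) -> \bar R) c :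
  (forall n g, 0 <= Fn n g) -> (forall n, gmeas (Fn n)) ->
  (forall g, nondecreasing_seq (Fn ^~ g)) -> (forall g, F g = limn (Fn ^~ g)) ->
  (forall n, gauss_mean N (Fn n) <= c) -> gauss_mean N F <= c.
Proof.
move=> F0 mF nd FE H; rewrite (_ : F = fun g => limn (Fn ^~ g)); last exact/funext.
rewrite gauss_mean_lim//; apply: lime_le; last exact: nearW.
by apply: ereal_nondecreasing_is_cvgn => m n mn; apply: gauss_mean_le => // g; exact: nd.
Qed.

End GaussMean.

(** * Measurability of norms and symmetrisation *)

Section NormMeasurable.
Variables (R : realType) (X : completeNormedModType R).
Local Notation RM := (measurableTypeR R).

(** The set where the norm is below [r] is a countable union over rational coefficients [q]: the
    norm at [q] plus the triangle-inequality error [h q] bounds the norm from above and comes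
    arbitrarily close to it. No measurable structure on [X] is involved. *)
Lemma measurable_norm_comb N d (U : measurableType d) (f : 'I_N -> U -> RM) (x : 'I_N -> X) :
  (forall i, measurable_fun setT (f i)) ->
  measurable_fun setT (fun u => `|\sum_(i < N) (f i u : R) *: x i| : RM).
Proof.
move=> mf; apply: (measurability _ (RGenInftyO.measurableE R)) => //.
move=> _ [_ [r ->] <-]; rewrite setTI.
pose h (q : {ffun 'I_N -> rat}) (u : U) : R := `|\sum_(i < N) ratr (q i) *: x i| +
  \sum_(i < N) `|(f i u : R) - ratr (q i)| * `|x i|.
rewrite (_ : _ @^-1` _ = \bigcup_q [set u | h q u < r]); last first.
  apply/seteqP; split => u /=; rewrite in_itv /=.
    set S := \sum_(i < N) _ => Sr.
    (* The approximation error enters twice, once explicitly in [h] and once in the norm at the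
       rational point. The added [1] makes the final inequality strict. *)
    pose c : R := 2 * (\sum_(i < N) `|x i| + 1).
    have c0 : 0 < c by rewrite mulr_gt0// ltr_wpDl// sumr_ge0.
    pose e := (r - `|S|) / c.
    have e0 : 0 < e by rewrite divr_gt0// subr_gt0.
    have Q (i : 'I_N) : {q : rat | `|(f i u : R) - ratr q| <= e}.
      apply: cid; have : (f i u : R) - e < (f i u : R) + e by lra.
      move=> /rat_in_itvoo[q]; rewrite in_itv /= => /andP[q1 q2]; exists q.
      by rewrite ler_norml; apply/andP; split; lra.
    exists [ffun i => sval (Q i)] => //=; rewrite /h.
    set S' := \sum_(i < N) ratr _ *: _; set D := (X in _ + X < _).
    have DE : D <= e * \sum_(i < N) `|x i|.
      rewrite mulr_sumr; apply: ler_sum => i _; rewrite ler_wpM2r// ffunE.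
      exact: (svalP (Q i)).
    have S'D : `|S'| <= `|S| + D.
      have -> : S' = S - \sum_(i < N) ((f i u : R) - ratr ([ffun i => sval (Q i)] i)) *: x i.
        by rewrite -sumrB; apply: eq_bigr => i _; rewrite scalerBl opprB addrC subrK.
      apply: le_trans (ler_normB _ _) _; rewrite lerD2l.
      by apply: le_trans (ler_norm_sum _ _ _) _; apply: ler_sum => i _; rewrite normrZ.
    have : e * c = r - `|S| by rewrite /e divfK// gt_eqF.
    rewrite /c; lra.
  move=> [q _]; apply: le_lt_trans; rewrite /h.
  have -> : \sum_(i < N) (f i u : R) *: x i = \sum_(i < N) ratr (q i) *: x i +
      \sum_(i < N) ((f i u : R) - ratr (q i)) *: x i.
    by rewrite -big_split; apply: eq_bigr => i _ /=; rewrite -scalerDl addrC subrK.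
  apply: le_trans (ler_normD _ _) _; rewrite lerD2l.
  by apply: le_trans (ler_norm_sum _ _ _) _; apply: ler_sum => i _; rewrite normrZ.
apply: countable_bigcupT_measurable => [|q]; first exact: countableP.
have mh : measurable_fun setT (h q : U -> RM).
  apply: measurable_funD => //; apply: measurable_sum => i.
  apply: measurable_funM => //; apply: measurableT_comp => //.
  by apply: measurable_funB; [exact: mf|exact: measurable_cst].
have -> : [set u | h q u < r] = h q @^-1` `]-oo, r[%classic.
  by apply/seteqP; split => u /=; rewrite in_itv.
by rewrite -[X in measurable X]setTI; apply: mh => //; exact: measurable_itv.
Qed.

Lemma gmeas_norm N (x : 'I_N -> X) q :
  gmeas (fun g : nat -> R => (`|rad_sum x g| ^+ q)%:E).
Proof.
move=> d U f mf; apply/measurable_EFinP; apply: measurable_funX.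
by apply: (measurable_norm_comb (f := fun i : 'I_N => f i)) => i; exact: mf.
Qed.

Definition scaled N (x : 'I_N -> X) (g : nat -> R) : 'I_N -> X := fun i => g i *: x i.

(** Outside the range the value is [1], unlike the [0] in [rad_mean], because [gauss_mean_flip] asks
    for signs at every index. *)
Definition flip N (e : {ffun 'I_N -> bool}) : nat -> R :=
  fun n => if @insub nat (fun k => k < N)%N 'I_N n is Some i then sgn R (e i) else 1.

Lemma flip_pm1 N (e : {ffun 'I_N -> bool}) n : flip e n = 1 \/ flip e n = -1.
Proof.
rewrite /flip; case: insubP => [i _ _|_]; last by left.
by case: (e i); [left|right].
Qed.

Lemma rad_sum_flip N (x : 'I_N -> X) g (e : {ffun 'I_N -> bool}) :
  rad_sum x (fun n => flip e n * g n) = sign_sum (scaled x g) e.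
Proof.
by apply: eq_bigr => i _; rewrite /scaled scalerA /flip valK.
Qed.

Lemma gmeas_rad_pow N (x : 'I_N -> X) : gmeas (fun g => (rad_pow 2 (scaled x g))%:E).
Proof.
move=> d U f mf.
have := @gmeas_sum R _ (index_enum {ffun 'I_N -> bool})
  (fun e g => ((2 ^+ N)^-1 * `|rad_sum x (fun n => flip e n * g n)| ^+ 2)%:E).
move=> /(_ _ d U f mf) H.
rewrite (_ : (fun u => _) = fun u => (\sum_(e : {ffun 'I_N -> bool})
  ((2 ^+ N)^-1 * `|rad_sum x (fun n => flip e n * f n u)| ^+ 2)%:E)%E); last first.
  apply/funext => u; rewrite sumEFin /rad_pow mulr_sumr; congr EFin.
  by apply: eq_bigr => e _; rewrite rad_sum_flip.
apply: H => e d' U' f' mf'; apply/measurable_EFinP; apply: measurable_funM => //.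
have := @gmeas_norm N x 2 d' U' (fun n u => flip e n * f' n u : R).
by move=> H; apply/measurable_EFinP/H => n; apply: measurable_funM; [exact: measurable_cst|exact: mf'].
Qed.

(* Gaussians are symmetric, hence may be multiplied by independent random signs. *)
Lemma gauss_norm2_symm N (x : 'I_N -> X) :
  gauss_norm2 x = gauss_mean N (fun g => (rad_pow 2 (scaled x g))%:E).
Proof.
set F := fun g : nat -> R => (`|rad_sum x g| ^+ 2)%:E.
have F0 g : (0 <= F g)%E by rewrite lee_fin sqr_ge0.
have mF : gmeas F := @gmeas_norm N x 2.
have P0 : 0 <= (2 ^+ N)^-1 :> R := pow2N_ge0 R N.
have -> : gauss_mean N (fun g => (rad_pow 2 (scaled x g))%:E) = gauss_mean N (fun g =>
    (\sum_(e : {ffun 'I_N -> bool}) (2 ^+ N)^-1%:E * F (fun n => flip e n * g n)%R)%E).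
  congr gauss_mean; apply/funext => g; rewrite /F /rad_pow mulr_sumr.
  under [in RHS]eq_bigr do rewrite -EFinM.
  rewrite sumEFin; congr EFin.
  by apply: eq_bigr => e _; rewrite rad_sum_flip.
have mFe (e : {ffun 'I_N -> bool}) : gmeas (fun g => F (fun n => flip e n * g n)%R).
  by move=> d U f mf; apply: (mF _ U (fun n u => flip e n * f n u : R)) => n; apply: measurable_funM; [exact: measurable_cst|exact: mf].
rewrite gauss_mean_sum; last 2 first.
- by move=> e g; rewrite mule_ge0// lee_fin.
- move=> e d U f mf; apply: emeasurable_funM => //; exact: mFe.
under eq_bigr => e _.
  rewrite gauss_meanZ//.
  rewrite (gauss_mean_flip N (flip_pm1 e) F0 mF).
  over.
rewrite -ge0_sume_distrl; last by move=> i _; rewrite lee_fin.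
rewrite sumEFin sumr_const -[_ *+ _]mulr_natr card_signs mulVf ?mul1e//.
Qed.

End NormMeasurable.

Section EvenConvex.
Variable R : realType.

(** Such functions increase with [|t|]. This permits comparison in both directions: Gaussians are
    bounded below by constants and above by a discrete law. *)
Definition even_convex (G : R -> R) := (forall t, G (- t) = G t) /\
  forall s t a b, 0 <= a -> 0 <= b -> a + b = 1 -> G (a * s + b * t) <= a * G s + b * G t.

(** The point [s] is a convex combination of [t] and [- t], where [G] takes the same value. *)
Lemma even_convex_mono G s t : even_convex G -> `|s| <= t -> G s <= G t.
Proof.
move=> [Gev Gcv] st; have [t0|tn] := eqVneq t 0.
  by move: st; rewrite t0 normr_le0 => /eqP ->.
have tp : 0 < t by rewrite lt_neqAle eq_sym tn (le_trans _ st).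
have := st; rewrite ler_norml => /andP[s1 s2].
have ta : `|s / t| <= 1 by rewrite normrM normfV (gtr0_norm tp) ler_pdivrMr// mul1r.
move: ta; rewrite ler_norml => /andP[u1 u2].
have := @Gcv t (- t) ((1 + s / t) / 2) ((1 - s / t) / 2).
rewrite Gev.
have -> : (1 + s / t) / 2 * t + (1 - s / t) / 2 * - t = s by field.
have e : (1 + s / t) / 2 + (1 - s / t) / 2 = 1 by field.
rewrite -[X in _ -> _ -> _ -> _ <= X]mulrDl e mul1r; apply => //; lra.
Qed.

Definition coord_even_convex (F : (nat -> R) -> R) :=
  forall n g, even_convex (fun t => F (upd g n t)).

Lemma upd_upd (g : nat -> R) n t s : upd (upd g n t) n s = upd g n s.
Proof. by apply/funext => k; rewrite /upd; case: eqP. Qed.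

Lemma upd_comm (g : nat -> R) n m t s : n != m -> upd (upd g n t) m s = upd (upd g m s) n t.
Proof.
move=> nm; apply/funext => k; rewrite /upd; case: (eqVneq k m) => // ->.
by rewrite eq_sym (negbTE nm).
Qed.

Lemma coord_even_convex_upd F n t : coord_even_convex F ->
  coord_even_convex (fun g => F (upd g n t)).
Proof.
move=> HF m g; have [->|mn] := eqVneq m n.
  rewrite (_ : (fun s => F (upd (upd g n s) n t)) = fun=> F (upd g n t)); last first.
    by apply/funext => s; rewrite upd_upd.
  by split=> // s u a b _ _ ab; rewrite -mulrDl ab mul1r.
rewrite (_ : (fun s => _) = fun s => F (upd (upd g n t) m s)); first exact: HF.
by apply/funext => s; rewrite upd_comm.
Qed.

(** Evenness in one coordinate is invariance under flipping the corresponding sign. It is available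
    because the mean over signs has been taken, which is the purpose of [gauss_norm2_symm]. *)
Lemma rad_pow_coord_even_convex (X : completeNormedModType R) N (x : 'I_N -> X) :
  coord_even_convex (fun g => rad_pow 2 (scaled x g)).
Proof.
move=> n g; split=> [t|s t a b a0 b0 ab].
  rewrite -(rad_pow_flip 2 (scaled x (upd g n t)) (fun i => (i : nat) != n)).
  apply: eq_rad_pow => i; rewrite /scaled /upd; case: eqP => _ /=.
    by rewrite scalerA mulN1r.
  by rewrite scalerA mul1r.
apply: le_trans (rad_pow_convex _ _ a0 b0 ab).
rewrite le_eqVlt; apply/orP; left; apply/eqP/eq_rad_pow => i.
rewrite /scaled /upd; case: eqP => _; first by rewrite scalerDl !scalerA.
by rewrite !scalerA -scalerDl -mulrDl ab mul1r.
Qed.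

End EvenConvex.

Section RGamma.
Variables (R : realType) (X Y : completeNormedModType R).

Lemma bounded_linearZ (T : X -> Y) (a : R) x : bounded_linear T -> T (a *: x) = a *: T x.
Proof.
move=> [lin _]; have T0 : T 0 = 0.
  by have := lin 1 0 0; rewrite !scale1r !addr0 => /(congr1 (fun z => z - T 0)); rewrite subrr addrK.
by have := lin a x 0; rewrite T0 !addr0.
Qed.

Lemma R_bounded_gamma (TT : set (X -> Y)) C : TT `<=` bounded_linear (Y:=Y) ->
  R_bounded_by TT C -> gamma_bounded_by TT C.
Proof.
move=> lin RT N x T TTT; rewrite !gauss_norm2_symm.
rewrite -gauss_meanZ; last 3 first.
- by move=> g; rewrite lee_fin rad_pow_ge0.
- exact: gmeas_rad_pow.
- exact: sqr_ge0.
apply: gauss_mean_le => g; first by rewrite lee_fin rad_pow_ge0.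
rewrite -EFinM lee_fin -!rad_norm_sqr -exprMn.
have H := RT N (scaled x g) T TTT.
have -> : rad_norm (scaled (fun i => T i (x i)) g) = rad_norm (fun i => T i (scaled x g i)).
  rewrite !rad_normE; congr Num.sqrt; apply: eq_rad_pow => i.
  by rewrite /scaled bounded_linearZ //; exact/lin/TTT.
by apply: lerXn2r => //; rewrite nnegrE ?rad_norm_ge0// (le_trans (rad_norm_ge0 _) H).
Qed.

End RGamma.

(** * Rademacher means below Gaussian means *)

Section GaussLower.
Variable R : realType.
Local Notation RM := (measurableTypeR R).
Local Open Scope ereal_scope.

Definition below (b t : R) : R := if (`|t| < b)%R then 1%R else 0%R.

Lemma below_ge0 b t : (0 <= below b t)%R. Proof. by rewrite /below; case: ifP. Qed.

Lemma measurable_below b : measurable_fun setT (below b : RM -> RM).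
Proof.
apply: measurable_fun_ifT => //.
apply: measurable_fun_ltr; last exact: measurable_cst.
exact: normr_measurable.
Qed.

Lemma gint_fin (f : R -> R) : (forall t, 0 <= f t <= 1)%R ->
  gint (EFin \o f) = (fine (gint (EFin \o f)))%:E /\ (0 <= fine (gint (EFin \o f)) <= 1)%R.
Proof.
move=> f01.
have h0 : 0 <= gint (EFin \o f).
  by apply: gint_ge0 => t; rewrite lee_fin; case/andP: (f01 t).
have h1 : gint (EFin \o f) <= 1.
  rewrite -[leRHS](gint1 R); apply: gint_le => t; rewrite lee_fin; by case/andP: (f01 t).
have fin : gint (EFin \o f) \is a fin_num.
  by rewrite ge0_fin_numE//; apply: le_lt_trans h1 _; rewrite ltry.
by split; [rewrite fineK | rewrite -!lee_fin fineK// h0 h1].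
Qed.

Definition gprob_ge1 : R := 1%R - fine (gint (EFin \o below 1)).

(** On the interval from [1] to [2], of length one, the density is at least its value at [2]. *)
Lemma gprob_ge1_gt0 : (0 < gprob_ge1)%R.
Proof.
have b01 t : (0 <= below 1 t <= 1)%R by rewrite /below; case: ifP; rewrite ?lexx ?ler01.
have [E _] := gint_fin b01.
have c0 : (0 < normal_pdf 0 1 2 :> R)%R.
  by rewrite normal_pdfE ?oner_neq0// mulr_gt0 ?expR_gt0// normal_peak_gt0 ?oner_neq0.
set c : R := normal_pdf 0 1 2 in c0.
pose A : set R := `[1%R, 2%R]%classic.
have mA : measurable (A : set RM) by exact: measurable_itv.
have m12 : measurable_fun setT (\1_A : RM -> RM).
  by apply: measurable_indic.
have H : c%:E <= gint (EFin \o (\1_A : R -> R)).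
  have -> : c%:E = \int[lebesgue_measure]_t (c%:E * (\1_A t : R)%:E).
    rewrite ge0_integralZl//; [|exact/measurable_EFinP|by rewrite lee_fin ltW].
    rewrite integral_indic//= setIT /A lebesgue_measure_itv /= lte_fin ltr1n.
    by rewrite -EFinB -EFinM; congr EFin; lra.
  apply: ge0_le_integral_nomeas => t.
    by rewrite mule_ge0// lee_fin ltW.
  rewrite /= -!EFinM lee_fin indicE; case: (boolP (t \in _)) => [|_]; last by rewrite !mulr0.
  rewrite inE /A /= in_itv /= => /andP[t1 t2]; rewrite !mulr1 /c !normal_pdfE ?oner_neq0//.
  rewrite ler_wpM2l ?normal_peak_ge0// /normal_fun ler_expR !subr0 !mulNr lerN2.
  rewrite ler_wpM2r ?invr_ge0 ?mulrn_wge0 ?sqr_ge0//.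
  by apply: lerXn2r; rewrite ?nnegrE; lra.
have : gint (EFin \o below 1) + gint (EFin \o (\1_A : R -> R)) <= 1.
  rewrite -gintD; last 4 first.
  - by apply/measurable_EFinP; exact: measurable_below.
  - exact/measurable_EFinP.
  - by move=> t; rewrite lee_fin below_ge0.
  - by move=> t; rewrite lee_fin.
  rewrite -[leRHS](gint1 R); apply: gint_le => t /=.
    by rewrite -EFinD lee_fin addr_ge0// ?below_ge0.
  rewrite -EFinD lee_fin indicE /below; case: (boolP (t \in _)) => [|_]; last by case: ifP; rewrite addr0.
  rewrite inE /A /= in_itv /= => /andP[t1 t2].
  by rewrite ger0_norm ?ltNge ?t1/= ?add0r//; lra.
rewrite E => H2.
have : (fine (gint (EFin \o below 1)))%:E + c%:E <= 1 by apply: le_trans H2; exact: leeD2l.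
rewrite -EFinD lee_fin /gprob_ge1; lra.
Qed.

(** [G] is at least [G 0] where [|t| < 1] and at least [G 1] elsewhere. Convexity between [0] and
    [1], with the probabilities of the two events as weights, gives the value at [gprob_ge1]. *)
Lemma gint_even_convex_ge (G : R -> R) : (forall t, 0 <= G t)%R -> even_convex G ->
  (G gprob_ge1)%:E <= gint (EFin \o G).
Proof.
move=> G0 Gec; have [Gev Gcv] := Gec.
have b01 t : (0 <= below 1 t <= 1)%R by rewrite /below; case: ifP; rewrite ?lexx ?ler01.
have [E /andP[p0 p1]] := gint_fin b01.
have mb := measurable_below 1.
have b01' t : (0 <= 1 - below 1 t <= 1)%R by move: (b01 t); lra.
apply: (@le_trans _ _ (gint (fun t => (G 0%R)%:E * (below 1 t)%:E + (G 1%R)%:E * (1 - below 1 t)%:E))).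
  have mc : measurable_fun setT (fun t : RM => (1 - below 1 t)%:E).
    by apply/measurable_EFinP; apply: measurable_funB => //; exact: measurable_cst.
  rewrite gintD; last 4 first.
  - by apply: measurable_funeM; exact/measurable_EFinP.
  - exact: measurable_funeM.
  - by move=> t; rewrite mule_ge0// lee_fin// below_ge0.
  - by move=> t; rewrite mule_ge0// lee_fin//; case/andP: (b01' t).
  rewrite !gintZ//; last 3 first.
  - by move=> t; rewrite lee_fin; case/andP: (b01' t).
  - exact/measurable_EFinP.
  - by move=> t; rewrite lee_fin below_ge0.
  have S : gint (EFin \o below 1) + gint (fun t => (1 - below 1 t)%:E) = 1.
    rewrite -gintD//; last 3 first.
    - exact/measurable_EFinP.
    - by move=> t; rewrite lee_fin below_ge0.
    - by move=> t; rewrite lee_fin; case/andP: (b01' t).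
    rewrite -[RHS](gint1 R); congr gint; apply/funext => t /=.
    by rewrite -EFinD; congr EFin; ring.
  have [E' _] := gint_fin b01'.
  rewrite -[gint (fun t => (1 - below 1 t)%:E)]/(gint (EFin \o (fun t => 1 - below 1 t)%R)) E' in S *.
  rewrite -[gint (fun t => (below 1 t)%:E)]/(gint (EFin \o below 1)) E in S *.
  move: S; rewrite -EFinD => -[S].
  rewrite -!EFinM -EFinD lee_fin.
  have := Gcv 0%R 1%R (fine (gint (EFin \o below 1))) gprob_ge1 p0.
  rewrite mulr0 add0r mulr1 /gprob_ge1 => H.
  have -> : fine (gint (EFin \o (fun t => 1 - below 1 t)%R)) = (1 - fine (gint (EFin \o below 1)))%R by lra.
  rewrite [X in (_ <= X)%R](_ : _ = (fine (gint (EFin \o below 1)) * G 0 +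
     (1 - fine (gint (EFin \o below 1))) * G 1)%R); last by ring.
  by apply: H; lra.
apply: gint_le => t.
  rewrite -!EFinM -EFinD lee_fin; apply: addr_ge0; apply: mulr_ge0 => //; first exact: below_ge0.
  by case/andP: (b01' t).
have Gt : G t = G `|t|%R by case: (ger0P t) => // _; rewrite Gev.
rewrite -!EFinM -EFinD lee_fin /below Gt; case: ltP => h.
  by rewrite mulr1 subrr mulr0 addr0 (even_convex_mono Gec)// normr0.
by rewrite mulr0 subr0 mulr1 add0r (even_convex_mono Gec)// normr1.
Qed.

Lemma gauss_mean_ge N (F : (nat -> R) -> R) : (forall g, 0 <= F g)%R -> coord_even_convex F ->
  (F (fun n => if (n < N)%N then gprob_ge1 else 0%R))%:E <= gauss_mean N (EFin \o F).
Proof.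
elim: N F => [|N IH] F F0 Fec; first by rewrite /=; apply: lexx.
rewrite gauss_meanS.
pose gN : nat -> R := fun n => if (n < N)%N then gprob_ge1 else 0%R.
apply: (@le_trans _ _ (gint (fun t => (F (upd gN N t))%:E))).
  have := gint_even_convex_ge (G := fun t => F (upd gN N t)) (fun t => F0 _) (Fec N gN).
  apply: le_trans; rewrite lee_fin; rewrite le_eqVlt; apply/orP; left; apply/eqP.
  congr F; apply/funext => n; rewrite /upd /gN ltnS leq_eqVlt.
  by case: eqP.
apply: gint_le => t; first by rewrite lee_fin.
by apply: (IH (fun g => F (upd g N t))) => //; exact: coord_even_convex_upd.
Qed.

(** By [gauss_mean_ge] every Gaussian may be replaced by the constant [gprob_ge1], which takes the
    place of the first absolute moment in the usual comparison. *)
Lemma rad_le_gauss (X : completeNormedModType R) N (x : 'I_N -> X) :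
  (gprob_ge1 ^+ 2)%:E * (rad_norm x ^+ 2)%:E <= gauss_norm2 x.
Proof.
rewrite gauss_norm2_symm; have := @gauss_mean_ge N (fun g => rad_pow 2 (scaled x g)).
move=> /(_ (fun g => rad_pow_ge0 _ _) (rad_pow_coord_even_convex x)).
apply: le_trans; rewrite -EFinM lee_fin rad_norm_sqr.
rewrite -[X in (X ^+ 2 * _)%R](gtr0_norm gprob_ge1_gt0) -rad_powZ.
rewrite le_eqVlt; apply/orP; left; apply/eqP/eq_rad_pow => i.
by rewrite /scaled ltn_ord.
Qed.

End GaussLower.

(** * Khintchine's upper bound under concavity *)

Section Discretize.
Variable R : realType.
Local Notation RM := (measurableTypeR R).
Implicit Types (B N : nat) (t s : R).

Definition cell (j : nat) t : R := below j.+1%:R t - below j%:R t.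

Lemma below_mono (b b' t : R) : b <= b' -> below b t <= below b' t.
Proof.
move=> bb; rewrite /below; case: ltP => h1; case: ltP => h2 //.
by have := lt_le_trans h1 bb; rewrite ltNge h2.
Qed.

Lemma cell_ge0 j t : 0 <= cell j t.
Proof. by rewrite subr_ge0; apply: below_mono; rewrite ler_nat. Qed.

Lemma below01 (b t : R) : 0 <= below b t <= 1.
Proof. by rewrite /below; case: ifP; rewrite ?lexx ?ler01. Qed.

Lemma cell01 j t : 0 <= cell j t <= 1.
Proof.
rewrite cell_ge0 /cell; have /andP[h1 h2] := below01 j%:R t.
have /andP[h3 h4] := below01 j.+1%:R t; lra.
Qed.

Lemma cell_sum B t : \sum_(j < B) cell j t = below B%:R t.
Proof.
rewrite -(big_mkord xpredT (fun j => cell j t)).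
rewrite (telescope_sumr (fun j => below j%:R t))//.
by rewrite {2}/below ltNge normr_ge0 subr0.
Qed.

Lemma measurable_cell j : measurable_fun setT (cell j : RM -> RM).
Proof. by apply: measurable_funB; exact: measurable_below. Qed.

(* [f] is tested against [cell j], which is supported in [j <= |t| < j.+1]. *)
Lemma cell_le (j : nat) t (a b : R) :
  (j%:R <= `|t| -> `|t| < j.+1%:R -> a <= b) -> a * cell j t <= b * cell j t.
Proof.
move=> H; rewrite /cell /below; case: (ltP `|t| j.+1%:R) => h1.
  case: (ltP `|t| j%:R) => h2; first by rewrite subrr !mulr0.
  by rewrite subr0 !mulr1; exact: H.
have -> : (`|t| < j%:R) = false; last by rewrite subrr !mulr0.
by apply/negbTE; rewrite -leNgt (le_trans _ h1)// ler_nat.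
Qed.

Definition wcell (j : nat) : R := fine (gint (EFin \o cell j)).

Lemma wcell_ge0 j : 0 <= wcell j.
Proof. by have [_ /andP[]] := gint_fin (cell01 j). Qed.

Lemma wcellE j : gint (fun t => (cell j t)%:E) = (wcell j)%:E.
Proof. by have [E _] := gint_fin (cell01 j); rewrite -E. Qed.

Lemma gint_cells (c : nat -> R) B : (forall j, 0 <= c j) ->
  gint (fun t => (\sum_(j < B) c j * cell j t)%:E) = (\sum_(j < B) c j * wcell j)%:E.
Proof.
move=> c0; elim: B => [|B IH].
  rewrite big_ord0 /gint; under eq_integral do rewrite big_ord0 mule0.
  by rewrite integral0.
rewrite big_ord_recr /= EFinD -IH EFinM -wcellE -gintZ//; last 2 first.
- by apply/measurable_EFinP; exact: measurable_cell.
- by move=> t; rewrite lee_fin cell_ge0.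
rewrite -gintD; last 4 first.
- apply/measurable_EFinP; apply: measurable_sum => j.
  by apply: measurable_funM; [exact: measurable_cst|exact: measurable_cell].
- apply/measurable_EFinP.
  by apply: measurable_funM; [exact: measurable_cst|exact: measurable_cell].
- by move=> t; rewrite lee_fin sumr_ge0// => j _; rewrite mulr_ge0// cell_ge0.
- by move=> t; rewrite -EFinM lee_fin mulr_ge0// cell_ge0.
congr gint; apply/funext => t; by rewrite big_ord_recr /= EFinD EFinM.
Qed.

Lemma wcell_sum B : \sum_(j < B) wcell j <= 1.
Proof.
have E := @gint_cells (fun=> 1) B (fun=> ler01).
have E2 : \sum_(j < B) 1 * wcell j = \sum_(j < B) wcell j.
  by apply: eq_bigr => j _; rewrite mul1r.
rewrite -lee_fin -E2 -E.
rewrite -(gint1 R); apply: gint_le => t; rewrite lee_fin; under eq_bigr do rewrite mul1r.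
  by rewrite cell_sum below_ge0.
by rewrite cell_sum; have /andP[] := below01 B%:R t.
Qed.

(** A symmetric discrete law: the Gaussian mass of [cell j] is split evenly between the two outer
    end points [j.+1] and [- j.+1], so that even convex functions only increase. Cells from [B] on
    are discarded, so the mass is at most one. *)
Definition disc1 B : seq (R * R) :=
  [seq (wcell j / 2, j.+1%:R) | j <- iota 0 B] ++
  [seq (wcell j / 2, - j.+1%:R) | j <- iota 0 B].

Lemma disc1E B (f : R -> R) : \sum_(v <- disc1 B) `|v.1| * f v.2 =
  \sum_(j < B) wcell j * ((f j.+1%:R + f (- j.+1%:R)) / 2).
Proof.
rewrite /disc1 big_cat !big_map /= -!/(index_iota 0 B) /=.
rewrite -[X in iota 0 X]subn0 -!/(index_iota 0 B) !big_mkord -big_split /=.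
apply: eq_bigr => j _; rewrite ger0_norm; [by field|by rewrite divr_ge0 ?wcell_ge0].
Qed.

Lemma gint_disc1 B (G : R -> R) : (forall t, 0 <= G t) -> even_convex G ->
  (gint (fun t => (G t * below B%:R t)%:E) <= (\sum_(v <- disc1 B) `|v.1| * G v.2)%:E)%E.
Proof.
move=> G0 Gec; have [Gev _] := Gec.
rewrite disc1E (_ : \sum_(j < B) _ = \sum_(j < B) G j.+1%:R * wcell j); last first.
  by apply: eq_bigr => j _; rewrite Gev; field.
rewrite -(gint_cells (c := fun j => G j.+1%:R) B)//; apply: gint_le => t; first by rewrite lee_fin mulr_ge0// below_ge0.
rewrite lee_fin -cell_sum mulr_sumr; apply: ler_sum => j _.
by apply: cell_le => _ h; apply: even_convex_mono => //; exact: ltW.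
Qed.

Fixpoint gdisc N B : seq (R * (nat -> R)) :=
  if N is N'.+1 then
    [seq (v.1 * d.1, upd d.2 N' v.2) | v <- disc1 B, d <- gdisc N' B]
  else [:: (1, fun=> 0)].

(** The weights enter through absolute values so that they are nonnegative for every element of the
    index type, as [vub_tail_sum] demands, and not only for the listed ones. *)
Definition dmean N B (f : (nat -> R) -> R) : R := \sum_(d <- gdisc N B) `|d.1| * f d.2.

Lemma dmean0 B f : dmean 0 B f = f (fun=> 0).
Proof. by rewrite /dmean /= big_seq1 normr1 mul1r. Qed.

Lemma dmeanS N B f : dmean N.+1 B f =
  \sum_(v <- disc1 B) `|v.1| * dmean N B (fun g => f (upd g N v.2)).
Proof.
rewrite /dmean big_allpairs_dep; apply: eq_bigr => v _.
by rewrite mulr_sumr; apply: eq_bigr => d _ /=; rewrite normrM mulrA.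
Qed.

Lemma even_convex_sum (I : Type) (r : seq I) (c : I -> R) (f : I -> R -> R) :
  (forall i, 0 <= c i) -> (forall i, even_convex (f i)) ->
  even_convex (fun t => \sum_(i <- r) c i * f i t).
Proof.
move=> c0 fe; split=> [t|s t a b a0 b0 ab].
  by apply: eq_bigr => i _; have [-> _] := fe i.
rewrite !mulr_sumr -big_split /=; apply: ler_sum => i _.
have [_ h] := fe i; have := ler_wpM2l (c0 i) (h s t a b a0 b0 ab); lra.
Qed.

Definition cutoff N B (g : nat -> R) : R := \prod_(i < N) below B%:R (g i).

Lemma cutoff_ge0 N B g : 0 <= cutoff N B g.
Proof. by apply: prodr_ge0 => i _; exact: below_ge0. Qed.

Lemma cutoffS N B g t : cutoff N.+1 B (upd g N t) = cutoff N B g * below B%:R t.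
Proof.
rewrite /cutoff big_ord_recr /= {2}/upd eqxx; congr (_ * _); apply: eq_bigr => i _.
by rewrite /upd ltn_eqF.
Qed.

(** One coordinate at a time by [gint_disc1]: partial discrete means stay even and convex in the
    remaining coordinate. The cutoff factor of that coordinate is a constant for the induction
    hypothesis and is absorbed into [F]. *)
Lemma gauss_mean_disc N B (F : (nat -> R) -> R) : (forall g, 0 <= F g) -> coord_even_convex F ->
  (gauss_mean N (fun g => (F g * cutoff N B g)%:E) <= (dmean N B F)%:E)%E.
Proof.
elim: N F => [|N IH] F F0 Fec.
  by rewrite dmean0 /= /cutoff big_ord0 mulr1.
rewrite gauss_meanS dmeanS.
pose G t := dmean N B (fun g => F (upd g N t)).
have G0 t : 0 <= G t by apply: sumr_ge0 => d _; rewrite mulr_ge0.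
have Gec : even_convex G by apply: even_convex_sum => // d; exact: Fec.
apply: le_trans (gint_disc1 B G0 Gec); apply: gint_le => t.
  by apply: gauss_mean_ge0 => g; rewrite lee_fin mulr_ge0// cutoff_ge0.
have := IH (fun g => F (upd g N t) * below B%:R t).
rewrite (_ : dmean N B (fun g => F (upd g N t) * below B%:R t) = G t * below B%:R t); last first.
  by rewrite /G /dmean mulr_suml; apply: eq_bigr => d _; rewrite mulrA.
rewrite (_ : (fun g => (F (upd g N t) * below B%:R t * cutoff N B g)%:E) =
   (fun g => (F (upd g N t) * cutoff N.+1 B (upd g N t))%:E)); last first.
  by apply/funext => g; rewrite cutoffS -mulrA [below _ _ * _]mulrC.
apply=> [g|]; first by rewrite mulr_ge0// below_ge0.
have Fu := coord_even_convex_upd N t Fec.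
move=> n g; have [ev cv] := Fu n g; split=> [s|s u a b a0 b0 ab]; first by rewrite ev.
have := ler_wpM2r (below_ge0 B%:R t) (cv s u a b a0 b0 ab); lra.
Qed.

(** For a symmetric law the term linear in [z] cancels, which leaves [1] plus a quadratic error, the
    form needed for a product of many coordinates. *)
Lemma expR_quad (z : R) : expR z <= 1 + z + z ^+ 2 * expR `|z|.
Proof.
have e0 y : 0 < expR y :> R := expR_gt0 y.
case: (leP 0 z) => z0; rewrite ?(ger0_norm z0) ?(ltr0_norm z0).
  have h : 1 - z <= expR (- z) by have := expR_ge1Dx (- z).
  have h2 : expR z - z * expR z <= 1.
    have := ler_wpM2l (ltW (e0 z)) h; rewrite expRN divff ?gt_eqF//; lra.
  have := ler_wpM2l z0 h2; rewrite expr2; lra.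
have h : 1 - z <= expR (- z) := expR_ge1Dx (- z).
have zz : 0 < - z by lra.
have E : expR z * expR (- z) = 1 by rewrite -expRD subrr expR0.
have h2 : expR z * (1 - z) <= 1 by rewrite -[X in _ <= X]E ler_wpM2l// ltW.
have h3 : 1 <= expR (- z) by have := expR_ge1Dx (- z); lra.
have h4 : z ^+ 2 <= z ^+ 2 * expR (- z) by rewrite ler_peMr// sqr_ge0.
have h5 : expR z <= 1 + z + z ^+ 2.
  rewrite -(@ler_pM2r _ (1 - z)); last lra.
  apply: le_trans h2 _.
  have : 0 <= z ^+ 2 * - z by rewrite mulr_ge0 ?sqr_ge0// ltW.
  rewrite expr2; lra.
lra.
Qed.

Lemma gint_exp_finite (q : R) : 0 <= q -> exists K : R, 0 <= K /\
  (gint (fun t => (expR (q * (`|t| + 1)))%:E) <= K%:E)%E.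
Proof.
move=> q0.
pose c : R := normal_peak 1 / normal_peak 2.
have p2 : 0 < normal_peak 2 :> R by rewrite normal_peak_gt0// pnatr_eq0.
have c0 : 0 <= c by rewrite divr_ge0// normal_peak_ge0.
pose K := c * expR (q + q ^+ 2).
have K0 : 0 <= K by rewrite mulr_ge0// expR_ge0.
exists K; split=> //.
apply: (@le_trans _ _ (\int[lebesgue_measure]_t (K%:E * (normal_pdf 0 2 t)%:E))%E); last first.
  rewrite ge0_integralZl//; last 2 first.
  - by apply/measurable_EFinP; exact: measurable_normal_pdf.
  - by move=> t _; rewrite lee_fin normal_pdf_ge0.
  by rewrite integral_normal_pdf mule1.
apply: ge0_le_integral_nomeas => t; first by rewrite mule_ge0// lee_fin ?normal_pdf_ge0// expR_ge0.
rewrite -!EFinM lee_fin !normal_pdfE ?oner_neq0 ?pnatr_eq0// /normal_fun !subr0.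
rewrite (_ : K * _ = normal_peak 1 * (expR (q + q ^+ 2) * expR (- t ^+ 2 / (2 ^+ 2 *+ 2)))); last first.
  by rewrite /K /c; field; rewrite gt_eqF.
rewrite -mulrA ler_wpM2l ?normal_peak_ge0// -!expRD ler_expR expr1n.
have -> : t ^+ 2 = `|t| ^+ 2 by rewrite real_normK// num_real.
(* The comparison density has standard deviation [2], so [q u - 3 u^2 / 8] must be bounded by [q^2];
   its maximum is at [u = 4 q / 3]. *)
have := sqr_ge0 (`|t| - (4 / 3) * q); set u := `|t|.
have -> : 1 *+ 2 = 2 :> R by [].
have -> : 2 ^+ 2 *+ 2 = 8 :> R by rewrite -mulr_natr expr2; lra.
have : 0 <= q ^+ 2 by exact: sqr_ge0.
rewrite !expr2; nra.
Qed.

(** On [cell j] one has [j.+1 <= |t| + 1], and [y^2 <= e^(2 y)] raises the rate from [q] to [q + 2];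
    then [gint_exp_finite] applies, uniformly in [B]. *)
Lemma wcell_moment (q : R) : 0 <= q -> exists K : R, 0 <= K /\
  forall B, \sum_(j < B) wcell j * (j.+1%:R ^+ 2 * expR (q * j.+1%:R)) <= K.
Proof.
move=> q0; have q2 : 0 <= q + 2 by lra.
have [K [K0 HK]] := gint_exp_finite q2; exists K; split=> // B.
rewrite -lee_fin; apply: le_trans HK.
under eq_bigr do rewrite mulrC.
rewrite -(gint_cells (c := fun j => j.+1%:R ^+ 2 * expR (q * j.+1%:R))); last first.
  by move=> j; rewrite mulr_ge0 ?sqr_ge0 ?expR_ge0.
apply: gint_le => t; rewrite lee_fin.
  by apply: sumr_ge0 => j _; rewrite !mulr_ge0 ?sqr_ge0 ?expR_ge0 ?cell_ge0.
apply: (@le_trans _ _ (\sum_(j < B) expR ((q + 2) * (`|t| + 1)) * cell j t)).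
  apply: ler_sum => j _; apply: cell_le => jt _.
  have j1 : j.+1%:R <= `|t| + 1 by rewrite -natr1; lra.
  apply: (@le_trans _ _ (expR (2 * j.+1%:R) * expR (q * j.+1%:R))).
    rewrite ler_wpM2r ?expR_ge0// (expRM_natl 2).
    by apply: lerXn2r; rewrite ?nnegrE ?expR_ge0// (le_trans _ (expR_ge1Dx _))//; lra.
  by rewrite -expRD ler_expR -mulrDl [2 + q]addrC ler_wpM2l.
rewrite -mulr_sumr cell_sum; apply: ler_piMr; first exact: expR_ge0.
by have /andP[] := below01 B%:R t.
Qed.

Lemma disc1_exp (q : R) : 0 <= q -> exists K : R, 0 <= K /\
  forall B s, `|s| <= q -> \sum_(v <- disc1 B) `|v.1| * expR (s * v.2) <= 1 + K * s ^+ 2.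
Proof.
move=> q0; have [K [K0 HK]] := wcell_moment q0; exists K; split=> // B s sq.
rewrite (disc1E B (fun y => expR (s * y))).
apply: (@le_trans _ _ (\sum_(j < B) (wcell j + s ^+ 2 *
   (wcell j * (j.+1%:R ^+ 2 * expR (q * j.+1%:R)))))); last first.
  rewrite big_split /= -mulr_sumr.
  have := wcell_sum B; have := ler_wpM2l (sqr_ge0 s) (HK B); lra.
apply: ler_sum => j _.
set y : R := j.+1%:R; have y0 : 0 <= y by [].
have h1 := expR_quad (s * y); have h2 := expR_quad (s * - y).
have e : expR `|s * y| <= expR (q * y) by rewrite ler_expR normrM (ger0_norm y0) ler_wpM2r.
have e' : `|s * - y| = `|s * y| by rewrite mulrN normrN.
rewrite e' in h2.
have h3 : (expR (s * y) + expR (s * - y)) / 2 <= 1 + s ^+ 2 * (y ^+ 2 * expR (q * y)).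
  have h4 : (s * y) ^+ 2 * expR `|s * y| <= s ^+ 2 * (y ^+ 2 * expR (q * y)).
    by rewrite exprMn -mulrA ler_wpM2l ?sqr_ge0// ler_wpM2l ?sqr_ge0.
  have h5 : (s * - y) ^+ 2 = (s * y) ^+ 2 by rewrite mulrN sqrrN.
  rewrite h5 in h2; lra.
have := ler_wpM2l (wcell_ge0 j) h3; lra.
Qed.

(** The exponential factorises over the coordinates and [1 + z <= e^z] recombines the factors of
    [disc1_exp]. A bound on the coefficients is enough: later the rate is fixed and [|a|_2 <= 1]. *)
Lemma dmean_exp (q : R) : 0 <= q -> exists K : R, 0 <= K /\
  forall N B (a : nat -> R), (forall i, `|a i| <= q) ->
    dmean N B (fun g => expR (\sum_(i < N) a i * g i)) <= expR (K * \sum_(i < N) a i ^+ 2).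
Proof.
move=> q0; have [K [K0 HK]] := disc1_exp q0; exists K; split=> // N B a aq.
elim: N => [|N IH]; first by rewrite dmean0 !big_ord0 mulr0 expR0.
rewrite dmeanS.
have E v : dmean N B (fun g => expR (\sum_(i < N.+1) a i * upd g N v i)) =
    expR (a N * v) * dmean N B (fun g => expR (\sum_(i < N) a i * g i)).
  rewrite /dmean mulr_sumr; apply: eq_bigr => d _.
  rewrite big_ord_recr /= {2}/upd eqxx addrC expRD mulrCA; congr (_ * (_ * expR _)).
  by apply: eq_bigr => i _; rewrite /upd ltn_eqF.
under eq_bigr do rewrite E mulrA.
rewrite -mulr_suml big_ord_recr /= mulrDr expRD [X in _ <= X]mulrC.
apply: ler_pM => //.
- by apply: sumr_ge0 => v _; rewrite mulr_ge0// expR_ge0.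
- by apply: sumr_ge0 => d _; rewrite mulr_ge0// expR_ge0.
apply: le_trans (HK B (a N) (aq N)) _; exact: expR_ge1Dx.
Qed.

End Discretize.

(** Chernoff's bound: for [q >= 1] and [u = |z| - k >= 0], [u <= e^(q u)]; both signs of [z] are
    covered by adding two exponentials. *)
Lemma tail_le_exp (R : realType) (q z k : R) : 1 <= q ->
  Num.max (`|z| - k) 0 <= expR (- (q * k)) * (expR (q * z) + expR (- q * z)).
Proof.
move=> q1; rewrite ge_max; apply/andP; split; last by rewrite mulr_ge0 ?addr_ge0 ?expR_ge0.
apply: (@le_trans _ _ (expR (- (q * k)) * expR (q * `|z|))).
  rewrite -expRD; have [h|h] := leP 0 (`|z| - k); last by rewrite ltW// (lt_le_trans h)// expR_ge0.
  apply: (@le_trans _ _ (q * (`|z| - k))); first by rewrite ler_peMl.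
  have := expR_ge1Dx (- (q * k) + q * `|z|); lra.
rewrite ler_wpM2l ?expR_ge0//; case: (ger0P z) => _; first by rewrite lerDl expR_ge0.
by rewrite mulrN mulNr lerDr expR_ge0.
Qed.

Section KhintchineUpper.
Variables (R : realType) (X : completeNormedModType R) (L : banach_lattice X).
Local Notation "x <=l y" := (bl_le L x y) (at level 70, no associativity).
Local Notation vabs := (vabs L).

(** Different outcomes need different numbers of slabs. A common, very generous number lets the sums
    over outcomes and over levels be exchanged; since the slabs are summable, its size does not
    matter. *)
Lemma sum_uniform_level (I : Type) (r : seq I) (m : I -> nat) (F : I -> nat -> R) n :
  (forall i, {homo F i : k l / (k <= l)%N >-> k <= l}) ->
  (\sum_(i <- r) m i <= n)%N -> \sum_(i <- r) F i (m i) <= \sum_(i <- r) F i n.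
Proof.
move=> Fm; elim: r => [|i r IH]; first by rewrite !big_nil.
rewrite !big_cons => h; apply: lerD; first by apply: Fm; exact: leq_trans (leq_addr _ _) h.
by apply: IH; exact: leq_trans (leq_addl _ _) h.
Qed.

Lemma vub_abs_le N (x : 'I_N -> X) t (b : 'I_N -> R) : vub L x t ->
  vabs (\sum_(i < N) b i *: x i) <=l (\sum_(i < N) `|b i|) *: t.
Proof.
move=> xt.
have key (c : 'I_N -> R) : (forall i, `|c i| = `|b i|) ->
    \sum_(i < N) c i *: x i <=l (\sum_(i < N) `|b i|) *: t.
  move=> cb; apply: vub_sum => // a a1; apply: ler_sum => i _.
  rewrite -cb; apply: le_trans (ler_norm _) _; rewrite normrM ler_piMl//.
  rewrite -(@expr_le1 _ 2)// real_normK ?num_real//; apply: le_trans a1.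
  by rewrite (bigD1 i)//= lerDl sumr_ge0// => j _; exact: sqr_ge0.
apply/vabsP; split; first exact: key.
rewrite -sumrN; under eq_bigr do rewrite -scaleNr.
by apply: key => i; rewrite normrN.
Qed.

Lemma dmean_norm_pow q C : pos_concave L q.+1 C -> exists A : R, 0 <= A /\
  forall N B (x : 'I_N -> X) t, vub L x t ->
    dmean N B (fun g => `|rad_sum x g| ^+ q.+1) <= A * `|t| ^+ q.+1.
Proof.
move=> conc; have C0 : 0 <= C by case: conc.
(* With this rate the tail at level [k] is at most a multiple of [2^-((q + 1) k)]. That absorbs the
   factor [2^((k + 1) q)] of [expr_sum_le] and leaves [2^q 2^-k], which is summable. *)
pose Q : R := q.+1%:R; have Q1 : 1 <= Q by rewrite ler1n.
have [K [K0 HK]] := dmean_exp (ltW (lt_le_trans ltr01 Q1)).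
pose c := expR (K * Q ^+ 2) *+ 2.
have c0 : 0 <= c by rewrite mulrn_wge0// expR_ge0.
exists (2 ^+ q * Q * C * c * 2); split.
  by rewrite !mulr_ge0// exprn_ge0.
move=> N B x t xt; have t0 := vub_ge0 xt.
pose d k := c * expR (- (Q * k%:R)).
have d0 k : 0 <= d k by rewrite mulr_ge0// expR_ge0.
have tail (k : nat) (a : 'I_N -> R) : \sum_(n < N) a n ^+ 2 <= 1 ->
    \sum_(i <- gdisc R N B) `|i.1| * Num.max (`|\sum_(n < N) a n * i.2 n| - k%:R) 0 <= d k.
  move=> a1; pose a' n := if @insub nat (fun k => k < N)%N 'I_N n is Some i then a i else 0.
  have a'E (i : 'I_N) : a' i = a i by rewrite /a' valK.
  have ai n : `|a' n| <= 1.
    rewrite /a'; case: insubP => [i _ _|_]; last by rewrite normr0.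
    rewrite -(@expr_le1 _ 2)// real_normK ?num_real//; apply: le_trans a1.
    by rewrite (bigD1 i)//= lerDl sumr_ge0// => j _; exact: sqr_ge0.
  have Hs (s : R) : `|s| = Q -> dmean N B (fun g => expR (s * \sum_(n < N) a n * g n)) <= expR (K * Q ^+ 2).
    move=> sQ; have := HK N B (fun n => s * a' n).
    rewrite (_ : dmean N B _ = dmean N B (fun g => expR (s * \sum_(n < N) a n * g n))); last first.
      congr dmean; apply/funext => g; congr expR; rewrite mulr_sumr; apply: eq_bigr => i _.
      by rewrite a'E mulrA.
    move=> H; apply: le_trans (H _) _.
      by move=> i; rewrite normrM sQ ler_piMr// (le_trans ler01).
    rewrite ler_expR ler_wpM2l//; under eq_bigr do rewrite exprMn a'E.
    rewrite -mulr_sumr -(@real_normK _ s) ?num_real// sQ; apply: ler_piMr => //; exact: sqr_ge0.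
  apply: (@le_trans _ _ (\sum_(i <- gdisc R N B) expR (- (Q * k%:R)) *
      (`|i.1| * expR (Q * \sum_(n < N) a n * i.2 n) + `|i.1| * expR (- Q * \sum_(n < N) a n * i.2 n)))).
    apply: ler_sum => i _; rewrite -mulrDr mulrCA ler_wpM2l//; exact: tail_le_exp.
  rewrite -mulr_sumr /d mulrC ler_wpM2r ?expR_ge0// big_split /= /c mulr2n.
  by apply: lerD; apply: Hs; rewrite ?normrN ger0_norm// (le_trans ler01).
pose S (i : R * (nat -> R)) : X := \sum_(n < N) i.2 n *: x n.
have slab k : \sum_(i <- gdisc R N B) `|i.1| * `|vslab L t (S i) k%:R k.+1%:R| ^+ q.+1 <=
    Q * (C * `|t| ^+ q.+1) * d k.
  have := @vslab_norm R X L N x t _ (gdisc R N B) (fun i => `|i.1|) (fun i n => i.2 n) q C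
     k%:R k.+1%:R (d k) conc xt (fun i => normr_ge0 _) (d0 k).
  have e : k.+1%:R - k%:R = 1 :> R by rewrite -natr1; lra.
  rewrite e expr1n mul1r; apply; last exact: tail.
  by rewrite ler0n ltr_nat ltnSn.
(* By the crude l1 bound [vub_abs_le], this many unit slabs exhaust outcome [i]. *)
pose m (i : R * (nat -> R)) := (Num.truncn (\sum_(n < N) `|i.2 n|)).+1.
pose F (i : R * (nat -> R)) n := `|i.1| * \sum_(k < n) 2 ^+ (k.+1 * q) * `|vslab L t (S i) k%:R k.+1%:R| ^+ q.+1.
have F_mono i : {homo F i : k l / (k <= l)%N >-> k <= l}.
  by move=> k l kl; rewrite ler_wpM2l// -(subnK kl) addnC big_split_ord /= lerDl sumr_ge0.
pose n := (\sum_(i <- gdisc R N B) m i)%N.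
apply: (@le_trans _ _ (\sum_(i <- gdisc R N B) F i (m i))).
  apply: ler_sum => i _; rewrite ler_wpM2l//.
  apply: le_trans (expr_sum_le q (m i) (y := fun k => `|vslab L t (S i) k%:R k.+1%:R|) _) => //.
  apply: lerXn2r; rewrite ?nnegrE ?sumr_ge0//.
  apply: (vslab_decomp (l := (m i)%:R) (e := fun k => k%:R) t0) => //.
    by move=> k; rewrite ler_nat.
  apply: vle_trans (vub_abs_le _ xt) _; apply: vscalel_le => //.
  by apply/ltW/truncnS_gt.
apply: le_trans (sum_uniform_level F_mono (leqnn n)) _.
rewrite (_ : \sum_(i <- _) _ = \sum_(k < n) 2 ^+ (k.+1 * q) *
    \sum_(i <- gdisc R N B) `|i.1| * `|vslab L t (S i) k%:R k.+1%:R| ^+ q.+1); last first.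
  rewrite /F; under eq_bigr do rewrite mulr_sumr.
  rewrite exchange_big /=; apply: eq_bigr => k _; rewrite mulr_sumr; apply: eq_bigr => i _.
  by rewrite mulrCA.
set T := `|t| ^+ q.+1; have T0 : 0 <= T by exact: exprn_ge0.
apply: (@le_trans _ _ (\sum_(k < n) (2 ^+ q * Q * C * c * T) * 2^-1 ^+ k)).
  apply: ler_sum => k _.
  apply: le_trans (ler_wpM2l _ (slab k)) _; first exact: exprn_ge0.
  have e1 : expR (- (Q * k%:R)) <= 2^-1 ^+ (q.+1 * k).
    rewrite expRN -natrM -[_%:R]mulr1 expRM_natl exprVn lef_pV2 ?posrE ?exprn_gt0 ?expR_gt0//.
    by apply: lerXn2r; rewrite ?nnegrE ?expR_ge0//; have := expR_ge1Dx (1 : R); lra.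
  have e2 : 2 ^+ (k.+1 * q) * 2^-1 ^+ (q.+1 * k) = 2 ^+ q * 2^-1 ^+ k :> R.
    have h : 2 ^+ (q * k) * 2^-1 ^+ (q * k) = 1 :> R by rewrite -exprMn divff ?expr1n.
    by rewrite mulSn exprD (mulnC k q) mulSn [2^-1 ^+ (k + _)]exprD mulrACA h mulr1.
  have h : 0 <= 2 ^+ (k.+1 * q) * (Q * (C * T)) * c :> R by rewrite !mulr_ge0// exprn_ge0.
  have := ler_wpM2l h e1; rewrite /d -/T.
  have -> : 2 ^+ (k.+1 * q) * (Q * (C * T)) * c * 2^-1 ^+ (q.+1 * k) =
    (2 ^+ (k.+1 * q) * 2^-1 ^+ (q.+1 * k)) * (Q * (C * T)) * c by ring.
  rewrite e2; lra.
rewrite -mulr_sumr.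
have h : 0 <= 2 ^+ q * Q * C * c * T by rewrite !mulr_ge0// exprn_ge0.
have := ler_wpM2l h (geom_half_le R n); lra.
Qed.

Lemma vub_flip N (x : 'I_N -> X) t (c : 'I_N -> bool) : vub L x t ->
  vub L (fun i => sgn R (c i) *: x i) t.
Proof.
move=> xt a a1; under eq_bigr do rewrite scalerA.
by apply: xt; under eq_bigr do rewrite exprMn sgn_sqr mulr1.
Qed.

(** The case [a = 0] of [dmean_exp]: the truncated law has mass at most one. *)
Lemma dmean1 N B : dmean N B (fun=> 1 : R) <= 1.
Proof.
have [K [_ HK]] := dmean_exp (ler01 : 0 <= 1 :> R).
have : dmean N B (fun g => expR (\sum_(i < N) 0 * g i)) <= expR (K * \sum_(i < N) 0 ^+ 2).
  by apply: (HK N B (fun=> 0)) => i; rewrite normr0.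
rewrite (_ : (fun g : nat -> R => _) = fun=> 1); last first.
  by apply/funext => g; rewrite big1 ?expR0// => i _; rewrite mul0r.
by rewrite big1 ?mulr0 ?expR0// => i _; rewrite expr0n.
Qed.

(** With [z = y / |t|], the elementary bound [z^2 <= 1 + z^(q + 2)] lowers the exponent to two,
    where the definition of gamma-bounds lives. *)
Lemma dmean_norm_sqr q C : pos_concave L q.+2 C -> exists A : R, 0 <= A /\
  forall N B (x : 'I_N -> X) t, vub L x t ->
    dmean N B (fun g => `|rad_sum x g| ^+ 2) <= A * `|t| ^+ 2.
Proof.
move=> conc; have [A [A0 HA]] := dmean_norm_pow conc.
exists (1 + A); split; first by rewrite addr_ge0.
move=> N B x t xt; have t0 := vub_ge0 xt.
have [tz|tn] := eqVneq t 0.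
  rewrite /dmean big1 => [|d _].
    by rewrite mulr_ge0 ?addr_ge0 ?sqr_ge0.
  have := vub_abs_le (fun i : 'I_N => d.2 i) xt; rewrite tz scaler0 => h.
  have := vnorm_le0 (vabs_ge0 L _) h; rewrite vnorm_abs normr0 normr_le0 => /eqP h2.
  by rewrite /rad_sum h2 normr0 expr0n mulr0.
have tp : 0 < `|t| by rewrite normr_gt0.
have key y : 0 <= y -> y ^+ 2 <= `|t| ^+ 2 * (1 + y ^+ q.+2 / `|t| ^+ q.+2).
  move=> y0; rewrite -expr_div_n -{1}[y](divfK (lt0r_neq0 tp)).
  have z0 : 0 <= y / `|t| by rewrite divr_ge0.
  rewrite exprMn mulrC ler_wpM2l ?sqr_ge0//; set z := y / `|t| in z0 *.
  have [z1|z1] := leP z 1.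
    by apply: le_trans (_ : 1 <= _); rewrite ?expr_le1// lerDl exprn_ge0.
  by apply: (@le_trans _ _ (z ^+ q.+2)); [rewrite ler_weXn2l// ltW|rewrite lerDr].
apply: (@le_trans _ _ (`|t| ^+ 2 * (dmean N B (fun=> 1) +
    dmean N B (fun g => `|rad_sum x g| ^+ q.+2) / `|t| ^+ q.+2))).
  rewrite /dmean mulr_suml -big_split mulr_sumr /=; apply: ler_sum => d _.
  have := ler_wpM2l (normr_ge0 d.1) (key _ (normr_ge0 (rad_sum x d.2))).
  by move/le_trans; apply; rewrite le_eqVlt; apply/orP; left; apply/eqP; ring.
rewrite mulrC ler_wpM2r ?sqr_ge0//; apply: lerD; first exact: dmean1.
by rewrite ler_pdivrMr ?exprn_gt0//; exact: HA.
Qed.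

(** For fixed signs, these are moved from the coefficients to the vectors; [vub] does not see them
    ([vub_flip]), so one bound serves all sign patterns. *)
Lemma dmean_rad_pow N B (x : 'I_N -> X) (c : R) :
  (forall e : {ffun 'I_N -> bool}, dmean N B (fun g => `|rad_sum (fun i => sgn R (e i) *: x i) g| ^+ 2) <= c) ->
  dmean N B (fun g => rad_pow 2 (scaled x g)) <= c.
Proof.
move=> H; apply: (@le_trans _ _ ((2 ^+ N)^-1 * \sum_(e : {ffun 'I_N -> bool})
   dmean N B (fun g => `|rad_sum (fun i => sgn R (e i) *: x i) g| ^+ 2))).
  rewrite /dmean exchange_big mulr_sumr; apply: ler_sum => d _.
  rewrite -mulr_sumr mulrCA ler_wpM2l// ler_wpM2l ?pow2N_ge0//.
  apply: ler_sum => e _; rewrite (_ : sign_sum _ e = rad_sum (fun i => sgn R (e i) *: x i) d.2)//.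
  by apply: eq_bigr => i _; rewrite /scaled !scalerA mulrC.
apply: (@le_trans _ _ ((2 ^+ N)^-1 * \sum_(e : {ffun 'I_N -> bool}) c)).
  by rewrite ler_wpM2l ?pow2N_ge0//; apply: ler_sum => e _.
have -> : \sum_(e : {ffun 'I_N -> bool}) c = 2 ^+ N * c.
  by rewrite sumr_const -(card_signs R N) mulr_natl.
by rewrite mulrA mulVf ?mul1r// expf_neq0.
Qed.

(** Symmetrise, cut off at [B], pass to the discrete law, and use a bound independent of [B].
    Monotone convergence removes the cutoff, which at each point equals [1] from some [B] on. *)
Lemma gauss_le_vub q C : pos_concave L q.+2 C -> exists A : R, 0 <= A /\
  forall N (x : 'I_N -> X) t, vub L x t ->
    (gauss_norm2 x <= (A * `|t| ^+ 2)%:E)%E.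
Proof.
move=> conc; have [A [A0 HA]] := dmean_norm_sqr conc.
exists A; split=> // N x t xt; rewrite gauss_norm2_symm.
pose Fn B (g : nat -> R) : \bar R := (rad_pow 2 (scaled x g) * cutoff N B g)%:E.
apply: (@gauss_mean_le_lim _ _ _ Fn).
- by move=> B g; rewrite lee_fin mulr_ge0 ?rad_pow_ge0 ?cutoff_ge0.
- move=> B d U f mf; apply/measurable_EFinP; apply: measurable_funM.
    exact/measurable_EFinP/gmeas_rad_pow.
  apply: measurable_prod => i _; apply: measurableT_comp; last exact: mf.
  exact: measurable_below.
- move=> g B B' BB; rewrite lee_fin ler_wpM2l ?rad_pow_ge0//.
  apply: ler_prod => i _; rewrite below_ge0 below_mono// ler_nat//.
- move=> g; apply/esym/cvg_lim => //; apply: cvg_near_cst.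
  exists (Num.truncn (\sum_(i < N) `|g i|)).+1 => // B /= HB.
  rewrite /Fn /cutoff big1 ?mulr1// => i _; rewrite /below.
  suff -> : `|g i| < B%:R by [].
  apply: le_lt_trans (_ : \sum_(i < N) `|g i| < _).
    by rewrite (bigD1 i)//= lerDl sumr_ge0.
  by apply: lt_le_trans (truncnS_gt _) _; rewrite ler_nat.
move=> B; apply: le_trans (gauss_mean_disc N B _ _) _.
- by move=> g; exact: rad_pow_ge0.
- exact: rad_pow_coord_even_convex.
rewrite lee_fin; apply: dmean_rad_pow => e; apply: HA; exact: vub_flip.
Qed.

End KhintchineUpper.

(** * Cotype and concavity *)

Section Cotype.
Variables (R : realType) (X : completeNormedModType R) (L : banach_lattice X).
Local Notation "x <=l y" := (bl_le L x y) (at level 70, no associativity).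
Local Notation vabs := (vabs L).
Local Notation vmeet := (vmeet L).

(** All signed sums of positive [f i] lie between [- t] and [t], so the cotype inequality bounds the
    sum of [|f i|^q]. As [|f i| <= |t|], the real exponent may be raised to an integer. *)
Lemma finite_cotype_pos_concave : finite_cotype X ->
  exists q C, pos_concave L q.+2 C.
Proof.
move=> [q [q2 [C HC]]].
pose k := (Num.truncn q).
have kq : q <= k.+2%:R.
  by apply: ltW; apply: lt_le_trans (truncnS_gt q) _; rewrite ler_nat.
have q0 : 0 < q by lra.
have qi : q != 0 by rewrite gt_eqF.
(* The absolute value is taken because [finite_cotype] puts no sign on its constant. *)
exists k, (`|C| `^ q); split; first exact: powR_ge0.
move=> n f t f0 ft.
have fit i : (i < n)%N -> f i <=l t.
  move=> ni; apply: vle_trans ft; rewrite (bigD1 (Ordinal ni)) //= -{1}[f i]addr0.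
  by apply/vleD2l/vsum_ge0 => j _; exact: f0.
have [tz|tn] := eqVneq t 0.
  rewrite big1 => [|i _]; first by rewrite tz normr0 expr0n mulr0.
  have := vnorm_le0 (f0 i (ltn_ord i)) (fit i (ltn_ord i)).
  by rewrite tz normr0 normr_le0 => /eqP ->; rewrite normr0 expr0n.
have tp : 0 < `|t| by rewrite normr_gt0.
have ut (i : 'I_n) : `|f i| <= `|t| by apply: (vnorm_le0 (L := L)); [exact: f0|exact: fit].
have H : \sum_(i < n) `|f i| `^ q <= `|C| `^ q * `|t| `^ q.
  have := HC n (fun i => f i); set A := \sum_(i < n) _; set B := rad_mean _ _ => H.
  have A0 : 0 <= A by apply: sumr_ge0 => i _; exact: powR_ge0.
  have B0 : 0 <= B.
    apply: mulr_ge0; first by rewrite invr_ge0 exprn_ge0.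
    by apply: sumr_ge0 => e _; exact: powR_ge0.
  have Bt : B <= `|t| `^ q.
    rewrite /B rad_meanE.
    apply: (@le_trans _ _ (#|{ffun 'I_n -> bool}|%:R^-1 * \sum_(e : {ffun 'I_n -> bool}) `|t| `^ q)).
      rewrite ler_wpM2l ?invr_ge0//; apply: ler_sum => e _.
      apply: ge0_ler_powR; rewrite ?nnegrE//; first exact: ltW.
      rewrite (rad_sum_signs (fun i : 'I_n => f i)).
      have key (c : {ffun 'I_n -> bool}) : sign_sum (fun i : 'I_n => f i) c <=l t.
        apply: vle_trans ft; apply: vle_sum => i _.
        by case: (c i); rewrite /sgn ?scale1r ?scaleN1r; [exact: vle_refl|apply/vge0N/f0].
      apply: (vnorm_le (L := L)) => //.
      rewrite (_ : - _ = sign_sum (fun i : 'I_n => f i) [ffun i => ~~ e i])//.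
      rewrite /sign_sum -sumrN; apply: eq_bigr => i _; rewrite ffunE -scaleNr.
      by case: (e i); rewrite /sgn ?opprK.
    have -> : \sum_(e : {ffun 'I_n -> bool}) `|t| `^ q = #|{ffun 'I_n -> bool}|%:R * `|t| `^ q.
      by rewrite sumr_const mulr_natl.
    rewrite mulrA mulVf ?mul1r// pnatr_eq0 -lt0n; exact: cards_signs_gt0.
  have E (y : R) : 0 <= y -> y = (y `^ q^-1) `^ q.
    by move=> y0; rewrite -powRrM mulVf// powRr1.
  rewrite (E A A0).
  apply: (@le_trans _ _ ((`|C| * B `^ q^-1) `^ q)).
    apply: ge0_ler_powR; rewrite ?nnegrE ?powR_ge0 ?mulr_ge0 ?powR_ge0//; first exact: ltW.
    by apply: le_trans H _; rewrite ler_wpM2r ?powR_ge0 ?ler_norm.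
  rewrite powRM ?powR_ge0// -E// ler_wpM2l ?powR_ge0//.
have tk : 0 < `|t| ^+ k.+2 by rewrite exprn_gt0.
apply: (@le_trans _ _ (\sum_(i < n) (`|f i| `^ q / `|t| `^ q) * `|t| ^+ k.+2)); last first.
  have -> : \sum_(i < n) (`|f i| `^ q / `|t| `^ q) * `|t| ^+ k.+2 =
    (\sum_(i < n) `|f i| `^ q) / `|t| `^ q * `|t| ^+ k.+2 by rewrite !mulr_suml.
  rewrite (ler_wpM2r (ltW tk))// ler_pdivrMr//; last exact: powR_gt0.
apply: ler_sum => i _.
rewrite -ler_pdivrMr// -expr_div_n.
have [fz|fn] := eqVneq (`|f i|) 0.
  by rewrite fz mul0r expr0n /= powR0// mul0r.
have fp : 0 < `|f i| by rewrite lt_neqAle eq_sym fn normr_ge0.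
have u0 : 0 < `|f i| / `|t| by rewrite divr_gt0.
have -> : `|f i| `^ q / `|t| `^ q = (`|f i| / `|t|) `^ q.
  have -> : `|f i| `^ q = ((`|f i| / `|t|) * `|t|) `^ q by rewrite divfK// gt_eqF.
  by rewrite powRM ?ltW// mulfK// gt_eqF// powR_gt0.
rewrite -powR_mulrn; last exact: ltW.
apply: ger_powR => //.
by rewrite u0 ler_pdivrMr// mul1r; exact: ut.
Qed.

Lemma vslab_dyadic t s K : vabs s <=l t -> 0 <=l t ->
  `|s| <= \sum_(j < K) `|vslab L t s (4^-1 ^+ j.+1) (4^-1 ^+ j)| + 4^-1 ^+ K * `|t|.
Proof.
move=> st t0.
have H : `|s| <= \sum_(j < K) `|vslab L t s (4^-1 ^+ j.+1) (4^-1 ^+ j)| +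
    `|vmeet (vabs s) (4^-1 ^+ K *: t)|.
  elim: K => [|K IH]; first by rewrite big_ord0 expr0 scale1r add0r (vmeet_eql st) vnorm_abs.
  apply: le_trans IH _; rewrite big_ord_recr /= -addrA lerD2l.
  by apply: le_trans (ler_normD _ _); rewrite /vslab subrK.
apply: le_trans H _; rewrite lerD2l.
have h : 0 <= 4^-1 ^+ K :> R by apply: exprn_ge0; rewrite invr_ge0.
rewrite -[X in X * _](ger0_norm h) -normrZ; apply: (vnorm_le0 (L := L)); last exact: vmeet_r.
by apply/vmeetP; split; [exact: vabs_ge0|exact: vscale_ge0].
Qed.

(** From sums to square functions: each [|x i|] is cut at the levels [4^-j] of [t]. The slab bound
    [4^j * 4^(-j (q + 3))] against the factor [2^(j (q + 3))] of [expr_sum_le] leaves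
    [2^(-j (q + 1))], which explains the exponent [q.+4]. *)
Lemma pos_concave_sqfun q C : pos_concave L q.+4 C -> exists A : R, 0 <= A /\
  forall N (x : 'I_N -> X) t, vub L x t ->
    \sum_(i < N) `|x i| ^+ q.+4 <= A * `|t| ^+ q.+4.
Proof.
move=> conc; have C0 : 0 <= C by case: conc.
pose D : R := 2 ^+ q.+3 * (q.+4%:R * C); have D0 : 0 <= D by apply: mulr_ge0; [exact: exprn_ge0|exact: mulr_ge0].
exists (2 ^+ q.+3 * (D * 2 + 1)); split; first by rewrite mulr_ge0 ?exprn_ge0// addr_ge0// mulr_ge0.
move=> N x t xt; have t0 := vub_ge0 xt.
set T := `|t| ^+ q.+4; have T0 : 0 <= T by exact: exprn_ge0.
have sumE (i : 'I_N) : \sum_(n < N) (n == i)%:R *: x n = x i.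
  rewrite (bigD1 i) //= eqxx scale1r big1 ?addr0// => n /negbTE ->; exact: scale0r.
have xit i : vabs (x i) <=l t.
  have d1 : \sum_(n < N) (n == i)%:R ^+ 2 <= 1 :> R.
    by rewrite (bigD1 i) //= eqxx expr1n big1 ?addr0// => n /negbTE ->; rewrite expr0n.
  apply/vabsP; split; first by rewrite -sumE; exact: xt.
  rewrite -sumE -sumrN; under eq_bigr do rewrite -scaleNr.
  by apply: xt; under eq_bigr do rewrite sqrrN.
pose y j i := `|vslab L t (x i) (4^-1 ^+ j.+1) (4^-1 ^+ j)|.
have p0 k : 0 < 4^-1 ^+ k :> R by rewrite exprn_gt0// invr_gt0.
have slab j : 2 ^+ (j.+1 * q.+3) * (\sum_(i < N) y j i ^+ q.+4) <= D * T * 2^-1 ^+ j.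
  have := @vslab_norm R X L N x t _ (index_enum 'I_N) (fun=> 1) (fun i n => (n == i)%:R) q.+3 C
     (4^-1 ^+ j.+1) (4^-1 ^+ j) (4 ^+ j) conc xt (fun=> ler01).
  under eq_bigr do rewrite sumE mul1r -/(y j _).
  move=> H; have {H} : \sum_(i < N) y j i ^+ q.+4 <=
      q.+4%:R * (C * T) * ((4^-1 ^+ j - 4^-1 ^+ j.+1) ^+ q.+3 * 4 ^+ j).
    apply: H; first by rewrite exprn_ge0.
      apply/andP; split; first exact: ltW.
      by rewrite exprS gtr_pMl//; lra.
    move=> a a1; apply: (@le_trans _ _ (\sum_(i < N) 4 ^+ j * a i ^+ 2)); last first.
      by rewrite -mulr_sumr ler_piMr// exprn_ge0.
    apply: ler_sum => i _; rewrite mul1r.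
    have -> : \sum_(n < N) a n * (n == i)%:R = a i.
      by rewrite (bigD1 i) //= eqxx mulr1 big1 ?addr0// => n /negbTE ->; rewrite mulr0.
    rewrite ge_max; apply/andP; split; last by apply: mulr_ge0; [exact: exprn_ge0|exact: sqr_ge0].
    set l : R := 4^-1 ^+ j.+1.
    have lE : 4 ^+ j * l = 4^-1 by rewrite /l exprS mulrCA -exprMn divff ?expr1n ?mulr1.
    (* This is [|a| - l <= a^2 / (4 l)], and [1 / (4 l) = 4^j]; summing over [i] gives the tail
       bound [d = 4^j]. *)
    have sq := sqr_ge0 (`|a i| - 2 * l).
    have w0 : 0 <= 4 ^+ j :> R by rewrite exprn_ge0.
    have := mulr_ge0 w0 sq.
    rewrite (_ : 4 ^+ j * (`|a i| - 2 * l) ^+ 2 = 4 ^+ j * `|a i| ^+ 2 - 4 * (4 ^+ j * l) * (`|a i| - l)); last by ring.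
    rewrite lE real_normK ?num_real//; lra.
  move=> H; have e2 : 0 <= 2 ^+ (j.+1 * q.+3) :> R by rewrite exprn_ge0.
  apply: le_trans (ler_wpM2l e2 H) _.
  have e3 : (4^-1 ^+ j - 4^-1 ^+ j.+1) ^+ q.+3 <= (4^-1 ^+ j) ^+ q.+3 :> R.
    apply: lerXn2r; rewrite ?nnegrE; [|exact: ltW|by rewrite gerBl ltW].
    rewrite subr_ge0 exprS; apply: ler_piMl; [exact: ltW|lra].
  have w0 : 0 <= 2 ^+ (j.+1 * q.+3) * (q.+4%:R * (C * T)) * 4 ^+ j :> R.
    apply: mulr_ge0; last exact: exprn_ge0.
    by apply: mulr_ge0 => //; apply: mulr_ge0 => //; exact: mulr_ge0.
  apply: (@le_trans _ _ (2 ^+ (j.+1 * q.+3) * (q.+4%:R * (C * T)) * 4 ^+ j * (4^-1 ^+ j) ^+ q.+3)).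
    have := ler_wpM2l w0 e3; lra.
  have e4 : 2 ^+ (j.+1 * q.+3) * 4 ^+ j * (4^-1 ^+ j) ^+ q.+3 <= 2 ^+ q.+3 * 2^-1 ^+ j :> R.
    have f4 : 4 = 2 ^+ 2 :> R by rewrite expr2; lra.
    set u : R := 2^-1 ^+ j; pose v : R := 2 ^+ j.
    have vu : v * u = 1 by rewrite -exprMn divff ?expr1n.
    have u0 : 0 <= u by apply: exprn_ge0; rewrite invr_ge0.
    have E1 : 2 ^+ (j.+1 * q.+3) = 2 ^+ q.+3 * v ^+ q.+3 by rewrite mulSn exprD exprM.
    have E2 : 4 ^+ j = v ^+ 2 by rewrite f4 exprAC.
    have E3 : 4^-1 ^+ j = u ^+ 2 by rewrite f4 -exprVn exprAC.
    rewrite E1 E2 E3.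
    have E4 : v ^+ q.+3 * v ^+ 2 * (u ^+ 2) ^+ q.+3 = (v * u) ^+ q.+3 * (v * u) ^+ 2 * u ^+ q.+1.
      have E5 : (u ^+ 2) ^+ q.+3 = u ^+ q.+3 * u ^+ q.+3 by rewrite expr2 exprMn.
      have E6 : u ^+ q.+3 = u ^+ 2 * u ^+ q.+1 by rewrite -exprD.
      by rewrite E5 !exprMn {2}E6; ring.
    have -> : 2 ^+ q.+3 * v ^+ q.+3 * v ^+ 2 * (u ^+ 2) ^+ q.+3 =
      2 ^+ q.+3 * (v ^+ q.+3 * v ^+ 2 * (u ^+ 2) ^+ q.+3) by rewrite !mulrA.
    rewrite E4 vu !expr1n !mul1r; apply: ler_wpM2l; first exact: exprn_ge0.
    rewrite exprS; apply: ler_piMr => //.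
    by apply: exprn_ile1 => //; apply: exprn_ile1; rewrite ?invr_ge0//; lra.
  have := ler_wpM2r (mulr_ge0 (ler0n R q.+4) (mulr_ge0 C0 T0)) e4; rewrite /D; lra.
have slabs : \sum_(i < N) (\sum_(j < N) y j i) ^+ q.+4 <= D * 2 * T.
  apply: (@le_trans _ _ (\sum_(i < N) \sum_(j < N) 2 ^+ (j.+1 * q.+3) * y j i ^+ q.+4)).
    by apply: ler_sum => i _; apply: (expr_sum_le q.+3 N (y := y ^~ i)) => j; exact: normr_ge0.
  rewrite exchange_big /=; apply: (@le_trans _ _ (\sum_(j < N) D * T * 2^-1 ^+ j)).
    by apply: ler_sum => j _; rewrite -mulr_sumr; exact: slab.
  rewrite -mulr_sumr; have := ler_wpM2l (mulr_ge0 D0 T0) (geom_half_le R N); lra.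
(* The number of levels is taken equal to the number [N] of vectors, so that the [N] remainders are
   paid for by [N <= 4^N]. *)
have rest : \sum_(i < N) (4^-1 ^+ N * `|t|) ^+ q.+4 <= T.
  rewrite sumr_const card_ord -[X in X <= _]mulr_natl exprMn mulrA -/T; apply: ler_piMl => //.
  have h1 : (4^-1 ^+ N) ^+ q.+4 <= 4^-1 ^+ N :> R.
    by rewrite exprS; apply: ler_piMr; [exact: ltW|apply: exprn_ile1; [exact: ltW|
       apply: exprn_ile1; rewrite ?invr_ge0//; lra]].
  have h2 : N%:R <= 4 ^+ N :> R by rewrite -natrX ler_nat ltnW// ltn_expl.
  have h3 : N%:R * 4^-1 ^+ N <= 4 ^+ N * 4^-1 ^+ N :> R by rewrite ler_wpM2r// ltW.
  rewrite -exprMn divff// expr1n in h3; apply: le_trans h3.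
  by rewrite ler_wpM2l.
apply: (@le_trans _ _ (\sum_(i < N) 2 ^+ q.+3 * ((\sum_(j < N) y j i) ^+ q.+4 + (4^-1 ^+ N * `|t|) ^+ q.+4))).
  apply: ler_sum => i _; apply: le_trans (exprD_convex q.+3 _ _); last 2 first.
  - by apply: sumr_ge0 => j _; exact: normr_ge0.
  - by apply: mulr_ge0 => //; exact: ltW.
  apply: lerXn2r; rewrite ?nnegrE//.
    by apply: addr_ge0; [apply: sumr_ge0 => j _; exact: normr_ge0|apply: mulr_ge0 => //; exact: ltW].
  exact: vslab_dyadic.
rewrite -mulr_sumr big_split /= -mulrA; apply: ler_wpM2l; first exact: exprn_ge0.
lra.
Qed.

(** Apply [pos_concave_sqfun] with [t = rad_bound L x], whose norm is at most [e] times the first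
    Rademacher moment, and raise the exponent of the moment by Jensen's inequality. *)
Lemma pos_concave_finite_cotype q C : pos_concave L q.+4 C -> finite_cotype X.
Proof.
move=> conc; have [A [A0 HA]] := pos_concave_sqfun conc.
pose Q : R := q.+4%:R; have Q0 : 0 < Q by rewrite ltr0n.
pose K := A * expR 1 ^+ q.+4; have K0 : 0 <= K by rewrite mulr_ge0// exprn_ge0// expR_ge0.
exists Q; split; first by rewrite /Q (ler_nat _ 2).
exists (K `^ Q^-1) => N x.
have Qi0 : 0 <= Q^-1 by rewrite invr_ge0 ltW.
have -> : \sum_(i < N) `|x i| `^ Q = \sum_(i < N) `|x i| ^+ q.+4.
  by apply: eq_bigr => i _; rewrite powR_mulrn.
have -> : rad_mean N (fun g => `|rad_sum x g| `^ Q) = rad_pow q.+4 x.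
  by congr (_ * _); apply: eq_bigr => e _; rewrite powR_mulrn// rad_sum_signs.
rewrite -powRM ?rad_pow_ge0//.
apply: ge0_ler_powR; rewrite ?nnegrE ?sumr_ge0//; first by rewrite mulr_ge0 ?rad_pow_ge0.
apply: le_trans (HA _ _ _ (@rad_bound_vub _ _ L _ x)) _.
rewrite /K -mulrA ler_wpM2l//.
apply: (@le_trans _ _ ((expR 1 * rad_pow 1 x) ^+ q.+4)).
  by apply: lerXn2r; rewrite ?nnegrE; [exact: normr_ge0|apply: mulr_ge0; [exact: expR_ge0|exact: rad_pow_ge0]|exact: rad_bound_norm].
by rewrite exprMn ler_wpM2l ?exprn_ge0 ?expR_ge0//; exact: rad_pow_le_pow.
Qed.

(** The failure of this is a positive copy of l_infty^m. The number [3 / 2] has a square above [2],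
    as the count below uses, and is itself below [2], as the coordinate functionals require. *)
Definition norm_grows m := forall x : nat -> X,
  (forall i, (i < m)%N -> 0 <=l x i /\ 1 <= `|x i|) -> 3 / 2 < `|\sum_(i < m) x i|.

(** Group the [m ^ k.+1] vectors into [m] blocks of [m ^ k]; the normalised block sums satisfy the
    hypothesis again. *)
Lemma norm_grows_iter m k (x : nat -> X) c : norm_grows m -> 0 < c ->
  (forall i, (i < m ^ k)%N -> 0 <=l x i /\ c <= `|x i|) ->
  c * (3 / 2) ^+ k <= `|\sum_(i < m ^ k) x i|.
Proof.
move=> Hm c0; elim: k x => [|k IH] x Hx.
  rewrite expn0 big_ord1 expr0 mulr1; by case: (Hx 0%N).
have d0 : 0 < c * (3 / 2) ^+ k by rewrite mulr_gt0// exprn_gt0.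
pose y j := \sum_(i < m ^ k) x (i + j * m ^ k)%N.
have idx j i : (j < m)%N -> (i < m ^ k)%N -> (i + j * m ^ k < m ^ k.+1)%N.
  by move=> jm im; rewrite expnS; apply: leq_trans (_ : j.+1 * m ^ k <= _)%N;
    rewrite ?leq_mul2r ?jm ?orbT// mulSn ltn_add2r.
have yc j : (j < m)%N -> c * (3 / 2) ^+ k <= `|y j|.
  by move=> jm; apply: (IH (fun i => x (i + j * m ^ k)%N)) => i im; apply/Hx/idx.
have y0 j : (j < m)%N -> 0 <=l y j.
  by move=> jm; apply: vsum_ge0 => i _; case: (Hx _ (idx j i jm (ltn_ord i))).
have -> : \sum_(i < m ^ k.+1) x i = \sum_(j < m) y j.
  rewrite -(big_mkord xpredT x) expnS big_nat_mul big_mkord; apply: eq_bigr => j _.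
  by rewrite -{1}[(j * m ^ k)%N]add0n big_addn mulSn addnK big_mkord.
set d := c * _ ^+ k in d0 yc.
have := Hm (fun j => d^-1 *: y j).
rewrite -scaler_sumr normrZ gtr0_norm ?invr_gt0// => H.
have {H} : 3 / 2 < d^-1 * `|\sum_(j < m) y j|.
  apply: H => j jm; split; first by apply: vscale_ge0; [rewrite invr_ge0 ltW|exact: y0].
  by rewrite normrZ gtr0_norm ?invr_gt0// ler_pdivlMl// mulr1; exact: yc.
rewrite ltr_pdivlMl// exprS /d; set w := _ ^+ k; lra.
Qed.

(** A dyadic layer-cake bound for a power; the last term covers values of [u] below the smallest
    level. *)
Lemma expr_layer_le (u : R) q J : 0 <= u -> u <= 1 ->
  u ^+ q <= \sum_(j < J) 2 ^+ q * 2^-1 ^+ (j * q) * (if 2^-1 ^+ j <= u then 1 else 0)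
            + 2 ^+ q * 2^-1 ^+ (J * q).
Proof.
move=> u0 u1; elim: J => [|J IH].
  rewrite big_ord0 mul0n expr0 mulr1 add0r; apply: (@le_trans _ _ 1); first exact: exprn_ile1.
  by apply: exprn_ege1; lra.
rewrite big_ord_recr /=; case: (leP (2^-1 ^+ J) u) => h.
  rewrite mulr1; apply: le_trans IH _; rewrite lerDl.
  by apply: mulr_ge0; [exact: exprn_ge0|apply: exprn_ge0; rewrite invr_ge0].
rewrite mulr0 addr0; apply: (@le_trans _ _ (2 ^+ q * 2^-1 ^+ (J.+1 * q))).
  rewrite mulSn exprD mulrA -exprMn divff// expr1n mul1r exprM.
  by apply: lerXn2r; rewrite ?nnegrE ?exprn_ge0 ?invr_ge0// ltW.
rewrite lerDr; apply: sumr_ge0 => j _; case: ifP => _; rewrite ?mulr0// mulr1.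
Qed.

(** Otherwise more than [m^(2 j + 1)] of the vectors have norm at least [2^-j |t|], and that many of
    them have a sum of norm at least [2^-j (3 / 2)^(2 j + 1) |t|], which exceeds [|t|]. *)
Lemma norm_grows_count m n (f : nat -> X) t j : norm_grows m ->
  (forall i, (i < n)%N -> 0 <=l f i) -> \sum_(i < n) f i <=l t -> 0 < `|t| ->
  \sum_(i < n) (if 2^-1 ^+ j <= `|f i| / `|t| then 1 else 0) <= m%:R ^+ j.*2.+1 :> R.
Proof.
move=> Hm f0 ft tp.
pose s := [seq i <- iota 0 n | 2^-1 ^+ j <= `|f i| / `|t|].
have -> : \sum_(i < n) (if 2^-1 ^+ j <= `|f i| / `|t| then 1 else 0) = (size s)%:R :> R.
  rewrite -(big_mkord xpredT (fun i => if 2^-1 ^+ j <= `|f i| / `|t| then 1 else 0 : R)).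
  rewrite -big_mkcond /= /s size_filter /index_iota subn0 -sum1_count natr_sum.
  by [].
rewrite -natrX ler_nat leqNgt; apply/negP => lt_s.
set k := (m ^ j.*2.+1)%N in lt_s.
have sn i : i \in s -> (i < n)%N /\ 2^-1 ^+ j <= `|f i| / `|t|.
  by rewrite mem_filter mem_iota add0n => /and3P[].
have p2 : 0 < 2^-1 ^+ j :> R by rewrite exprn_gt0// invr_gt0.
have := @norm_grows_iter m j.*2.+1 (fun l => f (nth 0%N s l)) (2^-1 ^+ j * `|t|) Hm (mulr_gt0 p2 tp).
rewrite -/k => H.
have {H} H : 2^-1 ^+ j * `|t| * (3 / 2) ^+ j.*2.+1 <= `|\sum_(i < k) f (nth 0%N s i)|.
  apply: H => l lk; have ls : nth 0%N s l \in s by rewrite mem_nth// (ltn_trans lk).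
  by have [l1 l2] := sn _ ls; split; [exact: f0|rewrite -ler_pdivlMr].
have sub : \sum_(i < k) f (nth 0%N s i) <=l t.
  apply: vle_trans ft.
  rewrite -(big_mkord xpredT (fun i => f (nth 0%N s i))) -[X in _ <=l X](big_mkord xpredT f).
  have -> : \sum_(0 <= i < k) f (nth 0%N s i) = \sum_(i <- take k s) f i.
    rewrite [RHS](big_nth 0%N) size_takel ?(ltnW lt_s)//; apply: eq_big_nat => i /andP[_ ik].
    by rewrite nth_take.
  apply: (@vle_trans _ _ _ (\sum_(i <- s) f i)).
    rewrite -{2}(cat_take_drop k s) big_cat /= -{1}[\sum_(i <- take k s) f i]addr0.
    apply/vleD2l; rewrite big_seq; apply: vsum_ge0 => i /mem_drop /sn[? _]; exact: f0.
  rewrite big_filter /index_iota subn0 big_mkcond /= big_seq [X in _ <=l X]big_seq.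
  apply: vle_sum => i; rewrite mem_iota add0n => /andP[_ ni].
  by case: ifP => _; [exact: vle_refl|exact: f0].
have s0 : 0 <=l \sum_(i < k) f (nth 0%N s i).
  apply: vsum_ge0 => i _; apply: f0.
  have ls : nth 0%N s i \in s by rewrite mem_nth// (ltn_trans (ltn_ord i)).
  by have [] := sn _ ls.
have := le_trans H (vnorm_le0 s0 sub).
rewrite -[X in _ <= X]mul1r [_ * `|t| * _]mulrAC ler_pM2r// => H2.
have : 1 < 2^-1 ^+ j * (3 / 2) ^+ j.*2.+1 :> R.
  rewrite exprS -mul2n exprM mulrCA -exprMn.
  have : 1 <= (2^-1 * (3 / 2) ^+ 2) ^+ j :> R by apply: exprn_ege1; rewrite expr2; lra.
  lra.
by rewrite ltNge H2.
Qed.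

(** The exponent [2 m + 4] beats the count: since [m <= 2^m], the factor [m^(2 j)] is at most
    [2^(2 m j)], and [2^(-4 j)] remains for summation over [j]. *)
Lemma norm_grows_pos_concave m : norm_grows m -> exists q C, pos_concave L q.+4 C.
Proof.
move=> Hm; pose q := m.*2; exists q, (2 ^+ q.+4 * (m%:R * 2 + 1)).
split; first by apply: mulr_ge0; [exact: exprn_ge0|rewrite addr_ge0// mulr_ge0].
move=> n f t f0 ft.
have fit i : (i < n)%N -> f i <=l t.
  move=> ni; apply: vle_trans ft; rewrite (bigD1 (Ordinal ni)) //= -{1}[f i]addr0.
  by apply/vleD2l/vsum_ge0 => j _; exact: f0.
have [tz|tn] := eqVneq t 0.
  rewrite big1 => [|i _]; first by rewrite tz normr0 expr0n mulr0.
  have := vnorm_le0 (f0 i (ltn_ord i)) (fit i (ltn_ord i)).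
  by rewrite tz normr0 normr_le0 => /eqP ->; rewrite normr0 expr0n.
have tp : 0 < `|t| by rewrite normr_gt0.
have p0 k : 0 <= 2^-1 ^+ k :> R by apply: exprn_ge0; rewrite invr_ge0.
suff H : \sum_(i < n) (`|f i| / `|t|) ^+ q.+4 <= 2 ^+ q.+4 * (m%:R * 2 + 1).
  apply: (@le_trans _ _ (\sum_(i < n) (`|f i| / `|t|) ^+ q.+4 * `|t| ^+ q.+4)).
    by apply: ler_sum => i _; rewrite -exprMn divfK// gt_eqF.
  by rewrite -mulr_suml ler_wpM2r// exprn_ge0.
apply: (@le_trans _ _ (\sum_(i < n) (\sum_(j < n) 2 ^+ q.+4 * 2^-1 ^+ (j * q.+4) *
   (if 2^-1 ^+ j <= `|f i| / `|t| then 1 else 0) + 2 ^+ q.+4 * 2^-1 ^+ (n * q.+4)))).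
  apply: ler_sum => i _; apply: expr_layer_le; first by rewrite divr_ge0.
  by rewrite ler_pdivrMr// mul1r; apply: (vnorm_le0 (L := L)); [exact: f0|exact: fit].
rewrite big_split /= exchange_big /= mulrDr mulr1; apply: lerD.
  apply: (@le_trans _ _ (\sum_(j < n) 2 ^+ q.+4 * m%:R * 2^-1 ^+ j)).
    apply: ler_sum => j _; rewrite -mulr_sumr -[X in X <= _]mulrA -[X in _ <= X]mulrA.
    apply: ler_wpM2l; first exact: exprn_ge0.
    apply: le_trans (ler_wpM2l (p0 _) (norm_grows_count j Hm f0 ft tp)) _.
    rewrite exprS mulrCA; apply: ler_wpM2l => //.
    rewrite mulnC exprM -mul2n exprM -exprMn; apply: lerXn2r; rewrite ?nnegrE//.
    have h : m%:R <= 2 ^+ m :> R by rewrite -natrX ler_nat ltnW// ltn_expl.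
    have h2 : m%:R ^+ 2 <= 2 ^+ q :> R.
      by rewrite /q -muln2 exprM; apply: lerXn2r; rewrite ?nnegrE ?exprn_ge0.
    apply: le_trans (ler_wpM2l (p0 _) h2) _.
    rewrite -addn4 exprD mulrAC -exprMn mulVf// expr1n mul1r exprS.
    by apply: ler_piMr; rewrite ?invr_ge0//; apply: exprn_ile1; rewrite ?invr_ge0//; lra.
  rewrite -mulr_sumr.
  have h : 0 <= 2 ^+ q.+4 * m%:R :> R by apply: mulr_ge0; [exact: exprn_ge0|].
  have := ler_wpM2l h (geom_half_le R n); lra.
rewrite sumr_const card_ord -[X in X <= _]mulr_natl mulrCA; apply: ler_piMr; first exact: exprn_ge0.
have h1 : 2^-1 ^+ (n * q.+4) <= 2^-1 ^+ n :> R.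
  rewrite mulnS exprD; apply: ler_piMr => //; apply: exprn_ile1; rewrite ?invr_ge0//; lra.
have h2 : n%:R <= 2 ^+ n :> R by rewrite -natrX ler_nat ltnW// ltn_expl.
have h3 : n%:R * 2^-1 ^+ n <= 2 ^+ n * 2^-1 ^+ n :> R by rewrite ler_wpM2r.
rewrite -exprMn divff// expr1n in h3; apply: le_trans h3.
by rewrite ler_wpM2l.
Qed.

Lemma not_cotype_positive_linfty m : ~ finite_cotype X -> exists x : nat -> X,
  (forall i, (i < m)%N -> 0 <=l x i /\ 1 <= `|x i|) /\ `|\sum_(i < m) x i| <= 3 / 2.
Proof.
move=> nfc; apply: contrapT => H; apply: nfc.
have /norm_grows_pos_concave[q [C]] : norm_grows m; last exact: pos_concave_finite_cotype.
by move=> x Hx; rewrite ltNge; apply/negP => Hn; apply: H; exists x.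
Qed.

End Cotype.

(** * Biorthogonal functionals and square functions *)

Section HahnBanach.
Variables (R : realType) (V : lmodType R).

Definition sublinear (p : V -> R) :=
  (forall x y, p (x + y) <= p x + p y) /\ (forall a x, 0 < a -> p (a *: x) <= a * p x).

Lemma sublinearZ p a x : sublinear p -> 0 < a -> p (a *: x) = a * p x.
Proof.
move=> [_ ph] a0; apply/le_anti/andP; split; first exact: ph.
have := ph a^-1 (a *: x); rewrite invr_gt0 scalerA mulVf ?gt_eqF// scale1r => /(_ a0).
by rewrite ler_pdivlMl.
Qed.

Lemma sublinear0 p : sublinear p -> p 0 = 0.
Proof.
move=> ps; have := sublinearZ 0 ps (_ : 0 < 2); rewrite scaler0 => /(_ (ltr0n R 2)); lra.
Qed.

Lemma sublinear_ge p x : sublinear p -> - p (- x) <= p x.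
Proof.
move=> ps; have [pa _] := ps; have := pa x (- x).
by rewrite subrr (sublinear0 ps); lra.
Qed.

Lemma inf_family (I : Type) (P : I -> Prop) (F : I -> R) m :
  (exists i, P i) -> (forall i, P i -> m <= F i) ->
  exists r, [/\ forall i, P i -> r <= F i & forall b, (forall i, P i -> b <= F i) -> b <= r].
Proof.
move=> [i0 Pi0] Hm; exists (inf [set F i | i in [set i | P i]]).
have lb : has_lbound [set F i | i in [set i | P i]].
  by exists m => _ [i Pi <-]; exact: Hm.
split=> [i Pi|b Hb]; first by apply: ge_inf => //; exists i.
by apply: lb_le_inf => [|_ [i Pi <-]]; [exists (F i0), i0|exact: Hb].
Qed.

(** Zorn's lemma for the reversed pointwise order gives a minimal sublinear functional below [q],
    and minimal ones are linear. A nonempty chain is bounded by its pointwise infimum, the empty one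
    by [q]. *)
Lemma sublinear_dominates_linear (q : V -> R) : sublinear q ->
  exists phi : V -> R, (forall a x y, phi (a *: x + y) = a * phi x + phi y) /\
    forall x, phi x <= q x.
Proof.
move=> qs.
pose T := {p : V -> R | sublinear p /\ forall x, p x <= q x}.
pose rel_T (s t : T) := `[< forall x, sval t x <= sval s x >].
have := @Zorn T rel_T.
case.
- by move=> t; apply/asboolP.
- move=> r s t /asboolP rs /asboolP st; apply/asboolP => x; exact: le_trans (st x) (rs x).
- move=> [s ps] [t pt] /asboolP /= st /asboolP /= ts.
  have E : s = t by apply/funext => x; apply/le_anti; rewrite ts st.
  by subst t; congr exist; exact: Prop_irrelevance.
- move=> A Atot.
  have [[p0 Ap0]|An] := pselect (exists p, A p); last first.
    by exists (exist _ q (conj qs (fun x => lexx _))) => s As; exfalso; apply: An; exists s.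
  have ex x := @inf_family T A (fun p => sval p x) (- q (- x)) (ex_intro _ p0 Ap0).
  have lbq x (p : T) : A p -> - q (- x) <= sval p x.
    move=> _; case: p => p [ps pq] /=; apply: le_trans (sublinear_ge x ps).
    by rewrite lerN2.
  have {ex} ex x := ex x (lbq x).
  have [r Hr] := @choice V R _ ex.
  have rs : sublinear r.
    split=> [x y|a x a0].
      have [_ rx] := Hr x; have [_ ry] := Hr y; have [rxy _] := Hr (x + y).
      rewrite -lerBlDr; apply: rx => p1 Ap1; rewrite lerBlDr -lerBlDl; apply: ry => p2 Ap2.
      rewrite lerBlDl.
      have [/asboolP p12|/asboolP p21] := Atot p1 p2 Ap1 Ap2.
        apply: le_trans (rxy _ Ap2) _; have [[pa _] _] := svalP p2.
        by apply: le_trans (pa x y) _; rewrite lerD2r.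
      apply: le_trans (rxy _ Ap1) _; have [[pa _] _] := svalP p1.
      by apply: le_trans (pa x y) _; rewrite lerD2l.
    have [_ rx] := Hr x; have [rax _] := Hr (a *: x).
    rewrite -ler_pdivrMl//; apply: rx => p Ap; rewrite ler_pdivrMl//.
    apply: le_trans (rax _ Ap) _; have [[_ ph] _] := svalP p; exact: ph.
  have rq x : r x <= q x.
    have [rx _] := Hr x; apply: le_trans (rx _ Ap0) _; by have [_] := svalP p0.
  exists (exist _ r (conj rs rq)) => p Ap; apply/asboolP => x /=.
  by have [rx _] := Hr x; exact: rx.
move=> [p [ps pq]] pmin.
have [pa ph] := ps.
(* The infimum over [s >= 0] of [p (z + s x0) - s p x0] is sublinear and at most [p], hence equal to
   [p] by minimality; at [z = - x0] and [s = 1] it gives the claim. *)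
have pN (x0 : V) : p (- x0) <= - p x0.
  have ex z := @inf_family R (fun s => 0 <= s) (fun s => p (z + s *: x0) - s * p x0) (- p (- z))
     (ex_intro _ 0 (lexx 0)).
  have lbz z s : 0 <= s -> - p (- z) <= p (z + s *: x0) - s * p x0.
    move=> s0; have : p (s *: x0) <= p (z + s *: x0) + p (- z).
      by have := pa (z + s *: x0) (- z); rewrite addrAC subrr add0r.
    have [->|sn] := eqVneq s 0; first by rewrite scale0r mul0r (sublinear0 ps) addr0; lra.
    rewrite (sublinearZ _ ps); last by rewrite lt_neqAle eq_sym sn.
    lra.
  have {ex} ex z := ex z (lbz z).
  have [p' Hp'] := @choice V R _ ex.
  have p's : sublinear p'.
    split=> [x y|a x a0].
      have [_ rx] := Hp' x; have [_ ry] := Hp' y; have [rxy _] := Hp' (x + y).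
      rewrite -lerBlDr; apply: rx => s s0; rewrite lerBlDr -lerBlDl; apply: ry => s' s'0.
      rewrite lerBlDl; apply: le_trans (rxy (s + s') (addr_ge0 s0 s'0)) _.
      rewrite scalerDl addrACA; have := pa (x + s *: x0) (y + s' *: x0); lra.
    have [_ rx] := Hp' x; have [rax _] := Hp' (a *: x).
    rewrite -ler_pdivrMl//; apply: rx => s s0; rewrite ler_pdivrMl//.
    apply: le_trans (rax (a * s) (mulr_ge0 (ltW a0) s0)) _.
    rewrite -scalerA -scalerDr; have := ph a (x + s *: x0) a0; lra.
  have p'p x : p' x <= p x.
    by have [rx _] := Hp' x; have := rx 0 (lexx 0); rewrite scale0r addr0 mul0r subr0.
  have p'q x : p' x <= q x by exact: le_trans (p'p x) (pq x).
  have := pmin (exist _ p' (conj p's p'q)); rewrite /rel_T /= => H.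
  have {H} /(congr1 sval) /= E := H (asboolT p'p).
  have [rx _] := Hp' (- x0); have := rx 1 ler01; rewrite E scale1r addNr (sublinear0 ps); lra.
have pNE (x : V) : p (- x) = - p x.
  by apply/le_anti/andP; split; [exact: pN|have := sublinear_ge (- x) ps; rewrite opprK].
have pD (x y : V) : p (x + y) = p x + p y.
  apply/le_anti/andP; split; first exact: pa.
  have := pa (x + y) (- y); rewrite addrK pNE; lra.
exists p; split=> [a x y|]; last exact: pq.
rewrite pD; congr (_ + _).
case: (ltrgt0P a) => [a0|a0|->]; first exact: sublinearZ.
  have -> : a *: x = - (- a *: x) by rewrite scaleNr opprK.
  by rewrite pNE (sublinearZ _ ps) ?oppr_gt0// mulNr opprK.
by rewrite scale0r mul0r (sublinear0 ps).
Qed.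

End HahnBanach.

Lemma sum_cauchy_schwarz (R : realFieldType) (I : finType) (u v : I -> R) :
  (\sum_i u i * v i) ^+ 2 <= (\sum_i u i ^+ 2) * (\sum_i v i ^+ 2).
Proof.
set S := \sum_i v i ^+ 2; set z := \sum_i u i * v i.
have S0 : 0 <= S by apply: sumr_ge0 => i _; exact: sqr_ge0.
have [Sz|Sn] := eqVneq S 0.
  rewrite /z big1 ?expr0n//= ?Sz ?mulr0// => i _.
  have /eqP : S == 0 by rewrite Sz.
  move/eqP; rewrite psumr_eq0; last by move=> j _; exact: sqr_ge0.
  by move=> /allP /(_ i (mem_index_enum _)) /=; rewrite sqrf_eq0 => /eqP ->; rewrite mulr0.
have Sp : 0 < S by rewrite lt_neqAle eq_sym Sn.
have : 0 <= \sum_i (S * u i - z * v i) ^+ 2 by apply: sumr_ge0 => i _; exact: sqr_ge0.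
have -> : \sum_i (S * u i - z * v i) ^+ 2 = S ^+ 2 * (\sum_i u i ^+ 2) - S * z ^+ 2.
  rewrite (eq_bigr (fun i => S ^+ 2 * u i ^+ 2 - 2 * S * z * (u i * v i) + z ^+ 2 * v i ^+ 2)); last first.
    by move=> i _; ring.
  rewrite big_split /= sumrB -!mulr_sumr -/z -/S; ring.
by rewrite subr_ge0 [S ^+ 2]expr2 -mulrA ler_pM2l// => /le_trans; apply; rewrite mulrC.
Qed.

Section Sqfun.
Variables (R : realType) (X : completeNormedModType R) (L : banach_lattice X).
Local Notation "x <=l y" := (bl_le L x y) (at level 70, no associativity).
Local Notation vabs := (vabs L).

Definition grid_point N M (phi : {ffun 'I_N -> 'I_(M.*2.+1)}) (i : 'I_N) : R :=
  ((phi i)%:R - M%:R) / M%:R.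

(** Rounding is towards zero: the coefficients shrink in modulus, so a grid point stays in the
    Euclidean unit ball. *)
Lemma grid_approx N M (a : 'I_N -> R) : (0 < M)%N -> (forall i, `|a i| <= 1) ->
  exists phi : {ffun 'I_N -> 'I_(M.*2.+1)}, forall i,
    `|grid_point phi i| <= `|a i| /\ `|a i - grid_point phi i| <= M%:R^-1.
Proof.
move=> M0 a1; have m0 : 0 < M%:R :> R by rewrite ltr0n.
pose k i := Num.truncn (M%:R * `|a i|).
have Ma0 i : 0 <= M%:R * `|a i| by rewrite mulr_ge0.
have kM i : (k i <= M)%N.
  rewrite -(ler_nat R); have /andP[h _] := truncn_itv (Ma0 i).
  by apply: le_trans h _; rewrite ler_piMr.
pose j i := if 0 <= a i then (M + k i)%N else (M - k i)%N.
have jM i : (j i < M.*2.+1)%N.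
  rewrite /j ltnS -addnn; case: ifP => _; first by rewrite leq_add2l.
  by apply: leq_trans (leq_subr _ _) _; exact: leq_addr.
exists [ffun i => Ordinal (jM i)] => i; rewrite /grid_point ffunE /=.
have /andP[h1 h2] := truncn_itv (Ma0 i); rewrite -/(k i) in h1 h2.
have E : (j i)%:R - M%:R = (if 0 <= a i then 1 else -1) * (k i)%:R :> R.
  by rewrite /j; case: ifP => _; rewrite ?natrD ?natrB//; lra.
have D1 : (k i)%:R / M%:R <= `|a i| by rewrite ler_pdivrMr// mulrC.
have D2 : `|a i| - (k i)%:R / M%:R <= M%:R^-1.
  rewrite -[X in _ <= X]mul1r ler_pdivlMr// mulrBl divfK ?gt_eqF//.
  move: h2; rewrite -natr1; lra.
have D0 : 0 <= (k i)%:R / M%:R :> R by rewrite divr_ge0.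
rewrite E -mulrA; case: (leP 0 (a i)) => ai.
  rewrite mul1r ger0_norm//; rewrite (ger0_norm ai) in D1 D2 *; split=> //.
  by rewrite ger0_norm// subr_ge0.
rewrite mulN1r normrN opprK; rewrite (ltr0_norm ai) in D1 D2 *; split; first by rewrite ger0_norm.
by rewrite ler0_norm; lra.
Qed.

(** Starting from [0] is harmless, since zero coefficients make every upper bound considered
    nonnegative. *)
Definition vsup (s : seq X) : X := foldr (bl_join L) 0 s.

Lemma vsup_le (s : seq X) u : 0 <=l u -> (forall x, x \in s -> x <=l u) -> vsup s <=l u.
Proof.
move=> u0; elim: s => [//|y s IH] H; apply/vjoinP; split; first by apply: H; rewrite mem_head.
by apply: IH => x xs; apply: H; rewrite in_cons xs orbT.
Qed.

Lemma vsup_ge (s : seq X) x : x \in s -> x <=l vsup s.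
Proof.
elim: s => [//|y s IH]; rewrite in_cons => /orP[/eqP ->|/IH h]; first exact: bl_join_l.
exact: vle_trans h (bl_join_r _ _ _).
Qed.

Lemma sum_sqr_le1 N (a : 'I_N -> R) : \sum_(i < N) a i ^+ 2 <= 1 -> forall i, `|a i| <= 1.
Proof.
move=> a1 i; rewrite -(@expr_le1 _ 2)// real_normK ?num_real//; apply: le_trans a1.
by rewrite (bigD1 i)//= lerDl sumr_ge0// => j _; exact: sqr_ge0.
Qed.

(** Finite joins over ever finer grids of coefficients converge in norm, and the closed cone makes
    the limit a supremum. Existence matters: [l2_bounded_by] speaks only of square functions that
    exist, so a lower bound for it needs one. *)
Lemma sqfun_exists N (x : 'I_N -> X) : exists s, is_sqfun L x s.
Proof.
pose comb (a : 'I_N -> R) := \sum_(i < N) a i *: x i.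
pose w := \sum_(i < N) vabs (x i).
have w0 : 0 <=l w by apply: vsum_ge0 => i _; exact: vabs_ge0.
pose v k := vsup [seq comb (grid_point phi) | phi <- enum {ffun 'I_N -> 'I_(k.+1.*2.+1)}
  & \sum_(i < N) grid_point phi i ^+ 2 <= 1].
have v_le k u : (forall a : 'I_N -> R, \sum_(i < N) a i ^+ 2 <= 1 -> comb a <=l u) -> v k <=l u.
  move=> H; apply: vsup_le.
    have := H (fun=> 0); rewrite /comb big1 => [|i _]; last by rewrite expr0n.
    by rewrite big1 => [|i _]; [apply; exact: ler01|rewrite scale0r].
  by move=> y /mapP[phi]; rewrite mem_filter => /andP[h _] ->; exact: H.
have v_ge k (a : 'I_N -> R) : \sum_(i < N) a i ^+ 2 <= 1 -> comb a <=l v k + k.+1%:R^-1 *: w.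
  move=> a1; have [phi Hphi] := grid_approx (ltn0Sn k) (sum_sqr_le1 a1).
  have -> : comb a = comb (grid_point phi) + \sum_(i < N) (a i - grid_point phi i) *: x i.
    by rewrite /comb -big_split; apply: eq_bigr => i _ /=; rewrite -scalerDl addrC subrK.
  apply: vleD.
    apply: vsup_ge; apply/mapP; exists phi => //; rewrite mem_filter mem_enum andbT.
    apply: le_trans a1; apply: ler_sum => i _; have [h _] := Hphi i.
    by rewrite -(real_normK (num_real (a i))) -(real_normK (num_real (grid_point phi i))) lerXn2r.
  rewrite scaler_sumr; apply: vle_sum => i _; apply: vle_trans (vscale_le_abs L _ _) _.
  by apply: vscalel_le; [have [] := Hphi i|exact: vabs_ge0].
(* The grids are not nested, but any two of these joins compare up to the mesh; this makes the
   sequence Cauchy. *)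
have vv k l : v l <=l v k + k.+1%:R^-1 *: w by apply: v_le; exact: v_ge.
have inv0 k : 0 <= k.+1%:R^-1 :> R by rewrite invr_ge0.
have vdist k l : `|v k - v l| <= (k.+1%:R^-1 + l.+1%:R^-1) * `|w|.
  rewrite -[X in X * _]ger0_norm ?addr_ge0// -normrZ.
  have key k' l' : v k' - v l' <=l (k'.+1%:R^-1 + l'.+1%:R^-1) *: w.
    apply/vle_subl_addr; apply: vle_trans (vv l' k') _; rewrite addrC; apply/vleD2r.
    by apply: vscalel_le => //; rewrite lerDr.
  by apply: (vnorm_le (L := L)); rewrite ?opprB; [exact: key|rewrite (addrC k.+1%:R^-1); exact: key].
have small e : 0 < e -> exists k0, forall k, (k0 <= k)%N -> k.+1%:R^-1 * `|w| <= e.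
  move=> e0; exists (Num.truncn (`|w| / e)) => k kk.
  rewrite ler_pdivrMl// -ler_pdivrMr//; apply: le_trans (ltW (truncnS_gt _)) _.
  by rewrite ler_nat ltnS.
have cv : cvg (v @ \oo).
  apply: cauchy_cvg; apply: cauchy_exP => e e0.
  have [k0 Hk0] := small (e / 4) (divr_gt0 e0 (ltr0n R 4)).
  exists (v k0); exists k0 => // k /= kk; rewrite -ball_normE /=.
  apply: le_lt_trans (vdist k0 k) _; rewrite mulrDl.
  apply: le_lt_trans (lerD (Hk0 k0 (leqnn _)) (Hk0 k kk)) _; lra.
have [s vs] : exists s : X, v @ \oo --> s by exists (lim (v @ \oo)).
have near e : 0 < e -> exists k, `|v k - s| <= e /\ k.+1%:R^-1 * `|w| <= e.
  move=> e0; have [k0 Hk0] := small e e0.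
  have /cvgrPdist_lt /(_ e e0) [k1 _ Hk1] := vs.
  exists (maxn k0 k1); split; last by apply: Hk0; exact: leq_maxl.
  by rewrite distrC ltW//; apply: Hk1 => /=; exact: leq_maxr.
exists s; split=> [a a1|u Hu].
  apply: vle_closed => e e0; have [k [k1 k2]] := near (e / 2) (divr_gt0 e0 (ltr0n R 2)).
  exists (v k + k.+1%:R^-1 *: w); first exact: v_ge.
  rewrite addrAC; apply: le_trans (ler_normD _ _) _; rewrite normrZ ger0_norm//; apply: le_trans (lerD k1 k2) _; lra.
apply: vge_closed => e e0; have [k [k1 k2]] := near e e0.
by exists (v k) => //; apply: v_le.
Qed.

(** The upper bound is Cauchy-Schwarz; [a = c / |c|_2] and its negative attain [y] and [- y], whose
    join is the modulus. *)
Lemma is_sqfun_line N (c : 'I_N -> R) (y : X) :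
  is_sqfun L (fun i => c i *: y) (Num.sqrt (\sum_(i < N) c i ^+ 2) *: vabs y).
Proof.
set S := \sum_(i < N) c i ^+ 2; have S0 : 0 <= S by apply: sumr_ge0 => i _; exact: sqr_ge0.
have sumE (a : 'I_N -> R) : \sum_(i < N) a i *: (c i *: y) = (\sum_(i < N) a i * c i) *: y.
  by rewrite scaler_suml; apply: eq_bigr => i _; rewrite scalerA.
split=> [a a1|u Hu].
  rewrite sumE; apply: vle_trans (vscale_le_abs L _ _) _.
  apply: vscalel_le; last exact: vabs_ge0.
  rewrite -ler_sqr ?nnegrE ?sqrtr_ge0// sqr_sqrtr// real_normK ?num_real//.
  by apply: le_trans (sum_cauchy_schwarz a c) _; rewrite -/S ler_piMl.
have u0 : 0 <=l u.
  have := Hu (fun=> 0); rewrite big1 => [|i _]; last by rewrite expr0n.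
  by rewrite big1 => [|i _]; [apply; exact: ler01|rewrite scale0r].
have [Sz|Sn] := eqVneq S 0; first by rewrite Sz sqrtr0 scale0r.
have Sp : 0 < S by rewrite lt_neqAle eq_sym Sn.
have sp : 0 < Num.sqrt S by rewrite sqrtr_gt0.
have key (e : R) : e ^+ 2 = 1 -> (e * Num.sqrt S) *: y <=l u.
  move=> e1; have := Hu (fun i => e * c i / Num.sqrt S); rewrite sumE.
  under eq_bigr do rewrite exprMn exprMn e1 mul1r exprVn sqr_sqrtr//.
  rewrite -mulr_suml divff ?gt_eqF// => /(_ (lexx _)).
  have -> // : \sum_(i < N) e * c i / Num.sqrt S * c i = e * Num.sqrt S.
  transitivity (e / Num.sqrt S * S).
    by rewrite /S mulr_sumr; apply: eq_bigr => i _; ring.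
  by rewrite -{2}(sqr_sqrtr S0) expr2 mulrA divfK// gt_eqF.
have -> : u = Num.sqrt S *: ((Num.sqrt S)^-1 *: u) by rewrite scalerA divff ?scale1r// gt_eqF.
apply: vscaler_le; first exact: ltW.
have k1 := vscaler_le (_ : 0 <= (Num.sqrt S)^-1) (key 1 (expr1n _ _)).
have k2 := vscaler_le (_ : 0 <= (Num.sqrt S)^-1) (key (-1) _).
apply/vabsP; split.
  by move: k1; rewrite mul1r scalerA mulVf ?gt_eqF// scale1r; apply; rewrite invr_ge0 ltW.
move: k2; rewrite mulN1r scaleNr scalerN scalerA mulVf ?gt_eqF// scale1r; apply.
  by rewrite invr_ge0 ltW.
by rewrite sqrrN expr1n.
Qed.

(* Coordinate functionals: [x 0, ..., x (m-1)] spans a copy of l_infty^m. *)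
Lemma positive_linfty_coord m (x : nat -> X) (a : nat -> R) i :
  (forall i, (i < m)%N -> 0 <=l x i /\ 1 <= `|x i|) -> `|\sum_(i < m) x i| <= 3 / 2 ->
  (i < m)%N -> `|a i| <= 2 * `|\sum_(j < m) a j *: x j|.
Proof.
move=> Hx sx im.
have [j0 jmax] : exists j0 : 'I_m, forall j : 'I_m, `|a j| <= `|a j0|.
  have := @arg_maxP _ _ 'I_m (Ordinal im) xpredT (fun j => `|a j|) isT.
  by case=> j0 _ H; exists j0 => j; exact: H.
apply: le_trans (jmax (Ordinal im)) _ => /=.
have [A0|An] := eqVneq (a j0) 0; first by rewrite A0 normr0 mulr_ge0.
have A0 : 0 < `|a j0| by rewrite normr_gt0.
pose b (j : 'I_m) := a j / a j0.
have b1 j : `|b j| <= 1 by rewrite normrM normfV ler_pdivrMr// mul1r.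
have -> : \sum_(j < m) a j *: x j = a j0 *: \sum_(j < m) b j *: x j.
  by rewrite scaler_sumr; apply: eq_bigr => j _; rewrite scalerA mulrC divfK.
rewrite normrZ mulrCA ler_peMr//.
rewrite (bigD1 j0) //= /b divff// scale1r.
set v := \sum_(j < m | j != j0) _.
have vabs_le (c : 'I_m -> R) : (forall j, `|c j| <= 1) ->
    \sum_(j < m | j != j0) c j *: x j <=l \sum_(j < m | j != j0) x j.
  move=> c1; apply: vle_sum => j _; apply: vle_trans (vscale_le_abs L _ _) _.
  have [xj _] := Hx j (ltn_ord j).
  by rewrite (vabs_id xj) -[X in _ <=l X]scale1r; exact: vscalel_le.
have [x0 x1] := Hx j0 (ltn_ord j0).
have h1 : `|x j0 - v| <= 3 / 2.
  apply: le_trans sx; rewrite [X in _ <= `|X|](bigD1 j0)//=.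
  apply: (vnorm_le (L := L)).
    apply/vleD2l; have -> : - v = \sum_(j < m | j != j0) - b j *: x j.
      by rewrite -sumrN; apply: eq_bigr => j _; rewrite scaleNr.
    by apply: vabs_le => j; rewrite normrN; exact: b1.
  rewrite opprD opprK; apply: vleD; first exact: vge0N.
  exact: vabs_le.
(* As [|x j0| >= 1] and [|x j0 - v| <= 3 / 2], there remains [|x j0 + v| >= 1 / 2], hence the factor
   [2] of the statement. *)
have h2 : 2 * `|x j0| <= `|x j0 + v| + `|x j0 - v|.
  have -> : 2 * `|x j0| = `|(x j0 + v) + (x j0 - v)|.
    by rewrite addrACA subrr addr0 -mulr2n normrMn mulr_natl.
  exact: ler_normD.
lra.
Qed.

Lemma biorthogonal_functionals m (x : nat -> X) :
  (forall i, (i < m)%N -> 0 <=l x i /\ 1 <= `|x i|) -> `|\sum_(i < m) x i| <= 3 / 2 ->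
  exists phi : 'I_m -> X -> R, forall i,
    [/\ forall a y z, phi i (a *: y + z) = a * phi i y + phi i z,
        forall z, `|phi i z| <= 2 * `|z| &
        forall j : 'I_m, phi i (x j) = (i == j)%:R].
Proof.
move=> Hx sx.
suff H (i : 'I_m) : exists f : X -> R,
    [/\ forall a y z, f (a *: y + z) = a * f y + f z, forall z, `|f z| <= 2 * `|z| &
        forall j : 'I_m, f (x j) = (i == j)%:R].
  by have [phi Hphi] := choice H; exists phi.
pose comb (a : 'I_m -> R) := \sum_(j < m) a j *: x j.
have coord (a : 'I_m -> R) : a i <= 2 * `|comb a|.
  pose a' n := if @insub nat (fun k => k < m)%N 'I_m n is Some i then a i else 0.
  have a'E (j : 'I_m) : a' j = a j by rewrite /a' valK.
  have := positive_linfty_coord a' Hx sx (ltn_ord i).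
  rewrite a'E; under eq_bigr do rewrite a'E.
  by move=> h; apply: le_trans (ler_norm _) h.
have combD a b : comb (fun j => a j + b j) = comb a + comb b.
  by rewrite /comb -big_split; apply: eq_bigr => j _ /=; rewrite scalerDl.
have combZ c a : comb (fun j => c * a j) = c *: comb a.
  by rewrite /comb scaler_sumr; apply: eq_bigr => j _; rewrite scalerA.
(* The infimum is the sublinear majorant that encodes both demands: it is at most [2 |z|], and at
   [e *: x j] at most [e] or [0]. A linear functional below it has the norm bound and, with both
   signs of [e], the prescribed values. *)
have ex z := @inf_family R ('I_m -> R) (fun=> True) (fun a => 2 * `|z + comb a| - a i) (- (2 * `|z|))
  (ex_intro _ (fun=> 0) Logic.I).
have lb z (a : 'I_m -> R) : True -> - (2 * `|z|) <= 2 * `|z + comb a| - a i.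
  move=> _; have := coord a.
  have : `|comb a| <= `|z + comb a| + `|z|.
    have {1}-> : comb a = (z + comb a) - z by rewrite addrAC subrr add0r.
    exact: ler_normB.
  lra.
have {ex} ex z := ex z (lb z).
have [q Hq] := @choice X R _ ex.
have qs : sublinear q.
  split=> [y z|c y c0].
    have [_ ry] := Hq y; have [_ rz] := Hq z; have [ryz _] := Hq (y + z).
    rewrite -lerBlDr; apply: ry => a _; rewrite lerBlDr -lerBlDl; apply: rz => b _.
    rewrite lerBlDl; apply: le_trans (ryz (fun j => a j + b j) _) _ => //.
    rewrite combD addrACA; have := ler_normD (y + comb a) (z + comb b); lra.
  have [_ ry] := Hq y; have [rcy _] := Hq (c *: y).
  rewrite -ler_pdivrMl//; apply: ry => a _; rewrite ler_pdivrMl//.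
  apply: le_trans (rcy (fun j => c * a j) _) _ => //.
  rewrite combZ -scalerDr normrZ gtr0_norm//; lra.
have [phi [philin phiq]] := sublinear_dominates_linear qs.
have phi0 : phi 0 = 0.
  by have := philin 1 0 0; rewrite scale1r addr0 mul1r; lra.
have phiN z : phi (- z) = - phi z.
  by have := philin (-1) z 0; rewrite scaleN1r !addr0 mulN1r phi0 addr0.
exists phi; split=> // [z|j].
  have le z' : phi z' <= 2 * `|z'|.
    apply: le_trans (phiq z') _; have [rz _] := Hq z'; have := rz (fun=> 0) Logic.I.
    by rewrite /comb big1 => [|k _]; rewrite ?scale0r// addr0 subr0.
  rewrite ler_norml le andbT; have := le (- z); rewrite phiN normrN; lra.
have val (e : R) : q (e *: x j) <= e * (i == j)%:R.
  have [rz _] := Hq (e *: x j); have := rz (fun k => - e * (k == j)%:R) Logic.I.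
  have -> : comb (fun k => - e * (k == j)%:R) = - (e *: x j).
    rewrite /comb (bigD1 j) //= eqxx mulr1 big1 ?addr0 ?scaleNr// => k /negbTE ->.
    by rewrite mulr0 scale0r.
  by rewrite subrr normr0 mulr0 sub0r mulNr opprK.
have h1 := le_trans (phiq _) (val 1); have h2 := le_trans (phiq _) (val (-1)).
move: h1 h2; rewrite scale1r scaleN1r phiN mul1r mulN1r => h1 h2; lra.
Qed.

End Sqfun.

(** * Riesz products *)

Section RieszKernel.
Variables (R : realType) (K : finType).
Hypothesis K0 : (0 < #|K|)%N.

Definition avg (F : K -> R) : R := #|K|%:R^-1 * \sum_i F i.

Lemma card_inv_ge0 : 0 <= #|K|%:R^-1 :> R. Proof. by rewrite invr_ge0. Qed.
Hint Resolve card_inv_ge0 : core.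

Lemma avg_le F G : (forall i, F i <= G i) -> avg F <= avg G.
Proof. by move=> FG; rewrite ler_wpM2l//; apply: ler_sum. Qed.

Lemma avgD F G : avg (fun i => F i + G i) = avg F + avg G.
Proof. by rewrite /avg big_split mulrDr. Qed.

Lemma avgZ c F : avg (fun i => c * F i) = c * avg F.
Proof. by rewrite /avg -mulr_sumr mulrCA. Qed.

Lemma avg_const c : avg (fun=> c) = c.
Proof.
rewrite /avg; have -> : \sum_(i : K) c = #|K|%:R * c by rewrite sumr_const mulr_natl.
by rewrite mulrA mulVf ?mul1r// pnatr_eq0 -lt0n.
Qed.

Lemma avg_sum (I : Type) (r : seq I) (F : I -> K -> R) :
  avg (fun i => \sum_(n <- r) F n i) = \sum_(n <- r) avg (F n).
Proof. by rewrite /avg exchange_big /= mulr_sumr. Qed.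

Lemma avgM F G : avg F * avg G = avg (fun i => avg (fun j => F i * G j)).
Proof.
rewrite mulrC -avgZ; congr avg; apply/funext => i.
by rewrite mulrC -avgZ.
Qed.

Lemma signs_mean_prod N (F : 'I_N -> bool -> R) :
  (2 ^+ N)^-1 * \sum_(e : {ffun 'I_N -> bool}) \prod_(n < N) F n (e n) =
  \prod_(n < N) ((F n true + F n false) / 2).
Proof.
rewrite -bigA_distr_bigA big_split /= prodr_const card_ord exprVn mulrC; congr (_ * _).
by apply: eq_bigr => n _; rewrite big_bool.
Qed.

Variables (N : nat) (h : 'I_N -> K -> R) (a : 'I_N -> R) (l b B : R).
Hypotheses (B0 : 0 <= B) (h0 : forall n i, 0 <= h n i) (a1 : \sum_(n < N) a n ^+ 2 <= 1) (l0 : 0 < l).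
Hypothesis h2 : forall n, avg (fun i => h n i ^+ 2) <= l.
Hypothesis h1 : forall n, avg (h n) ^+ 2 * expR l <= B.
(** A weak L^2 condition in integrated form: if [h n] exceeds [s] on a fraction at most [s^-2] of
    [K], the layer-cake formula gives exactly this bound with the factor [2]. *)
Hypothesis h_weak : forall n c, 0 <= c ->
  avg (fun i => if 1 < c * h n i then c * h n i else 0) <= 2 * c ^+ 2.

Let w n i := a n * h n i.
Let k i j := \sum_(n < N) w n i * w n j.
Let big n i := if 1 < `|w n i| then `|w n i| else 0.
(** The height of the kernel at [i]. It must dominate every [|w n i|] (nonnegative factors) and
    satisfy [k i i <= l W^2] (controlled correlations), while keeping a bounded average. The large
    values of [w] are therefore added separately. *)
Let W i := 1 + Num.sqrt (k i i / l) + \sum_(n < N) big n i.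

Let big_ge0 n i : 0 <= big n i. Proof. by rewrite /big; case: ifP. Qed.

Let kii_ge0 i : 0 <= k i i.
Proof. by apply: sumr_ge0 => n _; rewrite -expr2 sqr_ge0. Qed.

Let W1 i : 1 <= W i.
Proof. by rewrite /W -addrA lerDl addr_ge0 ?sqrtr_ge0// sumr_ge0. Qed.
Let Wgt0 i : 0 < W i. Proof. exact: lt_le_trans ltr01 (W1 i). Qed.

Let wW n i : `|w n i| <= W i.
Proof.
case: (leP `|w n i| 1) => [wle|wgt]; first exact: le_trans wle (W1 i).
rewrite /W (bigD1 n) //= {1}/big wgt.
have : 0 <= \sum_(j < N | j != n) big j i by apply: sumr_ge0 => j _; exact: big_ge0.
have := sqrtr_ge0 (k i i / l); lra.
Qed.

Let kW i : k i i <= l * W i ^+ 2.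
Proof.
have y0 : 0 <= k i i / l := divr_ge0 (kii_ge0 i) (ltW l0).
rewrite -ler_pdivrMl// mulrC -[X in X <= _](sqr_sqrtr y0).
apply: lerXn2r; rewrite ?nnegrE ?sqrtr_ge0//; first exact/ltW.
have : 0 <= \sum_(j < N) big j i by apply: sumr_ge0.
by rewrite /W; lra.
Qed.

(** The three summands contribute [1], [1] and [2]: the root by [sqrt y <= (1 + y) / 2] and the mean
    square bound, the large values by the weak bound. *)
Let avgW : avg W <= 4.
Proof.
rewrite /W avgD avgD avg_const avg_sum.
have H1 : avg (fun i => Num.sqrt (k i i / l)) <= 1.
  apply: (@le_trans _ _ (avg (fun i => 2^-1 + 2^-1 * (l^-1 * k i i)))).
    apply: avg_le => i; have := sqr_ge0 (Num.sqrt (k i i / l) - 1).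
    have y0 : 0 <= k i i / l by rewrite divr_ge0// ltW.
    rewrite sqrrB1 sqr_sqrtr// [l^-1 * _]mulrC; lra.
  rewrite avgD avg_const avgZ avgZ.
  have : avg (fun i => k i i) <= l.
    rewrite /k avg_sum; apply: (@le_trans _ _ (\sum_(n < N) a n ^+ 2 * l)).
      apply: ler_sum => n _; under [X in avg X]funext => i do rewrite -expr2 /w exprMn.
      by rewrite avgZ ler_wpM2l ?sqr_ge0.
    by rewrite -mulr_suml ler_piMl// ltW.
  move=> kl; have : l^-1 * avg (fun i => k i i) <= 1 by rewrite mulrC ler_pdivrMr// mul1r.
  lra.
have H2 : \sum_(n < N) avg (big n) <= 2.
  apply: (@le_trans _ _ (\sum_(n < N) 2 * a n ^+ 2)); last first.
    by rewrite -mulr_sumr -[X in _ <= X]mulr1 ler_wpM2l.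
  apply: ler_sum => n _; rewrite -(real_normK (num_real (a n))).
  apply: le_trans (h_weak n (normr_ge0 (a n))).
  apply: avg_le => i; rewrite /big /w normrM (ger0_norm (h0 n i)); exact: lexx.
lra.
Qed.

(** A real Riesz product with coefficients [w n i / W i] in the interval from [-1] to [1], hence
    nonnegative; the factor [W i] restores the coefficient [w n i] of [r_n]. *)
Definition riesz_kernel (e : {ffun 'I_N -> bool}) i : R :=
  W i * \prod_(n < N) (1 + w n i / W i * sgn R (e n)).

Let thW n i : `|w n i / W i| <= 1.
Proof. by rewrite normrM normfV (gtr0_norm (Wgt0 i)) ler_pdivrMr// mul1r wW. Qed.

Lemma riesz_kernel_ge0 e i : 0 <= riesz_kernel e i.
Proof.
apply: mulr_ge0; first exact/ltW.
apply: prodr_ge0 => n _; have := thW n i; rewrite ler_norml => /andP[? ?].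
by case: (e n); rewrite /sgn; lra.
Qed.

Lemma riesz_kernel_coef n i :
  (2 ^+ N)^-1 * \sum_(e : {ffun 'I_N -> bool}) sgn R (e n) * riesz_kernel e i = a n * h n i.
Proof.
pose F m (b : bool) : R := (1 + w m i / W i * sgn R b) * (if m == n then sgn R b else 1).
transitivity ((2 ^+ N)^-1 * \sum_(e : {ffun 'I_N -> bool}) W i * \prod_(m < N) F m (e m)).
  congr (_ * _); apply: eq_bigr => e _; rewrite /riesz_kernel mulrCA; congr (_ * _).
  rewrite /F big_split /= mulrC; congr (_ * _).
  by rewrite (bigD1 n) //= eqxx big1 ?mulr1 // => m /negbTE ->.
rewrite -mulr_sumr mulrCA signs_mean_prod (bigD1 n) //= big1 => [|m /negbTE mn].
  rewrite /F eqxx /sgn mulr1 -/(w n i); field; by rewrite gt_eqF.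
by rewrite /F mn /sgn !mulr1; field; rewrite gt_eqF.
Qed.

(** By independence the mean is [W i * W j] times the product of [1 + th m i * th m j]. With [E] the
    sum of these products, [E <= l] gives [e^E <= 1 + E e^l], and [W i * W j * E] is [k i j]. *)
Let pair_bound i j : (2 ^+ N)^-1 * \sum_e riesz_kernel e i * riesz_kernel e j <=
  W i * W j + expR l * k i j.
Proof.
pose th m i := w m i / W i.
pose F m (b : bool) : R := (1 + th m i * sgn R b) * (1 + th m j * sgn R b).
have -> : (2 ^+ N)^-1 * \sum_e riesz_kernel e i * riesz_kernel e j =
    W i * W j * \prod_(m < N) (1 + th m i * th m j).
  transitivity ((2 ^+ N)^-1 * \sum_(e : {ffun 'I_N -> bool}) (W i * W j) * \prod_(m < N) F m (e m)).
    congr (_ * _); apply: eq_bigr => e _; rewrite /riesz_kernel mulrACA; congr (_ * _).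
    by rewrite -big_split.
  rewrite -mulr_sumr mulrCA signs_mean_prod; congr (_ * _); apply: eq_bigr => m _.
  by rewrite /F /sgn; field.
pose E := \sum_(m < N) th m i * th m j.
have th0 m : 0 <= th m i * th m j.
  rewrite /th mulrACA -invfM; apply: divr_ge0; last by apply: mulr_ge0; exact: ltW.
  by rewrite /w mulrACA -expr2; apply: mulr_ge0; [exact: sqr_ge0|exact: mulr_ge0].
have EE : W i * W j * E = k i j.
  rewrite /E mulr_sumr; apply: eq_bigr => m _; rewrite /th; field.
  by rewrite !gt_eqF.
have El : E <= l.
  apply: (@le_trans _ _ (\sum_(m < N) (2^-1 * th m i ^+ 2 + 2^-1 * th m j ^+ 2))).
    apply: ler_sum => m _; have := sqr_ge0 (th m i - th m j); rewrite sqrrB; lra.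
  rewrite big_split /= -!mulr_sumr.
  have S x : \sum_(m < N) th m x ^+ 2 <= l.
    have -> : \sum_(m < N) th m x ^+ 2 = k x x / W x ^+ 2.
      by rewrite /k mulr_suml; apply: eq_bigr => m _; rewrite /th exprMn exprVn expr2.
    by rewrite ler_pdivrMr ?exprn_gt0//; exact: kW.
  have := S i; have := S j; lra.
have E0 : 0 <= E by apply: sumr_ge0.
have P1 : \prod_(m < N) (1 + th m i * th m j) <= 1 + E * expR l.
  apply: (@le_trans _ _ (expR E)).
    rewrite /E expR_sum; apply: ler_prod => m _.
    by rewrite expR_ge1Dx andbT addr_ge0.
  have := ler_wpM2l (expR_ge0 E) (expR_ge1Dx (- E)); rewrite -expRD subrr expR0.
  have := ler_wpM2l E0 (_ : expR E <= expR l); rewrite ler_expR => /(_ El); lra.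
have WW : 0 <= W i * W j by rewrite mulr_ge0// ltW.
have := ler_wpM2l WW P1; rewrite -EE; lra.
Qed.

(* Second moment method: the products [riesz_kernel e i] for different points [i]
   are nearly uncorrelated on average, so their mean concentrates. *)
Lemma riesz_kernel_mean :
  (2 ^+ N)^-1 * \sum_e avg (riesz_kernel e) ^+ 2 <= 16 + B.
Proof.
have -> : (2 ^+ N)^-1 * \sum_e avg (riesz_kernel e) ^+ 2 =
    avg (fun i => avg (fun j => (2 ^+ N)^-1 * \sum_e riesz_kernel e i * riesz_kernel e j)).
  rewrite (_ : (fun i => _) = (fun i => (2 ^+ N)^-1 * \sum_e avg (fun j => riesz_kernel e i * riesz_kernel e j))).
    rewrite avgZ avg_sum; congr (_ * _); apply: eq_bigr => e _.
    by rewrite expr2 avgM.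
  by apply/funext => i; rewrite avgZ avg_sum.
apply: (@le_trans _ _ (avg (fun i => avg (fun j => W i * W j + expR l * k i j)))).
  by apply: avg_le => i; apply: avg_le => j; exact: pair_bound.
(* Averaging over [i] and [j] separately leaves only the means of the [h n], not their mean squares,
   so that [h1] absorbs the factor [e^l]. *)
have -> : avg (fun i => avg (fun j => W i * W j + expR l * k i j)) =
    avg W * avg W + expR l * \sum_(n < N) a n ^+ 2 * avg (h n) ^+ 2.
  rewrite avgM; transitivity (avg (fun i => avg (fun j => W i * W j)) + avg (fun i => avg (fun j => expR l * k i j))).
    by rewrite -avgD; congr avg; apply/funext => i; rewrite avgD.
  congr (_ + _); transitivity (expR l * avg (fun i => avg (fun j => k i j))).
    by rewrite -avgZ; congr avg; apply/funext => i; rewrite avgZ.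
  congr (_ * _).
  transitivity (avg (fun i => \sum_(n < N) a n ^+ 2 * (h n i * avg (h n)))).
    congr avg; apply/funext => i; rewrite /k avg_sum; apply: eq_bigr => n _.
    rewrite [RHS]mulrA -avgZ; congr avg; apply/funext => j; rewrite /w; ring.
  rewrite avg_sum; apply: eq_bigr => n _; rewrite expr2 [RHS]mulrA -avgZ.
  by congr avg; apply/funext => i; ring.
have W0 : 0 <= avg W.
  by apply: mulr_ge0 => //; apply: sumr_ge0 => i _; exact/ltW.
apply: lerD; first by have := ler_pM W0 W0 avgW avgW; lra.
rewrite mulr_sumr; apply: (@le_trans _ _ (\sum_(n < N) a n ^+ 2 * B)).
  apply: ler_sum => n _; rewrite mulrCA [expR l * _]mulrC.
  by apply: ler_wpM2l; [exact: sqr_ge0|exact: h1].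
by rewrite -mulr_suml ler_piMl.
Qed.

End RieszKernel.

(** * Harmonic sums and the extremal profile *)

Section Harmonic.
Variable R : realType.

Definition harmonic_sum (M : nat) : R := \sum_(i < M) i.+1%:R^-1.

Lemma harmonic_sum_expR_ge M : M.+1%:R <= expR (harmonic_sum M).
Proof.
rewrite /harmonic_sum; elim: M => [|M IH]; first by rewrite big_ord0 expR0.
have M0 : 0 < M.+1%:R :> R by rewrite ltr0n.
rewrite big_ord_recr /= expRD.
have -> : M.+2%:R = M.+1%:R * (1 + M.+1%:R^-1) :> R.
  by rewrite mulrDr mulr1 divff ?gt_eqF// natr1.
by apply: ler_pM => //; exact: expR_ge1Dx.
Qed.

(** The exponential of the harmonic sum is of linear size. In [profile_avg1] this cancels the
    inverse of the cut. *)
Lemma harmonic_sum_expR_le M : expR (harmonic_sum M.+1) <= expR 1 * M.+1%:R.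
Proof.
rewrite /harmonic_sum; elim: M => [|M IH]; first by rewrite big_ord1 invr1 mulr1.
rewrite big_ord_recr /= expRD; set u : R := M.+2%:R.
have u0 : 0 < u by rewrite ltr0n.
have uE : u = M.+1%:R + 1 by rewrite natr1.
have h : expR u^-1 * M.+1%:R <= u.
  have := expR_ge1Dx (- u^-1); rewrite expRN => h1.
  have h2 : expR u^-1 * (1 - u^-1) <= 1.
    by rewrite -[X in _ <= X](divff (lt0r_neq0 (expR_gt0 u^-1))) ler_wpM2l ?expR_ge0.
  have -> : M.+1%:R = (1 - u^-1) * u by rewrite mulrBl mul1r mulVf ?gt_eqF// uE; ring.
  by rewrite mulrA -[X in _ <= X]mul1r ler_wpM2r// ltW.
apply: le_trans (ler_wpM2r (expR_ge0 _) IH) _.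
by rewrite -mulrA ler_wpM2l ?expR_ge0// mulrC.
Qed.

Lemma harmonic_sum_unbounded (c : R) : exists M, c <= harmonic_sum M.+1.
Proof.
exists (Num.truncn (expR c)); rewrite -ler_expR.
by apply: le_trans (harmonic_sum_expR_ge _); apply: ltW; apply: lt_trans (truncnS_gt _) _; rewrite ltr_nat.
Qed.

Lemma rsqrt_step n : 2 * Num.sqrt n%:R + (Num.sqrt n.+1%:R)^-1 <= 2 * Num.sqrt n.+1%:R :> R.
Proof.
set u := Num.sqrt n%:R; set v := Num.sqrt n.+1%:R.
have u0 : 0 <= u := sqrtr_ge0 _.
have v0 : 0 < v by rewrite sqrtr_gt0 ltr0n.
have uv : v ^+ 2 = u ^+ 2 + 1 by rewrite !sqr_sqrtr// natr1.
have ulev : u <= v by rewrite ler_sqrt ?ler_nat.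
have : v^-1 * v = 1 by rewrite mulVf// gt_eqF.
set t := v^-1 => tv; rewrite -(ler_pM2r v0) mulrDl tv.
have := sqr_ge0 (v - u); rewrite sqrrB; move: uv; rewrite !expr2; nra.
Qed.

Lemma rsqrt_sum_le n (y : R) : 0 <= y ->
  \sum_(i < n) (if i.+1%:R <= y then (Num.sqrt i.+1%:R)^-1 else 0) <=
  2 * Num.sqrt (Num.min n%:R y).
Proof.
move=> y0; elim: n => [|n IH]; first by rewrite big_ord0 mulr_ge0// sqrtr_ge0.
rewrite big_ord_recr /=; case: ifP => hy.
  have E1 : Num.min n%:R y = n%:R.
    by apply/min_idPl; apply: le_trans hy; rewrite ler_nat.
  have E2 : Num.min n.+1%:R y = n.+1%:R by apply/min_idPl.
  rewrite E1 in IH; rewrite E2; apply: le_trans (rsqrt_step n); by rewrite lerD2r.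
rewrite addr0; apply: le_trans IH _; rewrite ler_wpM2l// ler_wsqrtr//.
rewrite le_min ge_min ge_min lexx orbT andbT.
by rewrite ler_nat leqnSn.
Qed.

Section Profile.
Variable M' : nat.
Let M := M'.+1.
Let m := (M ^ 2).-1.
Let mE : m.+1 = (M ^ 2)%N. Proof. by rewrite prednK// expn_gt0. Qed.
Let Mm : (M <= m.+1)%N. Proof. by rewrite mE -{1}(expn1 M) leq_pexp2l. Qed.
Local Notation K := 'I_m.+1.

(** [K] has [M ^ 2] elements, written as a successor so that the ordinals form a cyclic group. Thus
    [sqrt m.+1 = M], and the profile lives on the first [M] points. *)
Definition profile (i : K) : R :=
  if (i < M)%N then Num.sqrt m.+1%:R / Num.sqrt i.+1%:R else 0.

Let p : R := m.+1%:R.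
Let p0 : 0 < p. Proof. by rewrite ltr0n. Qed.
Let pM : p = M%:R ^+ 2. Proof. by rewrite /p mE natrX. Qed.
Let sp : Num.sqrt p = M%:R. Proof. by rewrite pM sqrtr_sqr ger0_norm. Qed.

Lemma profile_ge0 i : 0 <= profile i.
Proof. by rewrite /profile; case: ifP => // _; rewrite divr_ge0// sqrtr_ge0. Qed.

Let avg_head (F : nat -> R) :
  avg (fun i : K => if (i < M)%N then F i else 0) = p^-1 * \sum_(i < M) F i.
Proof.
rewrite /avg card_ord; congr (_ * _).
by rewrite -big_mkcond (big_ord_widen _ _ Mm).
Qed.

Lemma profile_avg2 : avg (fun i => profile i ^+ 2) = harmonic_sum M.
Proof.
transitivity (avg (fun i : K => if (i < M)%N then p / i.+1%:R else 0)).
  congr avg; apply/funext => i; rewrite /profile; case: ifP => _; last by rewrite expr0n.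
  by rewrite expr_div_n !sqr_sqrtr.
rewrite (avg_head (fun i => p / i.+1%:R)) /harmonic_sum mulr_sumr; apply: eq_bigr => i _.
by rewrite mulrA mulVf ?mul1r// gt_eqF.
Qed.

(** The mean is at most [2 / sqrt M] and [e^l <= e M] for the mean square [l], whence [4 e]. *)
Lemma profile_avg1 : avg profile ^+ 2 * expR (harmonic_sum M) <= 4 * expR 1.
Proof.
have H : avg profile <= 2 * Num.sqrt M%:R / M%:R.
  rewrite /profile (avg_head (fun i => Num.sqrt m.+1%:R / Num.sqrt i.+1%:R)) -mulr_sumr -/p sp pM.
  have M0 : 0 < M%:R :> R by rewrite ltr0n.
  rewrite mulrA (_ : (M%:R ^+ 2)^-1 * M%:R = M%:R^-1); last by field; rewrite gt_eqF.
  rewrite mulrC ler_wpM2r ?invr_ge0//.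
  have := rsqrt_sum_le M (ler0n R M); rewrite minxx; apply: le_trans.
  by apply: ler_sum => i _; rewrite ler_nat ltn_ord.
have a0 : 0 <= avg profile.
  by apply: mulr_ge0; [rewrite invr_ge0|apply: sumr_ge0 => i _; exact: profile_ge0].
have M0 : 0 < M%:R :> R by rewrite ltr0n.
have H2 : avg profile ^+ 2 <= 4 / M%:R.
  apply: le_trans (_ : (2 * Num.sqrt M%:R / M%:R) ^+ 2 <= _).
    by apply: lerXn2r => //; rewrite nnegrE; apply: le_trans H.
  rewrite expr_div_n exprMn sqr_sqrtr// le_eqVlt; apply/orP; left; apply/eqP.
  by field; rewrite gt_eqF.
apply: le_trans (ler_pM _ _ H2 (harmonic_sum_expR_le M')) _.
- exact: sqr_ge0.
- exact: expR_ge0.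
by rewrite le_eqVlt; apply/orP; left; apply/eqP; rewrite -/M; set w : R := M%:R in M0 *; field; rewrite gt_eqF.
Qed.

(** [c * profile i > 1] forces [i.+1 <= p c^2], and the sum of inverse roots up to there is at most
    [2 sqrt (p c^2)]. *)
Lemma profile_weak c : 0 <= c ->
  avg (fun i => if 1 < c * profile i then c * profile i else 0) <= 2 * c ^+ 2.
Proof.
move=> c0; have sp0 : 0 < Num.sqrt p by rewrite sqrtr_gt0.
apply: (@le_trans _ _ (avg (fun i : K => if (i < M)%N then
   (c * Num.sqrt p) * (if i.+1%:R <= p * c ^+ 2 then (Num.sqrt i.+1%:R)^-1 else 0) else 0))).
  apply: avg_le => i; rewrite /profile; case: (ltnP i M) => iM; last by rewrite mulr0 ltNge ler01.
  have si : 0 < Num.sqrt i.+1%:R :> R by rewrite sqrtr_gt0 ltr0n.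
  case: ifP => h; last by apply: mulr_ge0; [rewrite mulr_ge0// sqrtr_ge0|case: ifP => // _; rewrite invr_ge0 sqrtr_ge0].
  rewrite ifT; first by rewrite -mulrA.
  move: h; rewrite mulrA ltr_pdivlMr// mul1r => h.
  have : Num.sqrt i.+1%:R ^+ 2 <= (c * Num.sqrt p) ^+ 2 :> R.
    by apply: lerXn2r; rewrite ?nnegrE ?mulr_ge0 ?sqrtr_ge0// ltW.
  by rewrite exprMn [X in X <= _]sqr_sqrtr// (sqr_sqrtr (ltW p0)) mulrC.
rewrite (avg_head (fun i => (c * Num.sqrt p) * (if i.+1%:R <= p * c ^+ 2 then (Num.sqrt i.+1%:R)^-1 else 0))).
rewrite -mulr_sumr.
have pc : 0 <= p * c ^+ 2 by rewrite mulr_ge0 ?sqr_ge0// ltW.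
have S := rsqrt_sum_le M pc.
have S2 : 2 * Num.sqrt (Num.min M%:R (p * c ^+ 2)) <= 2 * (Num.sqrt p * c).
  rewrite ler_wpM2l//; apply: (@le_trans _ _ (Num.sqrt (p * c ^+ 2))).
    by rewrite ler_wsqrtr// ge_min lexx orbT.
  by rewrite (sqrtrM _ (ltW p0)) sqrtr_sqr ger0_norm.
have h : 0 <= p^-1 * (c * Num.sqrt p) by rewrite !mulr_ge0 ?sqrtr_ge0// invr_ge0 ltW.
rewrite mulrA; apply: le_trans (ler_wpM2l h (le_trans S S2)) _.
have -> : p^-1 * (c * Num.sqrt p) * (2 * (Num.sqrt p * c)) = 2 * c ^+ 2 * (p^-1 * Num.sqrt p ^+ 2) by ring.
by rewrite (sqr_sqrtr (ltW p0)) mulVf ?mulr1// gt_eqF.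
Qed.

Lemma avg_shift (F : K -> R) (g : K) : avg (fun i => F (g + i)) = avg F.
Proof. by rewrite /avg [in RHS](reindex_inj (addrI g)). Qed.

End Profile.
End Harmonic.

(** * R-bounded families that are not l2-bounded *)

Section BadFamily.
Variables (R : realType) (X Y : completeNormedModType R).
Variables (LX : banach_lattice X) (LY : banach_lattice Y) (y : Y) (M' : nat).
Local Notation M := M'.+1.
Local Notation m := (M ^ 2).-1.
Local Notation K := 'I_m.+1.
Local Notation h := (@profile R M').
Variables (x : nat -> X) (phi : K -> X -> R).
Hypothesis x0 : forall i, (i < m.+1)%N -> bl_le LX 0 (x i) /\ 1 <= `|x i|.
Hypothesis x1 : `|\sum_(i < m.+1) x i| <= 3 / 2.
Hypothesis phi_lin : forall i a u z, phi i (a *: u + z) = a * phi i u + phi i z.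
Hypothesis phi_le : forall i z, `|phi i z| <= 2 * `|z|.
Hypothesis phi_x : forall i j : K, phi i (x j) = (i == j)%:R.

Definition shifted_avg (g : K) (z : X) : R := avg (fun i : K => h (g + i) * phi i z).

Definition shift_family : set (X -> Y) :=
  [set T | exists g, T = fun z => shifted_avg g z *: y].

Let phi0 i : phi i 0 = 0.
Proof. by have := phi_lin i 1 0 0; rewrite scale1r addr0 mul1r; lra. Qed.

Let phi_sum (I : finType) i (c : I -> R) (z : I -> X) :
  phi i (\sum_j c j *: z j) = \sum_j c j * phi i (z j).
Proof.
elim/big_rec2 : _ => [|j u v _ <-]; first exact: phi0.
exact: phi_lin.
Qed.

Let hs0 g i : 0 <= h (g + i) := profile_ge0 R _.

Lemma shift_family_linear : shift_family `<=` bounded_linear (Y:=Y).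
Proof.
move=> _ [g ->]; split=> [a u z|].
  rewrite scalerA -scalerDl; congr (_ *: _).
  rewrite /shifted_avg -avgZ -avgD; congr avg; apply/funext => i; rewrite phi_lin; ring.
exists (avg (fun i : K => h (g + i)) * 2 * `|y|) => z.
rewrite normrZ mulrAC ler_wpM2r//.
have c0 : 0 <= #|K|%:R^-1 :> R by rewrite invr_ge0.
rewrite /shifted_avg /avg normrM ger0_norm// -!mulrA ler_wpM2l//.
apply: le_trans (ler_norm_sum _ _ _) _; rewrite mulr_suml; apply: ler_sum => i _.
by rewrite normrM (ger0_norm (hs0 g i)) ler_wpM2l.
Qed.

(** The factor [2] bounds the functionals [phi]; [16 + 4 e] is the bound [16 + B] of
    [riesz_kernel_mean] for the profile. *)
Definition riesz_const : R := 2 * Num.sqrt (16 + 4 * expR 1).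

Lemma riesz_const_gt0 : 0 < riesz_const.
Proof. by rewrite mulr_gt0// sqrtr_gt0 addr_gt0// mulr_gt0// expR_gt0. Qed.

Let K0 : (0 < #|K|)%N. Proof. by rewrite card_ord. Qed.

(** The dual form of an l2 estimate. Replacing [a_n h (g_n + i)] by the correlation of the kernel
    with [r_n] moves the [phi i] onto the signed sum of the [z n]; the kernel is nonnegative, so
    only its average over [i] counts, and Cauchy-Schwarz over the signs separates it from the
    norm. *)
Lemma shifted_avg_sum_le N (z : 'I_N -> X) (g : 'I_N -> K) (a : 'I_N -> R) :
  \sum_(n < N) a n ^+ 2 <= 1 ->
  \sum_(n < N) a n * shifted_avg (g n) (z n) <= riesz_const * rad_norm z.
Proof.
move=> a1.
pose hn (n : 'I_N) (i : K) : R := h (g n + i).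
have B0 : 0 <= 4 * expR 1 :> R by rewrite mulr_ge0// expR_ge0.
have hn0 n i : 0 <= hn n i by exact: hs0.
have l0 : 0 < harmonic_sum R M.
  by rewrite -expR_gt1; apply: lt_le_trans (harmonic_sum_expR_ge R M); rewrite ltr1n.
have hn2 n : avg (fun i => hn n i ^+ 2) <= harmonic_sum R M.
  by rewrite /hn (avg_shift (fun i => h i ^+ 2)) profile_avg2.
have hn1 n : avg (hn n) ^+ 2 * expR (harmonic_sum R M) <= 4 * expR 1.
  by rewrite /hn (avg_shift h); exact: profile_avg1.
have hnw n c : 0 <= c -> avg (fun i => if 1 < c * hn n i then c * hn n i else 0) <= 2 * c ^+ 2.
  move=> c0; rewrite /hn (avg_shift (fun i => if 1 < c * h i then c * h i else 0)).
  exact: profile_weak.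
pose f := riesz_kernel hn a (harmonic_sum R M).
have fmean := riesz_kernel_mean K0 B0 hn0 a1 l0 hn2 hn1 hnw.
have fcoef := riesz_kernel_coef hn a (harmonic_sum R M).
have f0 e i : 0 <= f e i by apply: riesz_kernel_ge0.
rewrite -/f in fmean fcoef.
have -> : \sum_(n < N) a n * shifted_avg (g n) (z n) =
    (2 ^+ N)^-1 * \sum_(e : {ffun 'I_N -> bool}) avg (fun i => f e i * phi i (sign_sum z e)).
  transitivity (avg (fun i => \sum_(n < N) (a n * hn n i) * phi i (z n))).
    rewrite avg_sum; apply: eq_bigr => n _; rewrite /shifted_avg -avgZ.
    by congr avg; apply/funext => i; rewrite mulrA.
  transitivity (avg (fun i => (2 ^+ N)^-1 * \sum_(e : {ffun 'I_N -> bool}) f e i * phi i (sign_sum z e))).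
    congr avg; apply/funext => i.
    under eq_bigr => n _ do rewrite -fcoef -mulrA mulr_suml.
    rewrite -mulr_sumr exchange_big /=; congr (_ * _); apply: eq_bigr => e _.
    rewrite /sign_sum phi_sum mulr_sumr; apply: eq_bigr => n _; ring.
  by rewrite avgZ avg_sum.
have avg0 e : 0 <= avg (f e) by apply: mulr_ge0; [rewrite invr_ge0|apply: sumr_ge0].
apply: (@le_trans _ _ ((2 ^+ N)^-1 * \sum_(e : {ffun 'I_N -> bool}) avg (f e) * (2 * `|sign_sum z e|))).
  rewrite ler_wpM2l ?pow2N_ge0//; apply: ler_sum => e _.
  rewrite mulrC -avgZ; apply: avg_le => i; rewrite mulrC.
  by apply: ler_wpM2r => //; apply: le_trans (ler_norm _) (phi_le _ _).
have P0 := pow2N_ge0 R N.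
set u := \sum_(e : {ffun 'I_N -> bool}) avg (f e) * _.
have u0 : 0 <= (2 ^+ N)^-1 * u.
  by apply: mulr_ge0 => //; apply: sumr_ge0 => e _; rewrite mulr_ge0// mulr_ge0.
have rhs0 : 0 <= riesz_const * rad_norm z.
  by apply: mulr_ge0; [exact/ltW/riesz_const_gt0|exact: rad_norm_ge0].
rewrite -ler_sqr ?nnegrE//.
rewrite exprMn [X in _ <= X]exprMn rad_norm_sqr.
have CS := sum_cauchy_schwarz (fun e : {ffun 'I_N -> bool} => avg (f e)) (fun e => 2 * `|sign_sum z e|).
rewrite -/u in CS; apply: le_trans (ler_wpM2l (sqr_ge0 _) CS) _.
have -> : riesz_const ^+ 2 = 4 * (16 + 4 * expR 1).
  rewrite exprMn sqr_sqrtr ?addr_ge0//; by rewrite expr2; ring.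
have -> : \sum_(e : {ffun 'I_N -> bool}) (2 * `|sign_sum z e|) ^+ 2 =
   4 * \sum_(e : {ffun 'I_N -> bool}) `|sign_sum z e| ^+ 2.
  by rewrite mulr_sumr; apply: eq_bigr => e _; ring.
rewrite /rad_pow; set A := \sum_(e : {ffun 'I_N -> bool}) avg (f e) ^+ 2 in fmean *.
set S := \sum_(e : {ffun 'I_N -> bool}) `|_| ^+ 2.
have S0 : 0 <= (2 ^+ N)^-1 * S by apply: mulr_ge0 => //; apply: sumr_ge0 => e _; exact: sqr_ge0.
have := ler_wpM2r S0 fmean; set w := (2 ^+ N)^-1; lra.
Qed.

(** All operators map into the line of [y], where orthogonality of the signs turns the Rademacher
    norm into the l2 norm of the coefficients. That norm is found by testing [shifted_avg_sum_le] on
    the normalised coefficients. *)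
Lemma shift_family_R_bounded : R_bounded_by shift_family (riesz_const * `|y|).
Proof.
move=> N z T TT.
have [g Tg] := choice TT.
pose c n := shifted_avg (g n) (z n).
have TE n : T n (z n) = c n *: y by rewrite Tg.
pose S := \sum_(n < N) c n ^+ 2.
have S0 : 0 <= S by apply: sumr_ge0 => n _; exact: sqr_ge0.
have main : Num.sqrt S <= riesz_const * rad_norm z.
  have [Sz|Sn] := eqVneq S 0.
    by rewrite Sz sqrtr0; apply: mulr_ge0; [exact/ltW/riesz_const_gt0|exact: rad_norm_ge0].
  have sp : 0 < Num.sqrt S by rewrite sqrtr_gt0 lt_neqAle eq_sym Sn.
  have := @shifted_avg_sum_le N z g (fun n => c n / Num.sqrt S).
  have -> : \sum_(n < N) (c n / Num.sqrt S) ^+ 2 = 1.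
    under eq_bigr do rewrite expr_div_n sqr_sqrtr//.
    by rewrite -mulr_suml divff.
  move=> /(_ (lexx _)); apply: le_trans.
  have -> : \sum_(n < N) c n / Num.sqrt S * shifted_avg (g n) (z n) = S / Num.sqrt S.
    by rewrite /S mulr_suml; apply: eq_bigr => n _; rewrite -/(c n) expr2 mulrAC.
  by rewrite ler_pdivlMr// -expr2 sqr_sqrtr.
apply: (@le_trans _ _ (Num.sqrt S * `|y|)); last first.
  by have := ler_wpM2r (normr_ge0 y) main; lra.
rewrite -ler_sqr ?nnegrE ?rad_norm_ge0 ?mulr_ge0 ?sqrtr_ge0//.
rewrite rad_norm_sqr exprMn sqr_sqrtr// (eq_rad_pow 2 TE).
rewrite /rad_pow.
have -> : \sum_(e : {ffun 'I_N -> bool}) `|sign_sum (fun n => c n *: y) e| ^+ 2 =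
    \sum_(e : {ffun 'I_N -> bool}) (\sum_(n < N) c n * sgn R (e n)) ^+ 2 * `|y| ^+ 2.
  apply: eq_bigr => e _.
  rewrite (_ : sign_sum _ e = (\sum_(n < N) c n * sgn R (e n)) *: y).
    by rewrite normrZ exprMn real_normK// num_real.
  by rewrite scaler_suml; apply: eq_bigr => n _; rewrite scalerA mulrC.
rewrite -mulr_suml mulrA ler_wpM2r ?sqr_ge0//.
have -> : (2 ^+ N)^-1 * \sum_(e : {ffun 'I_N -> bool}) (\sum_(n < N) c n * sgn R (e n)) ^+ 2 =
    \sum_(n < N) \sum_(k < N) c n * c k *
      ((2 ^+ N)^-1 * \sum_(e : {ffun 'I_N -> bool}) sgn R (e n) * sgn R (e k)).
  rewrite mulr_sumr; under eq_bigr => e _.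
    rewrite expr2 mulr_suml mulr_sumr.
    under eq_bigr do rewrite mulr_sumr mulr_sumr.
    over.
  rewrite exchange_big /=; apply: eq_bigr => n _; rewrite exchange_big /=; apply: eq_bigr => k _.
  by rewrite !mulr_sumr; apply: eq_bigr => e _; ring.
have orth (n k : 'I_N) : (2 ^+ N)^-1 * \sum_(e : {ffun 'I_N -> bool}) sgn R (e n) * sgn R (e k) = (n == k)%:R.
  case: eqP => [->|/eqP nk].
    under eq_bigr do rewrite -expr2 sgn_sqr.
    have -> : \sum_(e : {ffun 'I_N -> bool}) 1 = 2 ^+ N :> R by rewrite sumr_const card_ffun card_bool card_ord natrX.
    by rewrite mulVf// expf_neq0.
  pose F i (b : bool) : R := (if i == n then sgn R b else 1) * (if i == k then sgn R b else 1).
  transitivity ((2 ^+ N)^-1 * \sum_(e : {ffun 'I_N -> bool}) \prod_(i < N) F i (e i)).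
    congr (_ * _); apply: eq_bigr => e _; rewrite /F big_split /=; congr (_ * _).
      by rewrite (bigD1 n) //= eqxx big1 ?mulr1 // => i /negbTE ->.
    by rewrite (bigD1 k) //= eqxx big1 ?mulr1 // => i /negbTE ->.
  rewrite signs_mean_prod (bigD1 n) //= /F eqxx (negbTE nk) /sgn; lra.
rewrite le_eqVlt; apply/orP; left; apply/eqP; rewrite /S; apply: eq_bigr => n _.
rewrite (bigD1 n) //= orth eqxx mulr1 big1 ?addr0 ?expr2// => k kn.
by rewrite orth eq_sym (negbTE kn) mulr0.
Qed.

(** With [c = (p H)^(-1/2)] the numbers [c * h (g + i)], over [g], form a unit vector for every [i],
    so the sum of the [x i] dominates the square function of [z]. Each of the [p] operators sends
    [z g] to [(c * H) *: y], and [sqrt p * c * H = sqrt H]. *)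
Lemma shift_family_l2 C : l2_bounded_by LX LY shift_family C ->
  Num.sqrt (harmonic_sum R M) * `|y| <= 3 / 2 * `|C|.
Proof.
move=> HC.
set H := harmonic_sum R M; pose p : R := m.+1%:R.
have p0 : 0 < p by rewrite ltr0n.
have H0 : 0 < H.
  by rewrite -expR_gt1; apply: lt_le_trans (harmonic_sum_expR_ge R M); rewrite ltr1n.
pose c := (Num.sqrt (p * H))^-1.
have c2 : c ^+ 2 = (p * H)^-1 by rewrite exprVn sqr_sqrtr// mulr_ge0// ltW.
pose z (g : K) : X := \sum_(i : K) (c * h (g + i)) *: x i.
have sumg i : \sum_(g : K) (c * h (g + i)) ^+ 2 = 1.
  under eq_bigr do rewrite exprMn c2 addrC.
  rewrite -mulr_sumr; have := profile_avg2 R M'; rewrite -(avg_shift (fun j => h j ^+ 2) i) /avg card_ord.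
  rewrite -/p -/H => E; have -> : \sum_(g : K) h (i + g) ^+ 2 = p * H by rewrite -E mulrA divff ?mul1r// gt_eqF.
  by rewrite mulVf// mulf_neq0// gt_eqF.
have zub : vub LX z (\sum_(i < m.+1) x i).
  move=> b b1.
  have -> : \sum_(g < m.+1) b g *: z g = \sum_(i < m.+1) (\sum_(g < m.+1) b g * (c * h (g + i))) *: x i.
    under eq_bigr do rewrite /z scaler_sumr.
    rewrite exchange_big; apply: eq_bigr => i _ /=; rewrite scaler_suml.
    by apply: eq_bigr => g _; rewrite scalerA.
  apply: vle_sum => i _; rewrite -[X in bl_le _ _ X]scale1r; apply: vscalel_le; last by case: (x0 (ltn_ord i)).
  apply: le_trans (ler_norm _) _; rewrite -(@expr_le1 _ 2)// real_normK ?num_real//.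
  apply: le_trans (sum_cauchy_schwarz _ _) _; rewrite sumg mulr1//.
have [t tz] := sqfun_exists LX z.
have tn : `|t| <= 3 / 2 by apply: le_trans (sqfun_norm_le tz zub) x1.
pose T (g : K) : X -> Y := fun u => shifted_avg g u *: y.
have Tz g : T g (z g) = (c * H) *: y.
  rewrite /T; congr (_ *: _); rewrite /shifted_avg.
  have E i : phi i (z g) = c * h (g + i).
    rewrite /z (phi_sum i (fun j => c * h (g + j)) (fun j : K => x j)) (bigD1 i) //= phi_x eqxx mulr1.
    by rewrite big1 ?addr0// => j ji; rewrite phi_x eq_sym (negbTE ji) mulr0.
  transitivity (avg (fun i => c * h (g + i) ^+ 2)).
    by congr avg; apply/funext => i; rewrite E; ring.
  by rewrite avgZ (avg_shift (fun j => h j ^+ 2)) profile_avg2.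
have sT : is_sqfun LY (fun g => T g (z g)) (Num.sqrt H *: vabs LY y).
  have := is_sqfun_line LY (fun _ : K => c * H) y.
  have -> : \sum_(i < m.+1) (c * H) ^+ 2 = H.
    rewrite sumr_const card_ord -[_ *+ _]mulr_natl -/p exprMn c2; field.
    by rewrite !gt_eqF.
  by rewrite (_ : (fun g => T g (z g)) = fun=> (c * H) *: y)//; apply/funext => g; exact: Tz.
have TT g : shift_family (T g) by exists g.
have := HC _ z T TT _ _ sT tz.
rewrite normrZ (ger0_norm (sqrtr_ge0 _)) vnorm_abs => h1; apply: le_trans h1 _.
rewrite mulrC; apply: (@le_trans _ _ (`|t| * `|C|)); first by rewrite ler_wpM2l// ler_norm.
by rewrite ler_wpM2r.
Qed.

End BadFamily.

(** * Unions of R-bounded families *)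

Section UnionFamily.
Variables (R : realType) (X Y : completeNormedModType R).

(** Off [A] the vectors are set to zero and the operators to one fixed member of the family, so that
    the R-bound applies. If [A] is empty the family may have no member, hence the separate case. *)
Lemma rad_pow_one_family (TT : set (X -> Y)) (c : R) N (x : 'I_N -> X) (T : 'I_N -> X -> Y)
    (A : pred 'I_N) :
  TT `<=` bounded_linear (Y:=Y) -> R_bounded_by TT c -> (forall i, A i -> TT (T i)) ->
  rad_pow 2 (fun i => if A i then T i (x i) else 0) <= c ^+ 2 * rad_pow 2 x.
Proof.
move=> lin RT TA.
have [[i0 Ai0]|An] := pselect (exists i, A i); last first.
  rewrite (eq_rad_pow 2 (y := fun i => 0 *: (0 : Y))) => [|i].
    by rewrite rad_powZ normr0 expr0n mul0r mulr_ge0 ?sqr_ge0 ?rad_pow_ge0.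
  by rewrite scaler0; case: ifP => // Ai; exfalso; apply: An; exists i.
pose x' i := if A i then x i else 0.
pose T' i := if A i then T i else T i0.
have TT' i : TT (T' i) by rewrite /T'; case: ifP => [/TA|_] //; exact: TA.
have RT' := RT N x' T' TT'.
apply: (@le_trans _ _ (c ^+ 2 * rad_pow 2 x')); last first.
  by rewrite ler_wpM2l ?sqr_ge0//; exact: rad_pow_restrict.
rewrite -!rad_norm_sqr -exprMn.
have -> : rad_norm (fun i => if A i then T i (x i) else 0) = rad_norm (fun i => T' i (x' i)).
  rewrite !rad_normE; congr Num.sqrt; apply: eq_rad_pow => i; rewrite /T' /x'; case: ifP => // _.
  by have := bounded_linearZ 0 0 (lin _ (TA i0 Ai0)); rewrite !scale0r.
by apply: lerXn2r => //; rewrite nnegrE ?rad_norm_ge0//; apply: le_trans RT'; exact: rad_norm_ge0.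
Qed.

(** Sort the operators by family. The weight [2^(l + 1)] of [expr_sum_le] against the squared bound
    [4^-l] leaves [2 * 2^-l], with sum at most [4], the square of the claimed bound. *)
Lemma R_bounded_bigcup (TT : nat -> set (X -> Y)) :
  (forall k, TT k `<=` bounded_linear (Y:=Y)) -> (forall k, R_bounded_by (TT k) (2^-1 ^+ k)) ->
  R_bounded_by (\bigcup_k TT k) (2 : R).
Proof.
move=> lin RT N x T TTT.
have exk (i : 'I_N) : exists k, TT k (T i) by have [k _ Tk] := TTT i; exists k.
have [k Hk] := choice exk.
pose B := (\sum_(i < N) k i).+1.
have kB i : (k i < B)%N by rewrite ltnS (bigD1 i) //= leq_addr.
pose u (l : nat) i := if k i == l then T i (x i) else 0.
have sumE (i : 'I_N) : T i (x i) = \sum_(l < B) u l i.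
  rewrite (bigD1 (Ordinal (kB i))) //= /u eqxx big1 ?addr0// => l; rewrite -val_eqE /= eq_sym.
  by move=> /negbTE ->.
have signE e : sign_sum (fun i => T i (x i)) e = \sum_(l < B) sign_sum (u l) e.
  rewrite /sign_sum exchange_big /=; apply: eq_bigr => i _.
  by rewrite {1}sumE scaler_sumr.
rewrite -ler_sqr ?nnegrE ?mulr_ge0 ?rad_norm_ge0// exprMn !rad_norm_sqr.
apply: (@le_trans _ _ (\sum_(l < B) 2 ^+ l.+1 * rad_pow 2 (u l))).
  rewrite /rad_pow; under [X in _ <= X]eq_bigr do rewrite mulrCA.
  rewrite -mulr_sumr ler_wpM2l ?pow2N_ge0//.
  under [X in _ <= X]eq_bigr do rewrite mulr_sumr.
  rewrite exchange_big /=; apply: ler_sum => e _; rewrite signE.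
  apply: (@le_trans _ _ ((\sum_(l < B) `|sign_sum (u l) e|) ^+ 2)).
    by apply: lerXn2r; rewrite ?nnegrE ?sumr_ge0//; exact: ler_norm_sum.
  have := expr_sum_le 1 B (y := fun l => `|sign_sum (u l) e|) (fun l => normr_ge0 _).
  by under [X in _ <= X -> _]eq_bigr do rewrite muln1.
apply: (@le_trans _ _ (\sum_(l < B) 2 * rad_pow 2 x * 2^-1 ^+ l)).
  apply: ler_sum => l _.
  have := @rad_pow_one_family (TT l) (2^-1 ^+ l) N x T (fun i => k i == l) (lin l) (RT l).
  rewrite -/(u l) => H; have e2 : 0 <= 2 ^+ l.+1 :> R by rewrite exprn_ge0.
  apply: le_trans (ler_wpM2l e2 (H _)) _; first by move=> i /eqP <-.
  rewrite le_eqVlt; apply/orP; left; apply/eqP.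
  have d : 2 ^+ l * 2^-1 ^+ l = 1 :> R by rewrite -exprMn divff ?expr1n.
  rewrite (exprS 2 l) (expr2 (2^-1 ^+ l)); set v := 2^-1 ^+ l in d *; set w := 2 ^+ l in d *.
  rewrite (_ : 2 * w * (v * v * rad_pow 2 x) = 2 * rad_pow 2 x * v * (w * v)); last by ring.
  by rewrite d mulr1.
rewrite -mulr_sumr.
have h : 0 <= 2 * rad_pow 2 x by rewrite mulr_ge0// rad_pow_ge0.
have := ler_wpM2l h (geom_half_le R B); rewrite expr2; lra.
Qed.

End UnionFamily.

Section Converse.
Variables (R : realType) (X Y : completeNormedModType R).
Variables (LX : banach_lattice X) (LY : banach_lattice Y).

Lemma bad_family (k : nat) : nonzero_space Y -> ~ finite_cotype X ->
  exists TT : set (X -> Y), [/\ TT `<=` bounded_linear (Y:=Y),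
    R_bounded_by TT (2^-1 ^+ k) &
    forall C, l2_bounded_by LX LY TT C -> k%:R <= `|C|].
Proof.
move=> [y y0] nfc.
have yp : 0 < `|y| by rewrite normr_gt0.
have c0 := riesz_const_gt0 R.
have k0 : 0 < 2^-1 ^+ k :> R by rewrite exprn_gt0// invr_gt0.
(* Scaling [y] by [a] makes the R-bound exactly [2^-k]. The number [b] below is then what the root
   of the harmonic sum must reach for an l2-bound of at least [k]. *)
pose a : R := 2^-1 ^+ k / (riesz_const R * `|y|).
have a0 : 0 < a by rewrite divr_gt0// mulr_gt0.
have ay : riesz_const R * `|a *: y| = 2^-1 ^+ k.
  by rewrite normrZ gtr0_norm// /a mulrCA divfK// gt_eqF// mulr_gt0.
have ayp : 0 < `|a *: y| by rewrite normrZ mulr_gt0// normr_gt0 gt_eqF.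
pose b : R := (3 / 2 * k%:R) / `|a *: y|.
have b0 : 0 <= b by rewrite divr_ge0// mulr_ge0.
have [M' HM] := harmonic_sum_unbounded (b ^+ 2).
have [x [x0 x1]] := @not_cotype_positive_linfty R X LX (M'.+1 ^ 2).-1.+1 nfc.
have [phi Hphi] := biorthogonal_functionals x0 x1.
exists (shift_family (a *: y) phi); split.
- apply: shift_family_linear => i; by have [] := Hphi i.
- rewrite -ay; apply: shift_family_R_bounded => i; by have [] := Hphi i.
move=> C HC.
have : Num.sqrt (harmonic_sum R M'.+1) * `|a *: y| <= 3 / 2 * `|C|.
  by apply: (shift_family_l2 x0 x1 _ _ HC) => i; have [] := Hphi i.
have : b * `|a *: y| <= Num.sqrt (harmonic_sum R M'.+1) * `|a *: y|.
  by rewrite ler_wpM2r// -[b]ger0_norm// -sqrtr_sqr ler_wsqrtr.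
rewrite /b divfK ?gt_eqF//; lra.
Qed.

Lemma R_l2_finite_cotype : nonzero_space Y ->
  (forall TT : set (X -> Y), TT `<=` bounded_linear (Y:=Y) ->
     R_bounded TT -> l2_bounded LX LY TT) -> finite_cotype X.
Proof.
move=> nzY H; apply: contrapT => nfc.
have [TT HTT] := choice (fun k => bad_family k nzY nfc).
have [] := H (\bigcup_k TT k).
- by move=> T [k _ Tk]; have [lin _ _] := HTT k; exact: lin.
- exists 2; apply: R_bounded_bigcup => k; by have [] := HTT k.
move=> C HC.
have [_ _ big] := HTT (Num.truncn `|C|).+1.
have : (Num.truncn `|C|).+1%:R <= `|C|.
  apply: big => N x T TTT; apply: HC => i; exists (Num.truncn `|C|).+1 => //; exact: TTT.
by rewrite leNgt truncnS_gt.
Qed.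

End Converse.

(** * Consequences of finite cotype and the constants *)

Section Direct.
Variables (R : realType) (X : completeNormedModType R) (LX : banach_lattice X).

Lemma finite_cotype_square_function : finite_cotype X -> exists A : R, 0 <= A /\
  forall N (x : 'I_N -> X) t, vub LX x t -> (gauss_norm2 x <= ((A * `|t|) ^+ 2)%:E)%E.
Proof.
move=> /(finite_cotype_pos_concave LX)[q [C conc]].
have [A [A0 HA]] := gauss_le_vub conc.
exists (Num.sqrt A); split=> [|N x t xt]; first exact: sqrtr_ge0.
by rewrite exprMn sqr_sqrtr//; exact: HA.
Qed.

Variables (A : R) (A0 : 0 <= A).
Hypothesis HA : forall N (x : 'I_N -> X) t, vub LX x t ->
  (gauss_norm2 x <= ((A * `|t|) ^+ 2)%:E)%E.

(** [e] bounds the square function by the Rademacher mean, the inverse of [gprob_ge1] passes from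
    Rademacher to Gaussian means, and [A] returns from Gaussian means to square functions. The same
    product serves both the l2-bound and the R-bound. *)
Definition cotype_const : R := expR 1 * (gprob_ge1 R)^-1 * A.

Lemma cotype_const_ge0 : 0 <= cotype_const.
Proof. by rewrite !mulr_ge0 ?expR_ge0// invr_ge0 ltW// gprob_ge1_gt0. Qed.

Let p := gprob_ge1 R.
Let p0 : 0 < p := gprob_ge1_gt0 R.

Lemma rad_le_of_gauss (Z : completeNormedModType R) N (z : 'I_N -> Z) (c : R) : 0 <= c ->
  (gauss_norm2 z <= (c ^+ 2)%:E)%E -> rad_norm z <= p^-1 * c.
Proof.
move=> c0 H; have := le_trans (rad_le_gauss z) H; rewrite -EFinM lee_fin -exprMn.
have h : 0 <= p * rad_norm z by rewrite mulr_ge0 ?rad_norm_ge0// (ltW p0).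
by rewrite ler_sqr ?nnegrE// ler_pdivlMl.
Qed.

(** The hypothesis is applied to [rad_bound] instead of the square function; this is where estimates
    for arbitrary upper bounds pay off. *)
Lemma gauss_le_rad N (x : 'I_N -> X) :
  (gauss_norm2 x <= ((A * expR 1 * rad_norm x) ^+ 2)%:E)%E.
Proof.
apply: le_trans (HA (@rad_bound_vub _ _ LX _ x)) _; rewrite lee_fin.
have h : `|rad_bound LX x| <= expR 1 * rad_norm x.
  by apply: le_trans (rad_bound_norm LX x) _; rewrite ler_wpM2l ?expR_ge0// rad_pow1_le.
apply: lerXn2r; rewrite ?nnegrE ?mulr_ge0 ?expR_ge0 ?rad_norm_ge0//.
by rewrite -mulrA ler_wpM2l.
Qed.

Variables (Y : completeNormedModType R) (LY : banach_lattice Y) (TT : set (X -> Y)).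

Lemma gamma_gauss_le N (x : 'I_N -> X) (T : 'I_N -> X -> Y) C b :
  gamma_bounded_by TT C -> (forall i, TT (T i)) -> (gauss_norm2 x <= (b ^+ 2)%:E)%E ->
  (gauss_norm2 (fun i => T i (x i)) <= ((`|C| * b) ^+ 2)%:E)%E.
Proof.
move=> GT TTT Hb; apply: le_trans (GT N x T TTT) _.
rewrite exprMn (EFinM (`|C| ^+ 2)) real_normK ?num_real// lee_wpmul2l//.
by rewrite lee_fin sqr_ge0.
Qed.

Lemma gamma_l2_bounded_by C : gamma_bounded_by TT C ->
  l2_bounded_by LX LY TT (cotype_const * `|C|).
Proof.
move=> GT N x T TTT s t sT tx.
apply: le_trans (khintchine_lower sT) _.
have h := rad_le_of_gauss _ (gamma_gauss_le GT TTT (HA (is_sqfun_vub tx))).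
have := ler_wpM2l (expR_ge0 1) (h _); rewrite /cotype_const -/p.
rewrite (_ : expR 1 * (p^-1 * (`|C| * (A * `|t|))) = expR 1 * p^-1 * A * `|C| * `|t|); last by ring.
by apply; rewrite !mulr_ge0.
Qed.

Lemma R_l2_bounded_by C : TT `<=` bounded_linear (Y:=Y) -> 0 <= C -> R_bounded_by TT C ->
  l2_bounded_by LX LY TT (cotype_const * C).
Proof.
move=> lin C0 /(R_bounded_gamma lin) /gamma_l2_bounded_by; by rewrite ger0_norm.
Qed.

Lemma gamma_R_bounded_by C : 0 <= C -> gamma_bounded_by TT C ->
  R_bounded_by TT (cotype_const * C).
Proof.
move=> C0 GT N x T TTT.
have b0 : 0 <= `|C| * (A * expR 1 * rad_norm x) by rewrite !mulr_ge0 ?expR_ge0 ?rad_norm_ge0.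
have := rad_le_of_gauss b0 (gamma_gauss_le GT TTT (gauss_le_rad x)).
move/le_trans; apply; rewrite le_eqVlt; apply/orP; left; apply/eqP.
by rewrite /cotype_const -/p ger0_norm//; ring.
Qed.

End Direct.

(** Infinite bounds are included: without an admissible constant the infimum is [+oo], and a
    positive factor [k] preserves that. *)
Lemma ereal_inf_scale (R : realType) (P Q : R -> Prop) (k : R) : 0 < k ->
  (forall C, 0 <= C -> P C -> Q (k * C)) ->
  (ereal_inf [set C%:E | C in [set C : R | (0 <= C)%R /\ Q C]] <=
   k%:E * ereal_inf [set C%:E | C in [set C : R | (0 <= C)%R /\ P C]])%E.
Proof.
move=> k0 PQ; rewrite -lee_pdivrMl//; apply: le_ereal_inf_tmp => _ [C [C0 PC] <-].
rewrite lee_pdivrMl//; apply: ereal_inf_lbound; exists (k * C); last by rewrite EFinM.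
by split; [rewrite mulr_ge0// ltW|exact: PQ].
Qed.

Section Monotone.
Variables (R : realType) (X Y : completeNormedModType R) (TT : set (X -> Y)).

Lemma R_bounded_by_le (c d : R) : c <= d -> R_bounded_by TT c -> R_bounded_by TT d.
Proof.
move=> cd H N x T TTT; apply: le_trans (H N x T TTT) _.
by rewrite ler_wpM2r// rad_norm_ge0.
Qed.

Lemma l2_bounded_by_le LX LY (c d : R) : c <= d -> l2_bounded_by LX LY TT c ->
  l2_bounded_by LX LY TT d.
Proof.
move=> cd H N x T TTT s t sT tx; apply: le_trans (H N x T TTT s t sT tx) _.
by rewrite ler_wpM2r.
Qed.

End Monotone.

Theorem mainTheorem14 (R : realType)
    (X Y : completeNormedModType R) (LX : banach_lattice X) (LY : banach_lattice Y)
    (nzX : nonzero_space X) (nzY : nonzero_space Y) :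
  ((forall TT : set (X -> Y), TT `<=` bounded_linear (Y:=Y) ->
       R_bounded TT -> l2_bounded LX LY TT) <->
   (forall TT : set (X -> Y), TT `<=` bounded_linear (Y:=Y) ->
       gamma_bounded TT -> l2_bounded LX LY TT)) /\
  ((forall TT : set (X -> Y), TT `<=` bounded_linear (Y:=Y) ->
       gamma_bounded TT -> l2_bounded LX LY TT) <->
   finite_cotype X) /\
  (finite_cotype X ->
   exists CX : R, 0 < CX /\
     forall (Y' : completeNormedModType R) (LY' : banach_lattice Y'),
       nonzero_space Y' ->
       forall TT : set (X -> Y'), TT `<=` bounded_linear (Y:=Y') ->
         (L2bound LX LY' TT <= CX%:E * Rbound TT)%E /\
         ((CX^-1)%:E * Rbound TT <= Gbound TT)%E /\
         (Gbound TT <= CX%:E * Rbound TT)%E).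
Proof.
have ii_i : (forall TT : set (X -> Y), TT `<=` bounded_linear (Y:=Y) ->
     gamma_bounded TT -> l2_bounded LX LY TT) ->
   forall TT : set (X -> Y), TT `<=` bounded_linear (Y:=Y) ->
     R_bounded TT -> l2_bounded LX LY TT.
  by move=> H TT lin [C RT]; apply: H => //; exists C; exact: R_bounded_gamma.
have i_iii := @R_l2_finite_cotype R X Y LX LY nzY.
have iii_ii : finite_cotype X -> forall TT : set (X -> Y), TT `<=` bounded_linear (Y:=Y) ->
    gamma_bounded TT -> l2_bounded LX LY TT.
  move=> /(finite_cotype_square_function LX)[A [A0 HA]] TT _ [C GT].
  by exists (cotype_const A * `|C|); exact: gamma_l2_bounded_by.
split; [|split].
- by split=> [/i_iii/iii_ii|/ii_i].
- by split=> [/ii_i/i_iii|/iii_ii].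
move=> /(finite_cotype_square_function LX)[A [A0 HA]].
have k0 := cotype_const_ge0 A0; set k := cotype_const A in k0.
(* Adding [1] to [k] makes the constant positive and at least one; the latter covers the
   gamma-bound, which never exceeds the R-bound. *)
exists (1 + k); split; first by rewrite ltr_pwDl.
move=> Y' LY' _ TT lin; have k1 : 0 < 1 + k by rewrite ltr_pwDl.
have le_k C : 0 <= C -> k * C <= (1 + k) * C by move=> C0; rewrite ler_wpM2r// lerDr.
have le_1 C : 0 <= C -> C <= (1 + k) * C by move=> C0; rewrite ler_peMl// lerDl.
split; [|split].
- apply: ereal_inf_scale => // C C0 RT; apply: l2_bounded_by_le (le_k C C0) _.
  exact: R_l2_bounded_by.
- rewrite lee_pdivrMl//; apply: ereal_inf_scale => // C C0 GT.
  apply: R_bounded_by_le (le_k C C0) _.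
  exact: (gamma_R_bounded_by A0 HA).
- apply: ereal_inf_scale => // C C0 RT; apply: R_bounded_gamma => //.
  exact: R_bounded_by_le (le_1 C C0) RT.
Qed.
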